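(* Let $k\ge1$, $B>0$, let $Q_g(X)[dX]$ be the ground-state probability measure on the space of $N\times N$ Hermitian matrices of the Chern-Simons matrix model with $p=1$ and level $k$, let $x_1,\dots,x_N$ be the eigenvalues of $X$, and let $\rho_N(x)=\frac1N\sum_{i=1}^N\delta(x-x_i)$ be the density of eigenvalues. Then, as $N\to\infty$, the leading term of the expectation value of $\rho_N(x)$ is a rescaled semicircle distribution: $$E_g(\rho_N(x))=\frac2{\pi R^2}\sqrt{R^2-x^2}\;\mathbf 1_{[-R,R]}(x)+\text{lower order terms},\qquad R=\sqrt{\frac{2(k+1)N}B}.$$
   Context: The measure. The ground state wave function is a function of an $N\times N$ Hermitian matrix $X$ and the complex conjugate $\bar\lambda$ of a vector $\lambda\in\mathbb C^N$: $$\Psi_{gr}(X,\bar\lambda)=\mathrm{const}\cdot\left[\epsilon^{i_1i_2\cdots i_N}\bar\lambda_{i_1}(\bar\lambda X)_{i_2}(\bar\lambda X^2)_{i_3}\cdots(\bar\lambda X^{N-1})_{i_N}\right]^ke^{-\frac B2\mathrm{Tr}(X^2)},$$ where $\epsilon^{i_1\cdots i_N}$ is the Levi-Civita symbol. $\lambda$ labels coherent states, so the resolution of the identity carries the Gaussian weight $e^{-\lambda^\dagger\lambda}$. With $[dX]$ a constant multiple of $\prod_idX_{ii}\prod_{i<j}d\,\mathrm{Re}X_{ij}\,d\,\mathrm{Im}X_{ij}$, the density $Q_g$ is obtained by integrating out $\lambda$: $$Q_g(X)=\int d\lambda\,d\lambda^\dagger\,e^{-\lambda^\dagger\lambda}\,|\Psi_{gr}(X,\bar\lambda)|^2,$$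 with the constant chosen so that $\int[dX]\,Q_g(X)=1$. $E_g$ denotes expectation with respect to $Q_g(X)[dX]$. Meaning of the leading term. In the rescaled variable $\tilde x=\sqrt{\frac{2B}{(k+1)N}}\,x$, the expected eigenvalue density $E_g\left(\frac1N\sum_i\delta(\tilde x-\tilde x_i)\right)$ converges as $N\to\infty$ (as a measure) to $\frac1{2\pi}\sqrt{4-\tilde x^2}\,\mathbf 1_{[-2,2]}(\tilde x)$. *)

(* Defs.v *)
From HB Require Import structures.
From mathcomp Require Import all_boot all_order all_algebra all_fingroup.
From mathcomp Require Import spectral.
From mathcomp Require Import complex.
From mathcomp Require Import all_classical all_reals all_analysis.

Set Implicit Arguments.
Unset Strict Implicit.
Unset Printing Implicit Defensive.

Import Order.TTheory GRing.Theory Num.Theory.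
Import numFieldNormedType.Exports.

Local Open Scope classical_set_scope.
Local Open Scope ring_scope.

Section prod_measure.
Local Open Scope ereal_scope.
Context d1 d2 (T1 : measurableType d1) (T2 : measurableType d2) (R : realType).
Variable m1 : {sigma_finite_measure set T1 -> \bar R}.
Variable m2 : {sigma_finite_measure set T2 -> \bar R}.

(* The library's sigma-finite structure on m1 \x m2 is shadowed by the
   sub-probability one, hence this alias. *)
Definition prod_measure : set (T1 * T2) -> \bar R := m1 \x m2.

HB.instance Definition _ := Measure.on prod_measure.

Let prod_measure_sigma_finite : sigma_finite setT prod_measure.
Proof.
have /sigma_finiteP[F [TF ndF Foo]] := sigma_finiteT m1.
have /sigma_finiteP[G [TG ndG Goo]] := sigma_finiteT m2.
exists (fun n => F n `*` G n).
  rewrite -setXTT TF TG predeqE => -[x y]; split.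
    move=> [/= [n _ Fnx] [k _ Gky]]; exists (maxn n k) => //; split.
    - by move: x Fnx; exact/subsetPset/ndF/leq_maxl.
    - by move: y Gky; exact/subsetPset/ndG/leq_maxr.
  by move=> [n _ []/= ? ?]; split; exists n.
move=> k; have [? ?] := Foo k; have [? ?] := Goo k.
split; first exact: measurableX.
by rewrite /prod_measure product_measure1E// lte_mul_pinfty// ge0_fin_numE.
Qed.

HB.instance Definition _ := Measure_isSigmaFinite.Build _ _ _ prod_measure
  prod_measure_sigma_finite.

End prod_measure.

Section tuple_measure.
Context d (T : measurableType d) (R : realType).
Variable mu : {sigma_finite_measure set T -> \bar R}.

Definition cons_tuple n (p : T * n.-tuple T) : n.+1.-tuple T :=
  [tuple of p.1 :: p.2].

Definition uncons_tuple n (t : n.+1.-tuple T) : T * n.-tuple T :=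
  (thead t, [tuple of behead t]).

Lemma measurable_cons_tuple n : measurable_fun setT (@cons_tuple n).
Proof. exact: (measurable_cons measurable_fst measurable_snd). Qed.

Lemma measurable_uncons_tuple n : measurable_fun setT (@uncons_tuple n).
Proof.
apply/measurable_fun_pairP; split.
  exact: (measurable_tnth ord0).
exact: measurable_behead.
Qed.

Lemma cons_tupleK n : cancel (@cons_tuple n) (@uncons_tuple n).
Proof. by move=> [x t]; congr pair; exact/val_inj. Qed.

Section step.
Variables (n : nat) (nu : {sigma_finite_measure set (n.-tuple T) -> \bar R}).

Definition cons_measure : set (n.+1.-tuple T) -> \bar R :=
  pushforward (prod_measure mu nu) (@cons_tuple n).

Let preE A : measurable A -> measurable (@cons_tuple n @^-1` A).
Proof.
by move=> mA; rewrite -[X in measurable X]setTI; exact: measurable_cons_tuple.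
Qed.

Let cons_measure0 : cons_measure set0 = 0%E.
Proof. by rewrite /cons_measure /pushforward preimage_set0 measure0. Qed.

Let cons_measure_ge0 A : (0 <= cons_measure A)%E.
Proof. by rewrite /cons_measure /pushforward; exact: measure_ge0. Qed.

Let cons_measure_sigma_additive : semi_sigma_additive cons_measure.
Proof.
move=> F mF tF mUF; rewrite /cons_measure /pushforward preimage_bigcup.
apply: measure_semi_sigma_additive.
- by move=> ?; exact: preE.
- apply/trivIsetP => /= i j _ _ ij; rewrite -preimage_setI.
  by move/trivIsetP : tF => /(_ _ _ _ _ ij) ->//; rewrite preimage_set0.
- by rewrite -preimage_bigcup; exact: preE.
Qed.

HB.instance Definition _ := isMeasure.Build _ _ _ cons_measure
  cons_measure0 cons_measure_ge0 cons_measure_sigma_additive.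

Let cons_measure_sigma_finite : sigma_finite setT cons_measure.
Proof.
have [F TF Foo] : sigma_finite setT (prod_measure mu nu)
  by exact: sigma_finiteT.
exists (fun i => @uncons_tuple n @^-1` (F i)).
  by rewrite -preimage_bigcup -TF preimage_setT.
move=> i; have [mF Fi] := Foo i; split.
  by rewrite -[X in measurable X]setTI; exact: measurable_uncons_tuple.
rewrite /cons_measure /pushforward -comp_preimage.
by rewrite (_ : _ \o _ = id)//; apply/funext => p /=; rewrite cons_tupleK.
Qed.

HB.instance Definition _ := Measure_isSigmaFinite.Build _ _ _ cons_measure
  cons_measure_sigma_finite.

End step.

(* The n-fold product measure mu x ... x mu on n-tuples. *)
Fixpoint tuple_measure n : {sigma_finite_measure set (n.-tuple T) -> \bar R} :=
  if n is m.+1 then cons_measure (tuple_measure m) else \d_([tuple] : 0.-tuple T).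

Lemma tuple_measure_box n (A : 'I_n -> set T) :
  (forall i, measurable (A i)) ->
  tuple_measure n [set t | forall i, A i (tnth t i)] = (\prod_i mu (A i))%E.
Proof.
elim: n A => [|n IHn] A mA /=.
  by rewrite big_ord0 diracE mem_set //; case.
rewrite big_ord_recl -IHn; last by move=> i; exact: mA.
rewrite /cons_measure /pushforward -product_measure1E//; last first.
  rewrite (_ : mkset _ = \bigcap_(i in [set: 'I_n])
      ((@tnth n T)^~ i @^-1` A (lift ord0 i))).
    apply: fin_bigcap_measurable => // i _; rewrite -[X in measurable X]setTI.
    by apply: measurable_tnth => //; exact: mA.
  by apply/seteqP; split=> t tA i; [move=> _|]; exact: tA.
congr (_ _); apply/seteqP; split=> -[x t] /=.
  move=> xtA; split; first by have := xtA ord0.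
  by move=> i; have := xtA (lift ord0 i); rewrite tnthS.
move=> [/= x0 tA] i; have [j ->|->//] := unliftP ord0 i.
by rewrite tnthS; exact: tA.
Qed.

End tuple_measure.

Section matrix_model.
Variable R : realType.
Local Notation C := R[i].
Local Notation leb := (@lebesgue_measure R).
Local Notation normc := ComplexField.Normc.normc.

(* Real coordinates on C^N (pairs of real and imaginary parts), and the
   Lebesgue measure d lambda d lambda^dagger in these coordinates. *)
Definition vec_of N (l : N.-tuple (R * R)) : 'rV[C]_N :=
  \row_i ((tnth l i).1 +i* (tnth l i).2)%C.

Definition vec_measure N :=
  tuple_measure (prod_measure leb leb) N.

(* Real coordinates on Hermitian matrices: the N^2 coordinates t are X_ii on the
   diagonal, Re X_ij above it (i < j), and Im X_ij at the transposed position
   (j, i) below it. *)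
Definition herm_of N (t : N.-tuple (N.-tuple R)) : 'M[C]_N :=
  \matrix_(i, j)
    if (i < j)%N then (tnth (tnth t i) j +i* tnth (tnth t j) i)%C
    else if (j < i)%N then (tnth (tnth t j) i -i* tnth (tnth t i) j)%C
    else (tnth (tnth t i) i)%:C%C.

Lemma herm_of_hermitian N (t : N.-tuple (N.-tuple R)) :
  herm_of t \is hermsymmx.
Proof.
apply/is_hermitianmxP; rewrite expr0 scale1r.
apply/matrixP => i j; rewrite !mxE.
have [ij|ji|ij] := ltngtP i j => //.
- by apply/eqP; rewrite eq_complex /= opprK !eqxx.
- by have /val_inj -> := ij; apply/eqP; rewrite eq_complex /= oppr0 !eqxx.
Qed.

Definition herm_measure N :=
  tuple_measure (tuple_measure leb N) N.

(* The contraction with the Levi-Civita symbol is a sum over permutations,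
   namely the determinant whose m-th row is lbar X^m. As X is Hermitian,
   Tr X^2 is real, and the Gaussian factor is a real exponential. *)
Definition Psi_gr (c : R) (k : nat) (B : R) N (X : 'M[C]_N) (lbar : 'rV[C]_N)
    : C :=
  c%:C%C
  * (\sum_(s : 'S_N) (-1) ^+ s * \prod_(m < N) (lbar *m X ^+ m) 0 (s m)) ^+ k
  * (expR (- (B / 2) * complex.Re (\tr (X ^+ 2))))%:C%C.

(* The density obtained by integrating out lambda in |Psi_gr|^2 against
   e^{-lambda^dagger lambda}, with overall constant c in Psi_gr. *)
Definition Q_const (c : R) (k : nat) (B : R) N (X : 'M[C]_N) : \bar R :=
  (\int[@vec_measure N]_l
     (expR (- \sum_i normc (vec_of l 0 i) ^+ 2)
      * normc (Psi_gr c k B X (map_mx Num.conj (vec_of l))) ^+ 2)%:E)%E.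

(* |Psi_gr|^2 is homogeneous of degree 2 in c, so this is the positive c for
   which Q_const c k B integrates to 1. *)
Definition gr_const (k : nat) (B : R) N : R :=
  (Num.sqrt (fine (\int[@herm_measure N]_t Q_const 1 k B (herm_of t))%E))^-1.

Definition Q_g (k : nat) (B : R) N (X : 'M[C]_N) : \bar R :=
  Q_const (gr_const k B N) k B X.

Definition E_g (k : nat) (B : R) N (F : 'M[C]_N -> R) : \bar R :=
  (\int[@herm_measure N]_t ((F (herm_of t))%:E * Q_g k B (herm_of t)))%E.

(* [spectral_diag X] lists the eigenvalues of X with multiplicity; they are
   real when X is Hermitian. *)
Definition eigval N (X : 'M[C]_N) (i : 'I_N) : R :=
  complex.Re (spectral_diag X 0 i).

(* The integral of f against the eigenvalue density
   N^-1 \sum_i delta(x - s * x_i), where the x_i are the eigenvalues of X. *)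
Definition density_scaled N (s : R) (f : R -> R) (X : 'M[C]_N) : R :=
  N%:R^-1 * \sum_i f (s * eigval X i).

Definition semicircle (r x : R) : R :=
  2 / (pi * r ^+ 2) * Num.sqrt (r ^+ 2 - x ^+ 2) * \1_`[- r, r] x.

Definition semicircle_radius (k : nat) (B : R) (N : nat) : R :=
  Num.sqrt (2 * k.+1%:R * N%:R / B).

Definition rescaling (k : nat) (B : R) (N : nat) : R :=
  Num.sqrt (2 * B / (k.+1%:R * N%:R)).

End matrix_model.

Arguments E_g {R} k B {N} F.
Arguments density_scaled {R} N s f X.

(* Main.v *)
(* Write p_m = Tr X^m and D(l, X) for the determinant whose rows are l X^m.
   Diagonalising X shows D(l, X + e X^n) = D(l, X) prod_{i<j} (1 + e g_ij) with
   g_ij = (x_i^n - x_j^n) / (x_i - x_j), for every l. Gaussian integration by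
   parts against the vector field X^n, at fixed l, therefore gives, for every
   product W of traces and E the integral against |D|^(2k) and the Gaussian,
     2 B E[p_(n+1) W] = (k + 1) sum_(a+b=n-1) E[p_a p_b W]
                        - k n E[p_(n-1) W] + E[dW(X^n)].
   This determines all mixed moments by induction on the degree; after
   rescaling it becomes, as N -> oo, the Catalan recursion
   c_(n+1) = sum_(a+b=n-1) c_a c_b of the semicircle moments, so no
   concentration estimate and no passage to eigenvalue coordinates is needed.
   Moment convergence to a compactly supported law gives weak convergence by
   polynomial approximation and a high-moment tail bound. *)

Require Import Defs.
From HB Require Import structures.
From mathcomp Require Import all_boot all_order all_algebra all_fingroup.
From mathcomp Require Import spectral complex ring lra zify.
From mathcomp Require Import all_classical all_reals all_analysis.
From mathcomp Require Import measurable_realfun.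
Import Order.TTheory GRing.Theory Num.Theory.
Import numFieldNormedType.Exports.
Local Open Scope classical_set_scope.
Local Open Scope ring_scope.

Set Implicit Arguments.
Unset Strict Implicit.
Unset Printing Implicit Defensive.

(** * Polynomial functions and their directional derivatives *)

(** The factor k + 1 has two sources: the divergence of the field X^n supplies one copy of sum p_a
    p_b, and the logarithmic derivative of |D|^(2k) supplies k more. Lambda is kept as a Gaussian
    variable beside X until the very end, so that every integrand is a polynomial in finitely many
    real coordinates times a Gaussian; integrability and the absence of boundary terms then come
    from dimension one by taking products. The derivative of |D|^2 along X^n is needed also where D
    vanishes or eigenvalues coincide, so it cannot be taken as a logarithmic derivative, nor through
    differentiable eigenvalues. Derivatives are therefore formal: along the line X + e X^n
    everything is a polynomial in e built from the spectrum of X, a real polynomial is determined by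
    its values, and its linear coefficient must be the directional derivative in matrix coordinates.
    Eigenvalues enter the measure theory only through symmetric functions: polynomial statistics are
    combinations of traces, and continuous ones are pointwise limits of these. *)

(* [F] is a polynomial function of the coordinates [x i] and [dF x v] is its
   derivative at [x] in the direction [v]. *)
Inductive poly_diff (R : realType) (I : Type) :
    ((I -> R) -> R) -> ((I -> R) -> (I -> R) -> R) -> Prop :=
| poly_diff_cst c : poly_diff (fun=> c) (fun _ _ => 0)
| poly_diff_crd i : poly_diff (fun x => x i) (fun _ v => v i)
| poly_diffD F dF G dG : poly_diff F dF -> poly_diff G dG ->
    poly_diff (fun x => F x + G x) (fun x v => dF x v + dG x v)
| poly_diffM F dF G dG : poly_diff F dF -> poly_diff G dG ->
    poly_diff (fun x => F x * G x) (fun x v => dF x v * G x + F x * dG x v).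

Definition unit_dir (R : realType) (I : eqType) (i : I) : I -> R :=
  fun j => (j == i)%:R.

Section poly_diff_theory.
Context (R : realType).

Lemma eq_poly_diff (I : Type) (F G : (I -> R) -> R) dF dG :
  poly_diff F dF -> F =1 G -> (forall x v, dF x v = dG x v) -> poly_diff G dG.
Proof.
move=> pF /funext <- dE; rewrite (_ : dG = dF) //.
by apply/funext => x; apply/funext => v.
Qed.

Lemma poly_diffN (I : Type) (F : (I -> R) -> R) dF :
  poly_diff F dF -> poly_diff (fun x => - F x) (fun x v => - dF x v).
Proof.
move=> pF; apply: (eq_poly_diff (poly_diffM (poly_diff_cst I (-1)) pF)) => [x|x v].
  by rewrite mulN1r.
by rewrite mul0r add0r mulN1r.
Qed.

Lemma poly_diff_sum (I J : Type) (r : seq J) (P : pred J)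
    (F : J -> (I -> R) -> R) dF :
  (forall j, poly_diff (F j) (dF j)) ->
  poly_diff (fun x => \sum_(j <- r | P j) F j x)
            (fun x v => \sum_(j <- r | P j) dF j x v).
Proof.
move=> pF; elim: r => [|j r IH].
  by apply: (eq_poly_diff (poly_diff_cst I 0)) => [x|x v]; rewrite big_nil.
have [Pj|nPj] := boolP (P j).
  apply: (eq_poly_diff (poly_diffD (pF j) IH)) => [x|x v]; by rewrite big_cons Pj.
by apply: (eq_poly_diff IH) => [x|x v]; rewrite big_cons (negbTE nPj).
Qed.

Lemma poly_diff_prod (I J : Type) (r : seq J) (F : J -> (I -> R) -> R) dF :
  (forall j, poly_diff (F j) (dF j)) ->
  exists d, poly_diff (fun x => \prod_(j <- r) F j x) d.
Proof.
move=> pF; elim: r => [|j r [d IH]].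
  exists (fun _ _ => 0).
  by apply: (eq_poly_diff (poly_diff_cst I 1)) => [x|x v] //; rewrite big_nil.
exists (fun x v => dF j x v * \prod_(i <- r) F i x + F j x * d x v).
by apply: (eq_poly_diff (poly_diffM (pF j) IH)) => [x|x v] //; rewrite big_cons.
Qed.

Lemma poly_diffX (I : Type) (F : (I -> R) -> R) dF n :
  poly_diff F dF -> exists d, poly_diff (fun x => F x ^+ n) d.
Proof.
move=> pF; have [d pd] := @poly_diff_prod _ _ (nseq n tt) (fun=> F) (fun=> dF)
  (fun=> pF).
exists d; apply: (eq_poly_diff pd) => [x|//].
by rewrite big_const_seq count_predT size_nseq iter_mulr_1.
Qed.

Lemma poly_diff_comp (I J : Type) (F : (I -> R) -> R) dF
    (phi : (J -> R) -> I -> R) dphi :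
  poly_diff F dF ->
  (forall i, poly_diff (fun x => phi x i) (fun x v => dphi x v i)) ->
  poly_diff (fun x => F (phi x)) (fun x v => dF (phi x) (dphi x v)).
Proof.
move=> pF pphi; elim: pF => [c|i|G dG H dH _ IG _ IH|G dG H dH _ IG _ IH].
- exact: poly_diff_cst.
- exact: pphi.
- exact: poly_diffD.
- exact: (poly_diffM IG IH).
Qed.

(** The integrand of an integration by parts contains [dF]; this makes it polynomial again, hence
    integrable against a Gaussian. *)
Lemma poly_diff_dir (I : Type) (F : (I -> R) -> R) dF (v : I -> R) :
  poly_diff F dF -> exists d, poly_diff (fun x => dF x v) d.
Proof.
elim=> [c|i|G dG H dH _ [g pg] _ [h ph]|G dG H dH pG [g pg] pH [h ph]].
- by eexists; exact: poly_diff_cst.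
- by eexists; exact: poly_diff_cst.
- by eexists; exact: (poly_diffD pg ph).
- by eexists; exact: (poly_diffD (poly_diffM pg pH) (poly_diffM pG ph)).
Qed.

(** Linearity in the direction is inherited through the constructors. It reassembles partial
    derivatives, obtained one coordinate at a time, into the derivative along a vector field. *)
Lemma poly_diff_linear (I : finType) (F : (I -> R) -> R) dF x v :
  poly_diff F dF -> dF x v = \sum_i v i * dF x (unit_dir R i).
Proof.
elim=> [c|i|G dG H dH _ IG _ IH|G dG H dH _ IG _ IH].
- by rewrite big1 // => i _; rewrite mulr0.
- rewrite (bigD1 i) //= /unit_dir eqxx mulr1 big1 ?addr0 // => j ji.
  by rewrite eq_sym (negbTE ji) mulr0.
- by rewrite IG IH -big_split /=; apply: eq_bigr => i _; rewrite mulrDr.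
- rewrite IG IH mulr_suml mulr_sumr -big_split /=; apply: eq_bigr => i _.
  ring.
Qed.

Lemma poly_diff_line (I : Type) (F : (I -> R) -> R) dF x v :
  poly_diff F dF -> exists2 q : {poly R},
    (forall e, F (fun i => x i + e * v i) = q.[e]) & (q^`()).[0] = dF x v.
Proof.
elim=> [c|i|G dG H dH _ [p pE pd] _ [q qE qd]|G dG H dH _ [p pE pd] _ [q qE qd]].
- exists c%:P => [e|]; first by rewrite hornerC.
  by rewrite derivC hornerC.
- exists ((x i)%:P + v i *: 'X) => [e|]; first by rewrite !hornerE mulrC.
  by rewrite derivD derivC add0r derivZ derivX hornerZ hornerC mulr1.
- exists (p + q) => [e|]; first by rewrite hornerD pE qE.
  by rewrite derivD hornerD pd qd.
- exists (p * q) => [e|]; first by rewrite hornerM pE qE.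
  have x0 : (fun i => x i + 0 * v i) = x by apply/funext => i; rewrite mul0r addr0.
  by rewrite derivM hornerD !hornerM pd qd -pE -qE x0.
Qed.

Lemma poly_eq_horner (p q : {poly R}) : (forall e, p.[e] = q.[e]) -> p = q.
Proof.
move=> pq; apply/eqP; rewrite -subr_eq0; apply/negP => /negP nz.
(* The integers below [size (p - q)] are one root too many for a nonzero [p - q]. *)
have := @max_poly_roots _ (p - q) [seq i%:R | i <- iota 0 (size (p - q))] nz.
rewrite size_map size_iota ltnn => H; have //: false; apply: H.
  by apply/allP => e _; rewrite /root !hornerE pq subrr.
by rewrite map_inj_uniq ?iota_uniq // => i j /eqP; rewrite eqr_nat => /eqP.
Qed.

(** The bridge from spectra to coordinates: [q] may be found by any means, such as diagonalisation,
    and still computes the coordinate derivative. *)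
Lemma poly_diff_line_deriv (I : Type) (F : (I -> R) -> R) dF x v (q : {poly R}) :
  poly_diff F dF -> (forall e, F (fun i => x i + e * v i) = q.[e]) ->
  dF x v = (q^`()).[0].
Proof.
move=> pF Fq; have [p pE <-] := poly_diff_line x v pF.
by congr (_^`().[_]); apply: poly_eq_horner => e; rewrite -pE -Fq.
Qed.

(** The bound is a product over coordinates rather than a power of a norm because it then splits,
    like the Gaussian weight, over a product of spaces. *)
Lemma poly_diff_growth (I : finType) (F : (I -> R) -> R) dF :
  poly_diff F dF -> exists (C : R) (d : nat), 0 <= C /\
    forall x, `|F x| <= C * \prod_i (1 + `|x i|) ^+ d.
Proof.
have ge1 d (x : I -> R) : 1 <= \prod_i (1 + `|x i|) ^+ d.
  apply: (big_ind (fun y => 1 <= y)) => // [y z|i _]; first exact: mulr_ege1.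
  by rewrite exprn_ege1 // lerDl.
elim=> [c|i|G dG H dH _ [C [d [C0 Gd]]] _ [D [e [D0 He]]]|
        G dG H dH _ [C [d [C0 Gd]]] _ [D [e [D0 He]]]].
- exists `|c|, 0%N; split => // x.
  by rewrite ler_peMr // ge1.
- exists 1, 1%N; split => // x; rewrite mul1r (bigD1 i) //= expr1.
  rewrite (@le_trans _ _ (1 + `|x i|)) ?lerDr // ler_peMr ?addr_ge0 //.
  apply: (big_ind (fun y => 1 <= y)) => // [y z|j _]; first exact: mulr_ege1.
  by rewrite expr1 lerDl.
- have mono a c (x : I -> R) : (a <= c)%N ->
      \prod_i (1 + `|x i|) ^+ a <= \prod_i (1 + `|x i|) ^+ c.
    move=> ac; apply: ler_prod => i _; rewrite exprn_ge0 ?addr_ge0 //=.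
    by rewrite ler_weXn2l // lerDl.
  exists (C + D), (d + e)%N; split; first exact: addr_ge0.
  move=> x; rewrite (le_trans (ler_normD _ _)) // mulrDl lerD //.
    by rewrite (le_trans (Gd x)) // ler_wpM2l // mono // leq_addr.
  by rewrite (le_trans (He x)) // ler_wpM2l // mono // leq_addl.
- exists (C * D), (d + e)%N; split; first exact: mulr_ge0.
  move=> x; rewrite normrM (le_trans (ler_pM _ _ (Gd x) (He x))) //.
  rewrite mulrACA -big_split /=; under eq_bigr do rewrite -exprD.
  by [].
Qed.

Lemma poly_diff_continuous (I : finType) (F : (I -> R) -> R) dF a :
  poly_diff F dF -> forall e, 0 < e -> exists2 r, 0 < r &
    forall x, (forall i, `|x i - a i| < r) -> `|F x - F a| < e.
Proof.
elim=> [c|i|G dG H dH _ IG _ IH|G dG H dH _ IG _ IH] e e0.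
- by exists 1 => // x _; rewrite subrr normr0.
- by exists e.
- have e2 : 0 < e / 2 by rewrite divr_gt0.
  have [r r0 Gr] := IG _ e2; have [s s0 Hs] := IH _ e2.
  exists (Num.min r s); first by rewrite lt_min r0.
  move=> x xrs; have -> : G x + H x - (G a + H a) = (G x - G a) + (H x - H a) by
    ring.
  rewrite (le_lt_trans (ler_normD _ _)) // [ltRHS]splitr ltrD //.
    by apply: Gr => i; have := xrs i; rewrite lt_min => /andP[].
  by apply: Hs => i; have := xrs i; rewrite lt_min => /andP[].
- pose M := `|G a| + `|H a| + 1.
  have M0 : 0 < M by rewrite ltr_wpDl // addr_ge0.
  (* The cap 1 keeps [|H x|] below [M]; the other bound makes each of the two terms of the product
     rule at most e / 2. *)
  have e2 : 0 < Num.min 1 (e / (2 * M)) by rewrite lt_min ltr01 divr_gt0 // mulr_gt0.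
  have [r r0 Gr] := IG _ e2; have [s s0 Hs] := IH _ e2.
  exists (Num.min r s); first by rewrite lt_min r0.
  move=> x xrs.
  have xr : `|G x - G a| < Num.min 1 (e / (2 * M)).
    by apply: Gr => i; have := xrs i; rewrite lt_min => /andP[].
  have xs : `|H x - H a| < Num.min 1 (e / (2 * M)).
    by apply: Hs => i; have := xrs i; rewrite lt_min => /andP[].
  move: xr xs; rewrite !lt_min => /andP[G1 G2] /andP[H1 H2].
  have -> : G x * H x - G a * H a = (G x - G a) * H x + G a * (H x - H a) by ring.
  rewrite (le_lt_trans (ler_normD _ _)) // !normrM.
  have Hx : `|H x| <= M.
    have := ler_normD (H x - H a) (H a); rewrite subrK => /le_trans -> //.
    by have := normr_ge0 (G a); rewrite /M; lra.
  have Ga : `|G a| <= M by rewrite /M -addrA lerDl addr_ge0.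
  have eE : e = (e / (2 * M)) * M + M * (e / (2 * M)) by field; rewrite gt_eqF.
  rewrite [ltRHS]eE; apply: ltr_leD.
    have [->|nz] := eqVneq (H x) 0;
      first by rewrite normr0 mulr0 !mulr_gt0 // invr_gt0 mulr_gt0.
    by rewrite (@lt_le_trans _ _ ((e / (2 * M)) * `|H x|)) ?ltr_pM2r ?normr_gt0
      // ler_wpM2l // divr_ge0 ?ltW // mulr_gt0.
  by rewrite ler_pM // ltW.
Qed.

Lemma poly_diff_measurable d (T : measurableType d) (I : Type)
    (F : (I -> R) -> R) dF (x : T -> I -> R) :
  poly_diff F dF -> (forall i, measurable_fun setT (fun t => x t i)) ->
  measurable_fun setT (fun t => F (x t)).
Proof.
move=> + mx; elim=> [c|i|G dG H dH _ IG _ IH|G dG H dH _ IG _ IH].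
- exact: measurable_cst.
- exact: mx.
- exact: measurable_funD.
- exact: measurable_funM.
Qed.

End poly_diff_theory.

(** * Gaussian spaces *)

Definition gauss_weight (R : realType) (I : finType) (b x : I -> R) : R :=
  expR (- \sum_i b i * x i ^+ 2).

(** What the argument needs of a Gaussian measure, in a form stable under products: finite moments,
    integration by parts without boundary terms, and positive mass of boxes, from which the
    normalisation integral is seen to be nonzero. The weight [b] may differ from coordinate to
    coordinate. *)
Record gauss_space (R : realType) d (T : measurableType d)
    (mu : {sigma_finite_measure set T -> \bar R}) (I : finType)
    (x : T -> I -> R) (b : I -> R) : Prop := GaussSpace {
  gs_meas : forall i, measurable_fun setT (fun t => x t i) ;
  gs_fin : forall n, (\int[mu]_t
    (\prod_i (1 + `|x t i|) ^+ n * gauss_weight b (x t))%:E < +oo)%E ;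
  gs_ibp : forall F dF i, poly_diff F dF ->
    (\int[mu]_t ((dF (x t) (unit_dir R i) - 2 * b i * x t i * F (x t))
                 * gauss_weight b (x t))%:E = 0)%E ;
  gs_box : forall a r, 0 < r ->
    (0 < mu [set t | forall i, (`|x t i - a i| < r)%R])%E }.

(** * Polynomials against a Gaussian weight: integrability and positivity *)

Section poly_gauss.
Context (R : realType) d (T : measurableType d).

Lemma measurable_gauss_weight (J : finType) (c : J -> R) (y : T -> J -> R) :
  (forall i, measurable_fun setT (fun t => y t i)) ->
  measurable_fun setT (fun t => gauss_weight c (y t)).
Proof.
move=> my; apply: measurableT_comp => //; apply: measurableT_comp => //.
apply: measurable_sum => i; apply: measurable_funM => //.
exact: measurable_funX.
Qed.

Lemma measurable_growth (J : finType) n (y : T -> J -> R) :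
  (forall i, measurable_fun setT (fun t => y t i)) ->
  measurable_fun setT (fun t => \prod_i (1 + `|y t i|) ^+ n).
Proof.
move=> my; apply: measurable_prod => i _.
by apply: measurable_funX; apply: measurable_funD => //; exact: measurableT_comp.
Qed.

Lemma measurable_box (J : finType) (y : T -> J -> R) a r :
  (forall i, measurable_fun setT (fun t => y t i)) ->
  measurable [set t | forall i, `|y t i - a i| < r].
Proof.
move=> my; rewrite (_ : mkset _ = \bigcap_(i in [set: J]) [set t | (`|y t i - a
  i| < r)%R]).
  apply: fin_bigcap_measurable => // i _.
  have m : measurable_fun setT (fun t => `|y t i - a i|).
    by apply: measurableT_comp => //; apply: measurable_funB.
  rewrite -[X in measurable X]setTI.
  have := @measurable_fun_ltr _ _ R setT _ _ m (measurable_cst r).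
  by move/(_ measurableT [set true]); exact.
by apply/seteqP; split=> t tB i; [move=> _|]; exact: tB.
Qed.

(** Only measurability and finite moments are assumed, so that the result is available while
    integration by parts on a product is still being established. *)
Lemma integrable_poly_gauss (mu : {measure set T -> \bar R}) (I : finType)
    (x : T -> I -> R) (b : I -> R) F dF :
  (forall i, measurable_fun setT (fun t => x t i)) ->
  (forall n, (\int[mu]_t
    (\prod_i (1 + `|x t i|) ^+ n * gauss_weight b (x t))%:E < +oo)%E) ->
  poly_diff F dF ->
  mu.-integrable setT (fun t => (F (x t) * gauss_weight b (x t))%:E).
Proof.
move=> mx fin pF; have [C [n [C0 FC]]] := poly_diff_growth pF.
have mG := measurable_growth n mx.
have mW := measurable_gauss_weight b mx.
have iG : mu.-integrable setT (fun t =>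
  (\prod_i (1 + `|x t i|) ^+ n * gauss_weight b (x t))%:E).
  apply/integrableP; split.
    by apply/measurable_EFinP; exact: measurable_funM.
  under eq_integral do rewrite gee0_abs ?lee_fin ?mulr_ge0 ?expR_ge0 ?prodr_ge0
    // => *; rewrite ?exprn_ge0 ?addr_ge0 //.
apply: (le_integrable _ _ _ (integrableZl _ C iG)) => //.
  apply/measurable_EFinP; apply: measurable_funM => //.
  exact: (poly_diff_measurable pF mx).
move=> t _; rewrite /= lee_fin !normrM (ger0_norm (expR_ge0 _)) mulrA.
rewrite ler_wpM2r ?expR_ge0 // (le_trans (FC _)) // ger0_norm // ler_wpM2l //.
exact: ler_norm.
Qed.

End poly_gauss.

Section gauss_space_theory.
Context (R : realType) d (T : measurableType d)
  (mu : {sigma_finite_measure set T -> \bar R}) (I : finType)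
  (x : T -> I -> R) (b : I -> R).
Hypothesis G : gauss_space mu x b.

Lemma gs_integrable F dF : poly_diff F dF ->
  mu.-integrable setT (fun t => (F (x t) * gauss_weight b (x t))%:E).
Proof. exact: integrable_poly_gauss (gs_meas G) (gs_fin G). Qed.

(** By continuity [F] is positive on a box around [a]. A zero integral would make the integrand
    vanish almost everywhere, although the box has positive measure. *)
Lemma gs_integral_gt0 F dF : poly_diff F dF -> (forall y, 0 <= F y) ->
  (exists a, 0 < F a) ->
  (0 < \int[mu]_t (F (x t) * gauss_weight b (x t))%:E)%E.
Proof.
move=> pF F0 [a Fa].
have [r r0 rF] := poly_diff_continuous a pF Fa.
set B := [set t | forall i, (`|x t i - a i| < r)%R].
have mB : measurable B by apply: measurable_box; exact: gs_meas G.
have FB t : B t -> 0 < F (x t).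
  by move=> /rF; rewrite ltr_norml => /andP[]; rewrite ltrBrDr addNr.
have mF : measurable_fun setT (fun t => (F (x t) * gauss_weight b (x t))%:E).
  by have /integrableP[] := gs_integrable pF.
rewrite lt0e integral_ge0 ?andbT; last first.
  by move=> t _; rewrite lee_fin mulr_ge0 // expR_ge0.
apply/negP => /eqP int0.
have := @ae_eq_integral_abs _ _ _ mu setT measurableT _ mF.
rewrite (eq_integral (fun t => (F (x t) * gauss_weight b (x t))%:E)); last first.
  by move=> t _; rewrite gee0_abs // lee_fin mulr_ge0 // expR_ge0.
move=> [/(_ int0) ae0 _].
have : mu B = 0.
  apply/negligibleP => //; apply: negligibleS ae0 => t Bt /= /(_ Logic.I) [] /eqP.
  by rewrite mulf_eq0 !gt_eqF ?expR_gt0 ?FB.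
by move=> B0; have := gs_box G a r0; rewrite -/B B0 ltxx.
Qed.

End gauss_space_theory.

(** * The one-dimensional Gaussian *)

Section real_line.
Context (R : realType) (b : R) (b0 : 0 < b).
Local Notation mu := (@lebesgue_measure R).

Lemma integrable_expR_sqr : mu.-integrable setT (fun y : R =>
  (expR (- (b * y ^+ 2)))%:E).
Proof.
(* The standard deviation for which the normal density is proportional to exp (- b y^2). *)
pose s := Num.sqrt (2 * b)^-1.
have s0 : s != 0 by rewrite gt_eqF // sqrtr_gt0 invr_gt0 mulr_gt0.
have sp := normal_peak_gt0 s0.
have := integrableZl measurableT (normal_peak s)^-1 (integrable_normal_pdf 0 s).
apply: eq_integrable => // y _;
  rewrite -EFinM normal_pdfE // mulrA mulVf ?gt_eqF // mul1r.
rewrite /normal_fun subr0 sqr_sqrtr ?invr_ge0 ?mulr_ge0 ?(ltW b0) //.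
congr (expR _)%:E; field; by rewrite gt_eqF.
Qed.

Lemma growth_expR_sqr n : exists2 C : R, 0 <= C & forall y : R,
  (1 + `|y|) ^+ n * expR (- (b * y ^+ 2)) <= C * expR (- (b / 2 * y ^+ 2)).
Proof.
(* Half of the Gaussian absorbs the growth: (1 + |y|)^n is at most exp (n |y|), and n^2 / (2 b) is
   the maximum of n |y| - (b / 2) y^2. *)
exists (expR (n%:R ^+ 2 / (2 * b))); first exact: expR_ge0.
move=> y; rewrite -expRD.
apply: (@le_trans _ _ (expR (n%:R * `|y|) * expR (- (b * y ^+ 2)))).
  rewrite ler_wpM2r ?expR_ge0 // expRM_natl ?lerXn2r ?nnegrE ?addr_ge0 ?expR_ge0 //.
  by rewrite expR_ge1Dx.
rewrite -expRD ler_expR -[y ^+ 2]real_normK ?num_real //.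
rewrite -subr_ge0.
suff -> : n%:R ^+ 2 / (2 * b) - b / 2 * `|y| ^+ 2 - (n%:R * `|y| - b * `|y| ^+ 2)
  = (n%:R - b * `|y|) ^+ 2 / (2 * b).
  by rewrite divr_ge0 ?sqr_ge0 // mulr_ge0 // ltW.
by field; rewrite gt_eqF.
Qed.

End real_line.

Section real_gauss_space.
Context (R : realType) (b : R) (b0 : 0 < b).
Local Notation mu := (@lebesgue_measure R).

Let gwE (c : R) (y : unit ->
  R) : gauss_weight (fun=> c) y = expR (- (c * y tt ^+ 2)).
Proof. by rewrite /gauss_weight (bigD1 tt) //= big1 ?addr0 // => -[]. Qed.

Lemma poly_diff_is_derive (F : (unit -> R) -> R) dF (y : R) : poly_diff F dF ->
  is_derive y 1 (fun z : R => F (fun=> z)) (dF (fun=> y) (unit_dir R tt)).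
Proof.
elim=> [c|[]|G dG H dH _ IG _ IH|G dG H dH _ IG _ IH].
- exact: is_derive_cst.
- exact: is_derive_id.
- exact: is_deriveD.
- by apply: is_derive_eq (is_deriveM IG IH) _; rewrite /GRing.scale /= addrC mulrC.
Qed.


(** The fundamental theorem of calculus on [-n, n], with dominated convergence as n grows; the
    boundary values tend to 0. *)
Lemma integral_deriv_eq0 (G g : R -> R) :
  (forall y : R, is_derive y 1 G (g y)) -> continuous g ->
  mu.-integrable setT (EFin \o g) ->
  G n%:R @[n --> \oo] --> (0 : R) -> G (- n%:R) @[n --> \oo] --> (0 : R) ->
  (\int[mu]_y (g y)%:E = 0)%E.
Proof.
move=> dG cg ig Gp Gm.
pose f_ (n : nat) : R -> \bar R := (EFin \o g) \_ (`[- n%:R, n%:R]).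
have mg : measurable_fun setT (EFin \o g) by have /integrableP[] := ig.
have fE n : (0 < n)%N -> (\int[mu]_y f_ n y = (G n%:R - G (- n%:R))%:E)%E.
  move=> n0; rewrite -integral_mkcond (@continuous_FTC2 _ _ G) //.
  - by rewrite gtrN // ltr0n.
  - by apply: continuous_subspaceT => y; exact: cg.
  - have cG : continuous G.
      by move=> y; apply/differentiable_continuous/derivable1_diffP; have [] := dG y.
    split => [y _| |]; first by have [] := dG y.
      by apply: cvg_at_right_filter; exact: cG.
    by apply: cvg_at_left_filter; exact: cG.
  - by move=> y _; rewrite derive1E; have [_] := dG y.
have f_cvg : (\int[mu]_y f_ n y @[n --> \oo] --> \int[mu]_y (EFin \o g) y)%E.
  have [] // := @dominated_convergence _ _ _ mu setT measurableT f_ (EFin \o g)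
    (abse \o (EFin \o g)).
  - move=> n; apply/(measurable_restrictT _ _).1 => //.
    exact: measurable_funTS.
  - apply: aeW => y _; apply: cvg_near_cst.
    near=> n; rewrite /f_ patchE ifT // inE /= in_itv /= -ler_norml.
    by near: n; exact: nbhs_infty_ger.
  - exact: integrable_abse.
  - apply: aeW => y n _; rewrite /f_ patchE; case: ifP => // _.
    by rewrite abse0 /= lee_fin.
apply/esym; apply: (cvg_unique _ _ f_cvg) => //.
have : ((G n%:R - G (- n%:R))%:E @[n --> \oo] --> 0%:E)%E.
  apply: cvg_EFin; first exact: nearW.
  by rewrite -[X in _ --> X](subr0 (0:R)); exact: cvgB Gp Gm.
apply: cvg_trans; apply: near_eq_cvg.
by near=> n; rewrite fE //; near: n; exact: nbhs_infty_gt.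
Unshelve. all: by end_near. Qed.

Lemma real_gauss_space :
  gauss_space mu (fun (y : R) (_ : unit) => y) (fun=> b).
Proof.
have growE n (y : R) : \prod_(i : unit) (1 + `|y|) ^+ n = (1 + `|y|) ^+ n.
  by rewrite (bigD1 tt) //= big1 ?mulr1 // => -[].
have int n : mu.-integrable setT (fun y : R =>
  ((1 + `|y|) ^+ n * expR (- (b * y ^+ 2)))%:E).
  have [C C0 CE] := growth_expR_sqr b0 n.
  have b2 : 0 < b / 2 by rewrite divr_gt0.
  apply: (le_integrable _ _ _ (integrableZl _ C (integrable_expR_sqr b2))) => //.
    apply/measurable_EFinP; apply: measurable_funM.
      by apply: measurable_funX; apply: measurable_funD => //.
    by apply: measurableT_comp => //; apply: measurableT_comp => //;
      apply: measurable_funM.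
  move=> y _; rewrite /= lee_fin [leLHS]ger0_norm ?mulr_ge0 ?exprn_ge0 ?addr_ge0
    ?expR_ge0 //.
  by rewrite [leRHS]ger0_norm ?mulr_ge0 ?expR_ge0 //; exact: CE.
split; [move=> i|move=> n|move=> F dF [] pF|move=> a r r0].
- exact: measurable_id.
- have /integrableP[_] := int n; apply: le_lt_trans; rewrite le_eqVlt; apply/orP;
  left.
  apply/eqP/eq_integral => y _; rewrite growE gwE //.
  by rewrite gee0_abs /= ?lee_fin ?mulr_ge0 ?exprn_ge0 ?addr_ge0 ?expR_ge0.
- pose W (y : R) := expR (- (b * y ^+ 2)).
  have dW (y : R) : is_derive y 1 W (- (2 * b * y) * W y).
    rewrite /W; apply: is_derive_eq => //.
    by rewrite /GRing.scale /=; ring.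
  have [dF2 pdF] := poly_diff_dir (unit_dir R tt) pF.
  have grow H dH : @poly_diff R unit H dH ->
      mu.-integrable setT (fun y : R => (H (fun=> y) * W y)%:E).
    move=> pH; have [C [n [C0 HC]]] := poly_diff_growth pH.
    have mH : measurable_fun setT (fun y : R => H (fun=> y)).
      by apply: (poly_diff_measurable pH) => i; exact: measurable_id.
    apply: (le_integrable _ _ _ (integrableZl _ C (int n))) => //.
      apply/measurable_EFinP; apply: measurable_funM => //.
      by apply: measurableT_comp => //; apply: measurableT_comp => //;
        apply: measurable_funM.
    move=> y _; rewrite /= lee_fin !normrM (ger0_norm (expR_ge0 _)) mulrA.
    rewrite ler_wpM2r ?expR_ge0 // (le_trans (HC _)) // growE.
    by rewrite ler_pM ?ler_norm ?exprn_ge0 ?addr_ge0.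
  have pg := poly_diffD pdF (poly_diffN (poly_diffM (poly_diffM (poly_diff_cst
    unit (2 * b)) (poly_diff_crd R tt)) pF)).
  have contP H dH : @poly_diff R unit H dH -> continuous (fun y : R => H (fun=> y)).
    move=> pH y; apply/differentiable_continuous/derivable1_diffP.
    by have [] := poly_diff_is_derive y pH.
  (* Stated for any sequence with |u n| = n, so that it serves both ends of the line. *)
  have decay (u : nat -> R) : (forall n, `|u n| = n%:R) ->
      F (fun=> u n) * W (u n) @[n --> \oo] --> (0 : R).
    move=> un; have [C [m [C0 FC]]] := poly_diff_growth pF.
    (* One power more than [F] requires; the spare factor 1 + |u n| yields decay like 1 / (n +
       1). *)
    have [D D0 DE] := growth_expR_sqr b0 m.+1.
    apply/norm_cvg0P; apply: (@squeeze_cvgr _ _ _ _ (fun=> 0) (fun n =>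
      C * D * n.+1%:R^-1)).
    - apply: nearW => n; rewrite normr_ge0 /= normrM (ger0_norm (expR_ge0 _)).
      rewrite (le_trans (ler_wpM2r (expR_ge0 _) (FC _))) // growE.
      rewrite ler_pdivlMr // un.
      have -> : C * (1 + n%:R) ^+ m * W (u n) * n.+1%:R = C * ((1 + n%:R) ^+ m.+1
        * W (u n)).
        by rewrite exprSr -natr1; ring.
      rewrite ler_wpM2l //; have := DE (u n); rewrite un => /le_trans; apply.
      rewrite ler_piMr // -[leRHS]expR0 ler_expR oppr_le0 mulr_ge0 ?sqr_ge0 //.
      by rewrite divr_ge0 ?(ltW b0).
    - exact: cvg_cst.
    - by rewrite -[X in _ --> X](mulr0 (C * D)); apply: cvgMr; exact: cvg_harmonic.
  pose g (y : R) := (dF (fun=> y) (unit_dir R tt) - 2 * b * y * F (fun=> y)) * W y.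
  transitivity (\int[mu]_y (g y)%:E)%E.
    by apply: eq_integral => y _; rewrite gwE.
  apply: (@integral_deriv_eq0 (fun y => F (fun=> y) * W y)).
  + move=> y; apply: is_derive_eq (is_deriveM (poly_diff_is_derive y pF) (dW y)) _.
    by rewrite /g /GRing.scale /=; ring.
  + move=> y; apply: cvgM; first exact: (contP _ _ pg).
    by apply/differentiable_continuous/derivable1_diffP; have [] := dW y.
  + exact: (grow _ _ pg).
  + by apply: decay => n; rewrite normr_nat.
  + by apply: decay => n; rewrite normrN normr_nat.
- rewrite (_ : [set _ | _] = `]a tt - r, a tt + r[%classic).
    suff : (0 < lebesgue_measure (`](a tt - r)%R, (a tt + r)%R[%classic : set
      R))%E by [].
    rewrite lebesgue_measure_itv /= lte_fin ifT; last lra.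
    by rewrite -EFinB lte_fin; lra.
  apply/seteqP; split => y /=.
    by move=> /(_ tt); rewrite in_itv /= ltr_distl.
  by move=> yi []; move: yi; rewrite in_itv /= ltr_distl.
Qed.

End real_gauss_space.

(** * Products, relabelling and tuples of Gaussian spaces *)

Section prod_gauss_space.
Context (R : realType) d1 d2 (T1 : measurableType d1) (T2 : measurableType d2)
  (mu1 : {sigma_finite_measure set T1 -> \bar R})
  (mu2 : {sigma_finite_measure set T2 -> \bar R})
  (I1 I2 : finType) (x1 : T1 -> I1 -> R) (x2 : T2 -> I2 -> R)
  (b1 : I1 -> R) (b2 : I2 -> R).
Hypotheses (G1 : gauss_space mu1 x1 b1) (G2 : gauss_space mu2 x2 b2).

Definition sum_fun (A : Type) (f : I1 -> A) (g : I2 -> A) (i : I1 + I2) : A :=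
  match i with inl i => f i | inr j => g j end.

Lemma gauss_weight_sum y1 y2 :
  gauss_weight (sum_fun b1 b2) (sum_fun y1 y2)
  = gauss_weight b1 y1 * gauss_weight b2 y2.
Proof. by rewrite /gauss_weight big_sumType /= opprD expRD. Qed.

Lemma poly_diff_suml F dF (y2 : I2 -> R) : poly_diff F dF ->
  poly_diff (fun y1 => F (sum_fun y1 y2))
            (fun y1 v => dF (sum_fun y1 y2) (sum_fun v (fun=> 0))).
Proof.
move=> pF; apply: (@poly_diff_comp _ _ _ F dF (fun y1 => sum_fun y1 y2)
  (fun _ v => sum_fun v (fun=> 0)) pF) => -[i|j].
  exact: poly_diff_crd.
exact: poly_diff_cst.
Qed.

Lemma poly_diff_sumr F dF (y1 : I1 -> R) : poly_diff F dF ->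
  poly_diff (fun y2 => F (sum_fun y1 y2))
            (fun y2 v => dF (sum_fun y1 y2) (sum_fun (fun=> 0) v)).
Proof.
move=> pF; apply: (@poly_diff_comp _ _ _ F dF (fun y2 => sum_fun y1 y2)
  (fun _ v => sum_fun (fun=> 0) v) pF) => -[i|j].
  exact: poly_diff_cst.
exact: poly_diff_crd.
Qed.

Let x (t : T1 * T2) : I1 + I2 -> R := sum_fun (x1 t.1) (x2 t.2).
Let b := sum_fun b1 b2.

Let mx i : measurable_fun setT (fun t => x t i).
Proof.
case: i => [i|j].
  exact: (measurableT_comp (gs_meas G1 i) measurable_fst).
exact: (measurableT_comp (gs_meas G2 j) measurable_snd).
Qed.

Let fin n : (\int[prod_measure mu1 mu2]_t
  (\prod_i (1 + `|x t i|) ^+ n * gauss_weight b (x t))%:E < +oo)%E.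
Proof.
have ge0 (J : finType) (c y : J -> R) :
    0 <= \prod_i (1 + `|y i|) ^+ n * gauss_weight c y.
  by rewrite mulr_ge0 ?expR_ge0 // prodr_ge0 // => i _; rewrite exprn_ge0 ?addr_ge0.
have meas : measurable_fun setT (fun t =>
  (\prod_i (1 + `|x t i|) ^+ n * gauss_weight b (x t))%:E).
  apply/measurable_EFinP; apply: measurable_funM; first exact: measurable_growth.
  exact: measurable_gauss_weight.
rewrite /prod_measure fubini_tonelli1 //; last by move=> t; rewrite lee_fin ge0.
rewrite /fubini_F /=.
pose f1 t := \prod_i (1 + `|x1 t i|) ^+ n * gauss_weight b1 (x1 t).
pose f2 t := \prod_i (1 + `|x2 t i|) ^+ n * gauss_weight b2 (x2 t).
have m1 : measurable_fun setT (EFin \o f1).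
  apply/measurable_EFinP; apply: measurable_funM;
    first exact: measurable_growth (gs_meas G1).
  exact: measurable_gauss_weight (gs_meas G1).
have m2 : measurable_fun setT (EFin \o f2).
  apply/measurable_EFinP; apply: measurable_funM;
    first exact: measurable_growth (gs_meas G2).
  exact: measurable_gauss_weight (gs_meas G2).
have fE t1 : (\int[mu2]_t2 (\prod_i (1 + `|x (t1, t2) i|) ^+ n
      * gauss_weight b (x (t1, t2)))%:E
    = (f1 t1)%:E * \int[mu2]_t2 (f2 t2)%:E)%E.
  rewrite -ge0_integralZl //; first last.
  - by rewrite lee_fin ge0.
  - by move=> t _; rewrite lee_fin ge0.
  apply: eq_integral => t2 _; rewrite gauss_weight_sum big_sumType /= -EFinM /f1 /f2.
  by congr _%:E; ring.
under eq_integral do rewrite fE.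
rewrite ge0_integralZr //; last first.
- by apply: integral_ge0 => t _; rewrite lee_fin ge0.
- by move=> t _; rewrite lee_fin ge0.
by rewrite lte_mul_pinfty ?integral_ge0 // ?ge0_fin_numE ?integral_ge0 //
  ?(gs_fin G1, gs_fin G2) // => t _; rewrite lee_fin ge0.
Qed.

Let integrable F dF : poly_diff F dF ->
  (prod_measure mu1 mu2).-integrable setT (fun t =>
    (F (x t) * gauss_weight b (x t))%:E).
Proof. exact: integrable_poly_gauss mx fin. Qed.

(** The differentiated coordinate is integrated innermost: the weight of the other factor is then a
    constant, and the inner integral is zero for every value of the outer variable. *)
Let ibp F dF i : poly_diff F dF ->
  (\int[prod_measure mu1 mu2]_t
    ((dF (x t) (unit_dir R i) - 2 * b i * x t i * F (x t))
                 * gauss_weight b (x t))%:E = 0)%E.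
Proof.
move=> pF.
have [dF2 pdF] := poly_diff_dir (unit_dir R i) pF.
have pg := poly_diffD pdF (poly_diffN (poly_diffM (poly_diffM (poly_diff_cst _ (2
  * b i)) (poly_diff_crd R i)) pF)).
have ig := integrable pg.
case: i pdF pg ig => [i|j] pdF pg ig.
  rewrite /prod_measure -integral21_prod_meas1 //.
  apply: integral0_eq => t2 _; rewrite /fubini_G /=.
  transitivity (\int[mu1]_t1 ((gauss_weight b2 (x2 t2))%:E * ((dF (sum_fun (x1
    t1) (x2 t2)) (sum_fun (unit_dir R i) (fun=> 0))
     - 2 * b1 i * x1 t1 i * F (sum_fun (x1 t1) (x2 t2))) * gauss_weight b1 (x1
       t1))%:E))%E.
    apply: eq_integral => t1 _; rewrite -EFinM gauss_weight_sum /x /=.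
    rewrite (_ : unit_dir R (inl i) = sum_fun (unit_dir R i) (fun=> 0)); last first.
      by apply/funext => -[].
    by congr _%:E; ring.
  have pF1 := poly_diff_suml (x2 t2) pF.
  rewrite integralZl ?(gs_ibp G1 i pF1) ?mule0 //.
  have [dd pdF1] := poly_diff_dir (unit_dir R i) pF1.
  have := gs_integrable G1 (poly_diffD pdF1 (poly_diffN (poly_diffM (poly_diffM
    (poly_diff_cst _ (2 * b1 i)) (poly_diff_crd R i)) pF1))).
  exact.
rewrite /prod_measure -integral12_prod_meas1 //.
apply: integral0_eq => t1 _; rewrite /fubini_F /=.
transitivity (\int[mu2]_t2 ((gauss_weight b1 (x1 t1))%:E * ((dF (sum_fun (x1 t1)
  (x2 t2)) (sum_fun (fun=> 0) (unit_dir R j))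
   - 2 * b2 j * x2 t2 j * F (sum_fun (x1 t1) (x2 t2))) * gauss_weight b2 (x2
     t2))%:E))%E.
  apply: eq_integral => t2 _; rewrite -EFinM gauss_weight_sum /x /=.
  rewrite (_ : unit_dir R (inr j) = sum_fun (fun=> 0) (unit_dir R j)); last first.
    by apply/funext => -[].
  by congr _%:E; ring.
have pF2 := poly_diff_sumr (x1 t1) pF.
rewrite integralZl ?(gs_ibp G2 j pF2) ?mule0 //.
have [dd pdF1] := poly_diff_dir (unit_dir R j) pF2.
have := gs_integrable G2 (poly_diffD pdF1 (poly_diffN (poly_diffM (poly_diffM
  (poly_diff_cst _ (2 * b2 j)) (poly_diff_crd R j)) pF2))).
exact.
Qed.

Lemma prod_gauss_space : gauss_space (prod_measure mu1 mu2) x b.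
Proof.
split; [exact: mx|exact: fin|exact: ibp|move=> a r r0].
rewrite (_ : [set _ | _] =
    [set t | forall i, `|x1 t i - a (inl i)| < r] `*`
    [set t | forall i, `|x2 t i - a (inr i)| < r]); last first.
  apply/seteqP; split => -[t1 t2] /=.
    by move=> h; split=> i; [exact: (h (inl i))|exact: (h (inr i))].
  by move=> [h1 h2] [i|i]; [exact: h1|exact: h2].
set A1 := [set t | _]; set A2 := [set t | _].
suff : (0 < (mu1 \x mu2) (A1 `*` A2))%E by [].
rewrite product_measure1E; first last.
- exact: measurable_box (gs_meas G2).
- exact: measurable_box (gs_meas G1).
by rewrite mule_gt0 // ?(gs_box G1 (fun i => a (inl i))) ?(gs_box G2 (fun i =>
  a (inr i))).
Qed.

End prod_gauss_space.

Section gauss_space_transfer.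
Context (R : realType) d (T : measurableType d)
  (mu : {sigma_finite_measure set T -> \bar R}).

Lemma reindex_gauss_space (I J : finType) (x : T -> I -> R) (b : I -> R)
    (phi : J -> I) : bijective phi ->
  gauss_space mu x b ->
  gauss_space mu (fun t j => x t (phi j)) (fun j => b (phi j)).
Proof.
move=> bphi G.
have wE y : gauss_weight (fun j => b (phi j)) (fun j =>
  y (phi j)) = gauss_weight b y.
  by rewrite /gauss_weight [in RHS](reindex phi) //; exact: onW_bij.
split => [j|n|F dF j pF|a r r0].
- exact: gs_meas G _.
- apply: le_lt_trans (gs_fin G n); rewrite le_eqVlt; apply/orP; left; apply/eqP.
  apply: eq_integral => t _; rewrite wE [in RHS](reindex phi) //.
  exact: onW_bij.
- have pF' : poly_diff (fun y => F (fun j => y (phi j)))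
      (fun y v => dF (fun j => y (phi j)) (fun j => v (phi j))).
    apply: (@poly_diff_comp _ _ _ F dF (fun y j => y (phi j)) (fun _ v j =>
      v (phi j)) pF) => i.
    exact: poly_diff_crd.
  rewrite -[RHS](gs_ibp G (phi j) pF'); apply: eq_integral => t _; rewrite wE.
  rewrite (_ : (fun k => unit_dir R (phi j) (phi k)) = unit_dir R j) //.
  by apply/funext => k; rewrite /unit_dir (bij_eq bphi).
- case: bphi => psi phiK psiK.
  rewrite (_ : [set _ | _] = [set t | forall i, (`|x t i - a (psi i)| < r)%R]).
    exact: (gs_box G (fun i => a (psi i)) r0).
  apply/seteqP; split => t /= h i; first by have := h (psi i); rewrite psiK.
  by have := h (phi i); rewrite phiK.
Qed.

(** Needed because the measure on (n + 1)-tuples is the image of a product measure under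
    [cons_tuple], not itself a product. *)
Lemma pushforward_gauss_space d' (T' : measurableType d')
    (nu : {sigma_finite_measure set T' -> \bar R}) (e : T -> T')
    (I : finType) (y : T' -> I -> R) (b : I -> R) :
  measurable_fun setT e ->
  (forall A, nu A = pushforward mu e A) ->
  (forall i, measurable_fun setT (fun t => y t i)) ->
  gauss_space mu (fun t => y (e t)) b -> gauss_space nu y b.
Proof.
move=> me nuE my G.
have mw := measurable_gauss_weight b my.
have fin n : (\int[nu]_t (\prod_i (1 + `|y t i|) ^+ n * gauss_weight b (y t))%:E
  < +oo)%E.
  rewrite (eq_measure_integral (pushforward mu e)); last by move=> A _ _; exact: nuE.
  rewrite (ge0_integral_pushforward me) //.
  - exact: (gs_fin G n).
  - by apply/measurable_EFinP; apply: measurable_funM => //;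
    exact: measurable_growth.
  - move=> t _; rewrite lee_fin mulr_ge0 ?expR_ge0 // prodr_ge0 //.
split; [exact: my|exact: fin|move=> F dF i pF|move=> a r r0].
- rewrite (eq_measure_integral (pushforward mu e)); last by move=> A _ _; exact: nuE.
  have [dF2 pdF] := poly_diff_dir (unit_dir R i) pF.
  have pg := poly_diffD pdF (poly_diffN (poly_diffM (poly_diffM (poly_diff_cst _
    (2 * b i)) (poly_diff_crd R i)) pF)).
  have ig := gs_integrable G pg.
  rewrite (integral_pushforward me) //.
  + exact: (gs_ibp G i pF).
  + apply/measurable_EFinP; apply: measurable_funM => //.
    exact: (poly_diff_measurable pg).
- by rewrite nuE /pushforward; exact: (gs_box G a r0).
Qed.

End gauss_space_transfer.

Section tuple_gauss_space.
Context (R : realType) d (T : measurableType d)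
  (mu : {sigma_finite_measure set T -> \bar R}) (I : finType)
  (x : T -> I -> R).

Lemma tuple_gauss_space n (b : 'I_n -> I -> R) :
  (forall i, gauss_space mu x (b i)) ->
  gauss_space (tuple_measure mu n) (fun t (p : 'I_n * I) => x (tnth t p.1) p.2)
    (fun p => b p.1 p.2).
Proof.
elim: n b => [|n IHn] b G.
  have no (p : 'I_0 * I) : False by case: p => -[].
  have w1 (c : 'I_0 * I -> R) y : gauss_weight c y = 1.
    by rewrite /gauss_weight big1 ?oppr0 ?expR0 // => p; case: (no p).
  split => [p|m|F dF p|a r r0]; try by case: (no p).
  - rewrite (_ : (fun _ => _) = cst 1%E); last first.
      by apply/funext => t; rewrite w1 mulr1 big1 // => p; case: (no p).
    by rewrite integral_cst // mul1e /= diracT ltry.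
  - rewrite (_ : [set _ | _] = setT).
      by rewrite /= diracT lte01.
    by apply/seteqP; split => // t _ p; case: (no p).
have G' := prod_gauss_space (G ord0) (IHn _ (fun i => G (lift ord0 i))).
(* Index 0 goes to the head factor, the lifted indices to the tail. *)
pose phi (p : 'I_n.+1 * I) : I + 'I_n * I :=
  if unlift ord0 p.1 is Some j then inr (j, p.2) else inl p.2.
pose psi (s : I + 'I_n * I) : 'I_n.+1 * I :=
  match s with inl a => (ord0, a) | inr q => (lift ord0 q.1, q.2) end.
have bphi : bijective phi.
  exists psi => [[i a]|[a|[j a]]]; rewrite /phi /psi /=.
  - by case: unliftP => [j|] ->.
  - by rewrite unlift_none.
  - by rewrite liftK.
have Gphi := reindex_gauss_space bphi G'.
have my (p : 'I_n.+1 * I) : measurable_fun setT (fun t : n.+1.-tuple T =>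
  x (tnth t p.1) p.2).
  exact: (measurableT_comp (gs_meas (G ord0) p.2) (measurable_tnth p.1)).
refine (@pushforward_gauss_space R _ _ (prod_measure mu (tuple_measure mu n)) _ _
  (tuple_measure mu n.+1) (@Defs.cons_tuple _ T n) _ _ _ _ _ my _) => //.
  exact: measurable_cons_tuple.
rewrite (_ : (fun p => b p.1 p.2) = (fun p =>
  sum_fun (b ord0) (fun q : 'I_n * I => b (lift ord0 q.1) q.2) (phi p))); last first.
  by apply/funext => -[i a]; rewrite /phi /=; case: unliftP => [j|] ->.
rewrite (_ : (fun t => _) = (fun t p => sum_fun (x t.1) (fun q : 'I_n * I =>
  x (tnth t.2 q.1) q.2) (phi p))) //.
apply/funext => t; apply/funext => -[i a]; rewrite /phi /=.
by case: unliftP => [j|] -> /=; rewrite ?tnthS.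
Qed.

End tuple_gauss_space.

(** * Complex-valued and matrix-valued polynomial functions *)

Local Notation Re := complex.Re.
Local Notation Im := complex.Im.
Local Notation normc := ComplexField.Normc.normc.

Section re_im.
Context (R : realType).
Implicit Types x y : R[i].

Lemma cReD x y : Re (x + y) = Re x + Re y. Proof. by case: x; case: y. Qed.
Lemma cImD x y : Im (x + y) = Im x + Im y. Proof. by case: x; case: y. Qed.
Lemma cReM x y : Re (x * y) = Re x * Re y - Im x * Im y.
Proof. by case: x; case: y. Qed.
Lemma cImM x y : Im (x * y) = Re x * Im y + Im x * Re y.
Proof. by case: x; case: y. Qed.
Lemma cRe_conj x : Re (x^* ) = Re x. Proof. by case: x. Qed.
Lemma cIm_conj x : Im (x^* ) = - Im x. Proof. by case: x. Qed.
Lemma cRe_sum J (r : seq J) (P : pred J) (F : J -> R[i]) :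
  Re (\sum_(j <- r | P j) F j) = \sum_(j <- r | P j) Re (F j).
Proof. by apply: (big_morph (fun x => Re x)) => // x y; exact: cReD. Qed.
Lemma cIm_sum J (r : seq J) (P : pred J) (F : J -> R[i]) :
  Im (\sum_(j <- r | P j) F j) = \sum_(j <- r | P j) Im (F j).
Proof. by apply: (big_morph (fun x => Im x)) => // x y; exact: cImD. Qed.

Lemma normc_sqr x : normc x ^+ 2 = Re x ^+ 2 + Im x ^+ 2.
Proof. by case: x => a b /=; rewrite sqr_sqrtr // addr_ge0 // sqr_ge0. Qed.

Lemma normcX x n : normc (x ^+ n) = normc x ^+ n.
Proof.
elim: n => [|n IH]; first by rewrite !expr0 ComplexField.Normc.normc1.
by rewrite !exprS ComplexField.Normc.normcM IH.
Qed.

Lemma normc_real (a : R) : normc a%:C%C = `|a|.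
Proof. by rewrite /= expr0n /= addr0 sqrtr_sqr. Qed.

End re_im.

Section cpoly_diff.
Context (R : realType) (I : Type).
Local Notation C := R[i].

Definition cpoly_diff (F : (I -> R) -> C) (dF : (I -> R) -> (I -> R) -> C) :=
  poly_diff (fun x => Re (F x)) (fun x v => Re (dF x v)) /\
  poly_diff (fun x => Im (F x)) (fun x v => Im (dF x v)).

Lemma eq_cpoly_diff F dF G dG : cpoly_diff F dF -> F =1 G ->
  (forall x v, dF x v = dG x v) -> cpoly_diff G dG.
Proof.
move=> [F1 F2] FG dFG; split.
  by apply: (eq_poly_diff F1) => [x|x v]; rewrite ?FG ?dFG.
by apply: (eq_poly_diff F2) => [x|x v]; rewrite ?FG ?dFG.
Qed.

Lemma cpoly_diff_cst c : cpoly_diff (fun=> c) (fun _ _ => 0).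
Proof. by split; exact: poly_diff_cst. Qed.

Lemma cpoly_diffM F dF G dG : cpoly_diff F dF -> cpoly_diff G dG ->
  cpoly_diff (fun x => F x * G x) (fun x v => dF x v * G x + F x * dG x v).
Proof.
move=> [F1 F2] [G1 G2]; split.
  apply: (eq_poly_diff (poly_diffD (poly_diffM F1 G1) (poly_diffN (poly_diffM F2
    G2)))) => [x|x v].
    by rewrite cReM.
  by rewrite cReD !cReM; ring.
apply: (eq_poly_diff (poly_diffD (poly_diffM F1 G2) (poly_diffM F2 G1))) => [x|x v].
  by rewrite cImM.
by rewrite cImD !cImM; ring.
Qed.

Lemma cpoly_diff_sum J (r : seq J) (P : pred J) (F : J -> (I -> R) -> C) dF :
  (forall j, cpoly_diff (F j) (dF j)) ->
  cpoly_diff (fun x => \sum_(j <- r | P j) F j x)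
             (fun x v => \sum_(j <- r | P j) dF j x v).
Proof.
move=> pF; split.
  apply: (eq_poly_diff (poly_diff_sum r P (fun j => (pF j).1))) => [x|x v];
  by rewrite cRe_sum.
apply: (eq_poly_diff (poly_diff_sum r P (fun j => (pF j).2))) => [x|x v];
by rewrite cIm_sum.
Qed.

Lemma cpoly_diff_prod J (r : seq J) (F : J -> (I -> R) -> C) dF :
  (forall j, cpoly_diff (F j) (dF j)) ->
  exists d, cpoly_diff (fun x => \prod_(j <- r) F j x) d.
Proof.
move=> pF; elim: r => [|j r [d IH]].
  exists (fun _ _ => 0).
  by apply: (eq_cpoly_diff (cpoly_diff_cst 1)) => // x; rewrite big_nil.
exists (fun x v => dF j x v * \prod_(i <- r) F i x + F j x * d x v).
by apply: (eq_cpoly_diff (cpoly_diffM (pF j) IH)) => // x; rewrite big_cons.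
Qed.

Definition mxpoly_diff m n (A : (I -> R) -> 'M[C]_(m, n))
    (dA : (I -> R) -> (I -> R) -> 'M[C]_(m, n)) :=
  forall i j, cpoly_diff (fun x => A x i j) (fun x v => dA x v i j).

Lemma mxpoly_diff_cst m n (M : 'M[C]_(m, n)) : mxpoly_diff (fun=> M) (fun _ _ => 0).
Proof.
by move=> i j; apply: (eq_cpoly_diff (cpoly_diff_cst (M i j))) => // x v;
  rewrite mxE.
Qed.

Lemma mxpoly_diffM m n p (A : (I -> R) -> 'M[C]_(m, n)) dA
    (B : (I -> R) -> 'M[C]_(n, p)) dB :
  mxpoly_diff A dA -> mxpoly_diff B dB ->
  mxpoly_diff (fun x => A x *m B x) (fun x v => dA x v *m B x + A x *m dB x v).
Proof.
move=> pA pB i j.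
apply: (eq_cpoly_diff (cpoly_diff_sum (index_enum 'I_n) predT (fun k =>
  cpoly_diffM (pA i k) (pB k j)))) => [x|x v].
  by rewrite mxE.
by rewrite !mxE big_split.
Qed.

Lemma eq_mxpoly_diff m n (A B : (I -> R) -> 'M[C]_(m, n)) dA dB :
  mxpoly_diff A dA -> A =1 B -> (forall x v, dA x v = dB x v) -> mxpoly_diff B dB.
Proof.
by move=> pA AB dAB i j; apply: (eq_cpoly_diff (pA i j)) => [x|x v];
  rewrite ?AB ?dAB.
Qed.

(** The direction need not commute with [A], so each factor is varied in its own place. The
    truncated subtraction is harmless: the sum is empty when m = 0. *)
Lemma mxpoly_diffX n (A : (I -> R) -> 'M[C]_n) dA m :
  mxpoly_diff A dA ->
  mxpoly_diff (fun x => A x ^+ m)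
    (fun x v => \sum_(a < m) A x ^+ a *m dA x v *m A x ^+ (m.-1 - a)).
Proof.
move=> pA; elim: m => [|m IH].
  apply: (eq_mxpoly_diff (mxpoly_diff_cst (1 : 'M[C]_n))) => [x|x v] //.
  by rewrite big_ord0.
apply: (eq_mxpoly_diff (mxpoly_diffM IH pA)) => [x|x v]; first by rewrite exprSr.
rewrite big_ord_recr /= subnn expr0 mulmx1.
congr (_ + _); rewrite mulmx_suml; apply: eq_bigr => a _.
rewrite -!mulmxA; congr (_ *m (_ *m _)).
rewrite -[X in _ *m X]expr1 -[LHS]exprD; congr (_ ^+ _).
by have := ltn_ord a; case: (m) a => [[]//|k] a /=; rewrite ltnS => ak;
  rewrite addn1 subSn.
Qed.

End cpoly_diff.

(** * Hermitian matrices in real coordinates *)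

Section hermitian.
Context (R : realType) (N : nat).
Local Notation C := R[i].
Local Notation J := ('I_N * 'I_N)%type.
Implicit Types (y v : J -> R) (M : 'M[C]_N).

Definition self_adjoint M := forall i j, M j i = (M i j)^*.

(** The layout of [herm_of], with coordinates as a function on index pairs: real parts above the
    diagonal, imaginary parts at the transposed places. The two agree by computation, which
    [mx_crd_model] relies on. *)
Definition herm_mx y : 'M[C]_N :=
  \matrix_(i, j)
    if (i < j)%N then (y (i, j) +i* y (j, i))%C
    else if (j < i)%N then (y (j, i) -i* y (i, j))%C
    else (y (i, i))%:C%C.

Definition herm_crd M : J -> R := fun p =>
  if (p.1 < p.2)%N then Re (M p.1 p.2)
  else if (p.2 < p.1)%N then Im (M p.2 p.1) else Re (M p.1 p.1).

Lemma eq_re_im (x z : C) : Re x = Re z -> Im x = Im z -> x = z.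
Proof. by case: x => a b; case: z => c d /= -> ->. Qed.

Lemma herm_mx_sa y : self_adjoint (herm_mx y).
Proof.
move=> i j; rewrite !mxE; have [ij|ji|/val_inj ->] := ltngtP i j.
- by apply: eq_re_im; rewrite ?cRe_conj ?cIm_conj.
- by apply: eq_re_im; rewrite ?cRe_conj ?cIm_conj //= opprK.
- by apply: eq_re_im; rewrite ?cRe_conj ?cIm_conj //= oppr0.
Qed.

Lemma self_adjointX M n : self_adjoint M -> self_adjoint (M ^+ n).
Proof.
move=> sM; elim: n => [|n IH] i j.
  by rewrite !expr0 !mxE [j == i]eq_sym; case: eqP; rewrite ?conjC1 ?conjC0.
rewrite {1}exprS exprSr !mxE rmorph_sum; apply: eq_bigr => k _.
by rewrite [M j k]sM [(M ^+ n) k i]IH -rmorphM mulrC.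
Qed.

Lemma herm_crdK M : self_adjoint M -> herm_mx (herm_crd M) = M.
Proof.
move=> sM; apply/matrixP => i j; rewrite !mxE /herm_crd /=.
have [ij|ji|/val_inj ->] := ltngtP i j; rewrite ?ltnn.
- by apply: eq_re_im.
- by rewrite [RHS]sM; apply: eq_re_im; rewrite ?cRe_conj ?cIm_conj.
- have := congr1 (fun x => Im x) (sM j j); rewrite cIm_conj => h.
  by apply: eq_re_im => //=; lra.
Qed.

Lemma herm_mx_line y v (e : R) :
  herm_mx (fun p => y p + e * v p) = herm_mx y + e%:C%C *: herm_mx v.
Proof.
apply/matrixP => i j; rewrite !mxE; have [ij|ji|ij] := ltngtP i j;
  apply: eq_re_im; rewrite ?(cReD, cImD, cReM, cImM) /=; ring.
Qed.

Lemma mxpoly_diff_herm : @mxpoly_diff R J N N herm_mx (fun=> herm_mx).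
Proof.
move=> i j; split.
  apply: (eq_poly_diff (poly_diff_crd R (if (i < j)%N then (i, j) else if (j <
    i)%N then (j, i) else (i, i)))) => [x|x v]; rewrite mxE; by case: ltngtP.
have [ij|ji|ij] := ltngtP i j.
- apply: (eq_poly_diff (poly_diff_crd R (j, i))) => [x|x v]; by rewrite mxE ij.
- apply: (eq_poly_diff (poly_diffN (poly_diff_crd R (i, j)))) => [x|x v];
  by rewrite mxE ltnNge (ltnW ji) /= ji.
- apply: (eq_poly_diff (poly_diff_cst J 0)) => [x|x v]; by rewrite mxE ij ltnn.
Qed.

(** The real and imaginary parts of one entry sit at transposed positions, so coordinate sums match
    trace sums only after each position is paired with its transpose. *)
Lemma sum_pairing (g h : J -> R) :
  (forall i j, g (i, j) + g (j, i) = h (i, j) + h (j, i)) ->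
  \sum_p g p = \sum_p h p.
Proof.
move=> gh; have sw (f : J -> R) : \sum_(p : J) f p = \sum_(p : J) f (p.2, p.1).
  by apply: (@reindex_inj _ _ _ _ (fun p : J => (p.2, p.1))) => -[a b] [c d] [-> ->].
suff : (\sum_p g p) *+ 2 = (\sum_p h p) *+ 2 by move/eqP;
  rewrite eqr_pMn2r // => /eqP.
rewrite !mulr2n {2}(sw g) {2}(sw h) -!big_split /=.
by apply: eq_bigr => -[i j] _; exact: gh.
Qed.

(** Tr X^2 counts diagonal coordinates once and the others twice; the Gaussian weight is thus exp (-
    B Tr X^2), the square of the factor in the wave function. *)
Definition herm_wt (B : R) (p : J) : R := if p.1 == p.2 then B else 2 * B.

(** Evaluates the drift term of the integration by parts: with M = X^n it becomes B p_(n+1). *)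
Lemma herm_wtE (B : R) y M : self_adjoint M ->
  \sum_p herm_wt B p * y p * herm_crd M p = B * Re (\tr (herm_mx y *m M)).
Proof.
move=> sM; rewrite /mxtrace cRe_sum mulr_sumr.
transitivity (\sum_(p : J) B * Re (herm_mx y p.1 p.2 * M p.2 p.1)); last first.
  rewrite -(pair_bigA _ (fun i j => B * Re (herm_mx y i j * M j i))) /=.
  apply: eq_bigr => i _; rewrite mxE cRe_sum mulr_sumr.
  by apply: eq_bigr => j _.
apply: sum_pairing => i j;
  rewrite /herm_wt /herm_crd !mxE /= ![M j i]sM [j == i]eq_sym.
have ij0 : (i == j) = (i == j :> nat) by [].
have [ij|ji|/val_inj <-] := ltngtP i j.
- rewrite ij0 ltn_eqF // !cReM ?cRe_conj ?cIm_conj /=; ring.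
- rewrite ij0 gtn_eqF // !cReM ?cRe_conj ?cIm_conj /=.
  rewrite -[M i j]conjCK -sM !cRe_conj !cIm_conj; ring.
- by rewrite eqxx !cReM /= ?cRe_conj; ring.
Qed.

Lemma herm_wt_sqr (B : R) y :
  \sum_p herm_wt B p * y p ^+ 2 = B * Re (\tr (herm_mx y ^+ 2)).
Proof.
rewrite (_ : herm_mx y ^+ 2 = herm_mx y *m herm_mx y) // -(herm_wtE B y
  (herm_mx_sa y)).
apply: eq_bigr => -[i j] _; rewrite expr2 -mulrA; congr (_ * (_ * _)).
by rewrite /herm_crd !mxE /=; have [ij|ji|/val_inj ->] := ltngtP i j; rewrite ?ltnn.
Qed.

End hermitian.

(** * Divergence of the vector field X^n *)

Section divergence.
Context (R : realType) (N : nat).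
Local Notation C := R[i].
Local Notation J := ('I_N * 'I_N)%type.

(** The power sum p_m as a real number. For self-adjoint X the real part discards nothing, by
    [tr_self_adjoint] and [self_adjointX]. *)
Definition ptr m (X : 'M[C]_N) : R := Re (\tr (X ^+ m)).

Lemma tr_self_adjoint (M : 'M[C]_N) : self_adjoint M -> \tr M = (Re (\tr M))%:C%C.
Proof.
move=> sM; apply: eq_re_im => //=; rewrite /mxtrace cIm_sum big1 // => i _.
have := congr1 (fun x => Im x) (sM i i); rewrite cIm_conj => h.
by apply/eqP; rewrite -[_ == 0](mulrn_eq0 _ 2) mulr2n {1}h addNr.
Qed.

Lemma mul_delta_mx_entry (A B : 'M[C]_N) i j r c :
  (A *m delta_mx i j *m B) r c = A r i * B j c.
Proof.
rewrite mxE (bigD1 j) //= big1 ?addr0 => [|k kj].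
  rewrite mxE (bigD1 i) //= big1 ?addr0 => [|k ki]; rewrite !mxE ?eqxx ?mulr1 //.
  by rewrite (negbTE ki) mulr0.
by rewrite mxE big1 ?mul0r // => k' _; rewrite mxE (negbTE kj) andbF mulr0.
Qed.

Lemma andb_eq2F (a b c d : nat) : (a = c -> b = d -> False) ->
  (a == c) && (b == d) = false.
Proof. by move=> h; apply/negP => /andP[/eqP ac /eqP bd]; exact: h. Qed.

Lemma herm_mx_unit_lt (i j : 'I_N) : (i < j)%N ->
  herm_mx (unit_dir R (i, j)) = delta_mx i j + delta_mx j i.
Proof.
move=> ij; apply/matrixP => r c; rewrite !mxE /unit_dir !xpair_eqE -!val_eqE /=.
have [rc|rc|rc] := ltngtP r c.
- have no : r = j :> nat -> c = i :> nat -> False.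
    by move=> a b; move: rc; rewrite a b ltnNge (ltnW ij).
  rewrite (andb_eq2F no) [(c == i :> nat) && _]andbC (andb_eq2F no) addr0.
  by apply: eq_re_im; case: (_ && _).
- have no : r = i :> nat -> c = j :> nat -> False.
    by move=> a b; move: rc; rewrite a b ltnNge (ltnW ij).
  rewrite (andb_eq2F no) add0r [(c == i :> nat) && _]andbC.
  by apply: eq_re_im; case: (_ && _); rewrite /= ?oppr0.
- have no a b : a != b :> nat -> (c == a :> nat) && (c == b :> nat) = false.
    by move=> ab; apply: andb_eq2F => -> /eqP; rewrite (negbTE ab).
  by rewrite rc !no ?addr0 ?(ltn_eqF ij) ?(gtn_eqF ij) //; apply: eq_re_im.
Qed.

Lemma herm_mx_unit_gt (i j : 'I_N) : (i < j)%N ->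
  herm_mx (unit_dir R (j, i)) = 'i%C *: (delta_mx i j - delta_mx j i).
Proof.
move=> ij; apply/matrixP => r c; rewrite !mxE /unit_dir !xpair_eqE -!val_eqE /=.
have [rc|rc|rc] := ltngtP r c.
- have no : r = j :> nat -> c = i :> nat -> False.
    by move=> a b; move: rc; rewrite a b ltnNge (ltnW ij).
  rewrite (andb_eq2F no) subr0 [(c == j :> nat) && _]andbC.
  by apply: eq_re_im; case: (_ && _);
    rewrite !(cReM, cImM) /= ?(mulr0, mul0r, mul1r, subr0, addr0, add0r);
      rewrite ?oppr0.
- have no : r = i :> nat -> c = j :> nat -> False.
    by move=> a b; move: rc; rewrite a b ltnNge (ltnW ij).
  rewrite [(c == j :> nat) && _]andbC (andb_eq2F no) sub0r.
  by apply: eq_re_im; case: (_ && _);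
    rewrite !(cReM, cImM) /= ?(mulr0, mul0r, mul1r, subr0, addr0, add0r, oppr0,
      mulrN1).
- have no a b : a != b :> nat -> (c == a :> nat) && (c == b :> nat) = false.
    by move=> ab; apply: andb_eq2F => -> /eqP; rewrite (negbTE ab).
  by rewrite rc !no ?subr0 ?mulr0 ?(ltn_eqF ij) ?(gtn_eqF ij) //; apply: eq_re_im.
Qed.

Lemma herm_mx_unit_diag (i : 'I_N) : herm_mx (unit_dir R (i, i)) = delta_mx i i.
Proof.
apply/matrixP => r c; rewrite !mxE /unit_dir !xpair_eqE -!val_eqE /=.
have [rc|rc|rc] := ltngtP r c.
- rewrite !(@andb_eq2F r c i i) ?(@andb_eq2F c r i i); last 2 first.
  + by move=> a b; move: rc; rewrite a b ltnn.
  + by move=> a b; move: rc; rewrite a b ltnn.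
  by apply: eq_re_im.
- rewrite !(@andb_eq2F r c i i) ?(@andb_eq2F c r i i); last 2 first.
  + by move=> a b; move: rc; rewrite a b ltnn.
  + by move=> a b; move: rc; rewrite a b ltnn.
  by apply: eq_re_im; rewrite /= ?oppr0.
- by rewrite -rc andbb; apply: eq_re_im; case: (_ == _).
Qed.

Definition dpow n (X E : 'M[C]_N) := \sum_(a < n) X ^+ a *m E *m X ^+ (n.-1 - a).

(** Write A = X^a and C = X^(n-1-a). For i < j the real direction at (i, j) contributes the real
    part of A_ii C_jj + A_ij C_ij and the imaginary direction that of A_ii C_jj - A_ij C_ij. The
    off-diagonal products cancel and a product of traces remains. *)
Lemma divergence_pow n (X : 'M[C]_N) : self_adjoint X ->
  \sum_p herm_crd (dpow n X (herm_mx (unit_dir R p))) p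
  = \sum_(a < n) ptr a X * ptr (n.-1 - a) X.
Proof.
move=> sX.
transitivity (\sum_(p : J) Re (\sum_(a < n) (X ^+ a) p.1 p.1 * (X ^+ (n.-1 - a))
  p.2 p.2)); last first.
  under eq_bigr do rewrite cRe_sum.
  rewrite exchange_big /=; apply: eq_bigr => a _.
  rewrite -cRe_sum -(pair_bigA _ (fun i j =>
    (X ^+ a) i i * (X ^+ (n.-1 - a)) j j)) /=.
  under eq_bigr do rewrite -mulr_sumr.
  rewrite -mulr_suml -/(\tr (X ^+ a)) -/(\tr (X ^+ (n.-1 - a))).
  have /(congr1 (fun z => Im z)) /= Ima := tr_self_adjoint (self_adjointX a sX).
  by rewrite cReM Ima mul0r subr0.
have lt_case (i j : 'I_N) : (i < j)%N ->
   herm_crd (dpow n X (herm_mx (unit_dir R (i, j)))) (i, j)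
   + herm_crd (dpow n X (herm_mx (unit_dir R (j, i)))) (j, i)
   = Re (\sum_(a < n) (X ^+ a) i i * (X ^+ (n.-1 - a)) j j)
   + Re (\sum_(a < n) (X ^+ a) j j * (X ^+ (n.-1 - a)) i i).
  move=> ij.
  rewrite /herm_crd /= ij ltnNge (ltnW ij) /= (herm_mx_unit_lt ij)
    (herm_mx_unit_gt ij).
  rewrite /dpow !summxE.
  (* The exchange of a with n - 1 - a swaps the roles of i and j, so both right-hand sums equal the
     one produced by the directions. *)
  have -> : \sum_(a < n) (X ^+ a) j j * (X ^+ (n.-1 - a)) i i
          = \sum_(a < n) (X ^+ a) i i * (X ^+ (n.-1 - a)) j j.
    rewrite (reindex_inj rev_ord_inj) /=; apply: eq_bigr => a _.
    rewrite mulrC; congr ((X ^+ _) _ _ * (X ^+ _) _ _).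
      by have := ltn_ord a; case: (n) a => [[]//|m] a /=;
        rewrite !ltnS subSS => am; rewrite subKn.
    by case: (n) a => [[]//|m] a /=; rewrite subSS.
  rewrite !cRe_sum cIm_sum -!big_split /=; apply: eq_bigr => a _.
  rewrite mulmxDr mulmxDl mxE !mul_delta_mx_entry.
  rewrite -scalemxAr -scalemxAl mxE mulmxBr mulmxBl mxE [in X in _ * (_ + X)]mxE
    !mul_delta_mx_entry.
  rewrite cReD cImM /=; rewrite cReD; ring.
apply: sum_pairing => i j.
have [ij|ji|/val_inj ->] := ltngtP i j; first exact: lt_case.
  by rewrite addrC [RHS]addrC; exact: lt_case.
congr (_ + _).
  rewrite herm_mx_unit_diag /herm_crd /= ltnn; congr Re.
  by rewrite /dpow summxE; apply: eq_bigr => a _; rewrite mul_delta_mx_entry.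
rewrite herm_mx_unit_diag /herm_crd /= ltnn; congr Re.
by rewrite /dpow summxE; apply: eq_bigr => a _; rewrite mul_delta_mx_entry.
Qed.

End divergence.

(** * Variation of the traces and of the determinant along X^n *)

Section poly_deriv0.
Context (R : realType).

Lemma deriv0_prod (I : Type) (r : seq I) (P : pred I) (g : I -> R) :
  ((\prod_(i <- r | P i) (1 + g i *: 'X))^`()).[0] = \sum_(i <- r | P i) g i
  /\ (\prod_(i <- r | P i) (1 + g i *: 'X)).[0] = 1 :> R.
Proof.
elim: r => [|i r [IH1 IH2]]; first by rewrite !big_nil derivC !hornerC.
rewrite !big_cons; case: (P i) => //.
have d1 : (1 + g i *: 'X : {poly R})^`() = (g i)%:P.
  by rewrite derivD derivC add0r derivZ derivX alg_polyC.
split; last by rewrite hornerM IH2 !hornerE; ring.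
by rewrite derivM d1 hornerD !hornerM IH1 IH2 !hornerE; ring.
Qed.

End poly_deriv0.

Section diag_conj.
Context (F : fieldType) (N : nat).
Implicit Types (P : 'M[F]_N) (d : 'rV[F]_N).

Lemma conj_diagX P d m : P \in unitmx ->
  (invmx P *m diag_mx d *m P) ^+ m = invmx P *m diag_mx (\row_i d 0 i ^+ m) *m P.
Proof.
move=> uP; elim: m => [|m IH].
  rewrite expr0 (_ : diag_mx _ = 1%:M) ?mulmx1 ?mulVmx //.
  by apply/matrixP => i j; rewrite !mxE expr0.
rewrite exprSr IH -[_ * _]/(_ *m _) !mulmxA mulmxK //.
rewrite -!mulmxA; congr (_ *m _); rewrite !mulmxA; congr (_ *m _).
rewrite mulmx_diag; congr diag_mx; apply/rowP => i.
by rewrite !mxE exprSr.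
Qed.

Lemma tr_conj_diag P d : P \in unitmx ->
  \tr (invmx P *m diag_mx d *m P) = \sum_i d 0 i.
Proof.
by move=> uP; rewrite mxtrace_mulC mulmxA mulmxV // mul1mx mxtrace_diag.
Qed.

Lemma conj_diag_line P d n e : P \in unitmx ->
  let M := invmx P *m diag_mx d *m P in
  M + e *: M ^+ n = invmx P *m diag_mx (\row_i (d 0 i + e * d 0 i ^+ n)) *m P.
Proof.
move=> uP M; rewrite conj_diagX // scalemxAl scalemxAr -mulmxDl -mulmxDr.
congr (_ *m _ *m _); apply/matrixP => i j; rewrite !mxE.
by have [->|] := eqVneq i j; rewrite ?mulr0n ?mulr0 ?addr0 // !mulr1n.
Qed.

End diag_conj.

Section spectral_lines.
Context (R : realType) (N : nat).
Local Notation C := R[i].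
Implicit Types (X P : 'M[C]_N) (l d : 'rV[C]_N).

Definition ldet l X : C :=
  \sum_(s : 'S_N) (-1) ^+ s * \prod_(m < N) (l *m X ^+ m) 0 (s m).

(** Row m is (l P^-1) diag(d^m) P, so the matrix factors as Vandermonde matrix times diag(l P^-1)
    times P. The eigenvalues [d] occur only in the Vandermonde factor. *)
Lemma ldet_conj_diag l P d : P \in unitmx ->
  ldet l (invmx P *m diag_mx d *m P)
  = (\prod_(i < N) \prod_(j < N | (i < j)%N) (d 0 j - d 0 i))
    * (\prod_j (l *m invmx P) 0 j * \det P).
Proof.
move=> uP; pose V := Vandermonde N d *m diag_mx (l *m invmx P) *m P.
transitivity (\det V).
  apply: eq_bigr => s _; congr (_ * _); apply: eq_bigr => m _.
  rewrite conj_diagX // !mulmxA mxE [RHS]mxE; apply: eq_bigr => k _; congr (_ * _).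
  by rewrite mul_mx_diag mul_mx_diag !mxE mulrC.
by rewrite !det_mulmx det_Vandermonde det_diag mulrA.
Qed.

Lemma spectral_self_adjoint X : self_adjoint X ->
  exists2 P, P \in unitmx & X = invmx P *m diag_mx (\row_i (eigval X i)%:C%C) *m P.
Proof.
move=> sX; have hX : X \is hermsymmx.
  apply/is_hermitianmxP; rewrite expr0 scale1r; apply/matrixP => i j.
  by rewrite !mxE sX.
exists (spectralmx X); first exact: spectral_unit.
have nX : X \is normalmx.
  apply/normalmxP; move/is_hermitianmxP : hX; rewrite expr0 scale1r => <- //.
have {1}-> := orthomx_spectralP nX; set d := \row_i _.
have -> // : spectral_diag X = d.
apply/rowP => i; rewrite mxE /eigval.
have /mxOverP /(_ 0 i) := hermitian_spectral_diag_real hX.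
by move=> /complex_realP [r ->].
Qed.

Variables (X : 'M[C]_N) (n : nat).
Hypothesis sX : self_adjoint X.
Local Notation x := (eigval X).

Lemma ptrE m : ptr m X = \sum_i x i ^+ m.
Proof.
have [P uP XE] := spectral_self_adjoint sX.
rewrite /ptr {1}XE conj_diagX // tr_conj_diag // cRe_sum; apply: eq_bigr => i _.
by rewrite !mxE -rmorphXn.
Qed.

(** X^n commutes with X: a single [P] diagonalises the whole line, and only the eigenvalues move
    with e. *)
Lemma line_conj_diag : exists2 P, P \in unitmx &
  forall e : R, X + e%:C%C *: X ^+ n
    = invmx P *m diag_mx (\row_i (x i + e * x i ^+ n)%:C%C) *m P.
Proof.
have [P uP XE] := spectral_self_adjoint sX.
exists P; first exact: uP.
move=> e; have := conj_diag_line (\row_i (x i)%:C%C) n e%:C%C uP;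
  rewrite /= -XE => ->.
apply: (congr1 (fun d => invmx P *m diag_mx d *m P)).
by apply/rowP => i; rewrite !mxE rmorphD rmorphM rmorphXn.
Qed.

(** At m = 0 the coefficient is 0, so the value of the truncated predecessor is immaterial there. *)
Lemma ptr_line m : exists2 q : {poly R},
  (forall e, ptr m (X + e%:C%C *: X ^+ n) = q.[e]) &
  (q^`()).[0] = m%:R * ptr (m + n).-1 X.
Proof.
have [P uP line] := line_conj_diag.
exists (\sum_i ((x i)%:P + (x i ^+ n) *: 'X) ^+ m) => [e|].
  rewrite /ptr line conj_diagX // tr_conj_diag // cRe_sum horner_sum.
  by apply: eq_bigr => i _; rewrite !mxE -rmorphXn /= !hornerE [e * _]mulrC.
rewrite linear_sum /= horner_sum ptrE mulr_sumr; apply: eq_bigr => i _.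
case: m => [|m]; first by rewrite expr0 derivC hornerC mul0r.
rewrite deriv_exp derivD derivC add0r derivZ derivX.
by rewrite hornerMn !hornerE ?mulr0 ?addr0 /= exprD -mulr_natl; ring.
Qed.

(** The divided difference of x^n at two eigenvalues, expanded as a sum so that it keeps its
    meaning, n x^(n-1), when they coincide. *)
Definition gap (i j : 'I_N) : R := \sum_(a < n) x j ^+ (n.-1 - a) * x i ^+ a.

(** [ldet_conj_diag] at e and at 0 differ only in the Vandermonde factor, and each difference x_j -
    x_i is multiplied by 1 + e [gap i j]. Nothing is divided by [ldet l X], so its zeros are
    covered. *)
Lemma ldet_line l (e : R) :
  ldet l (X + e%:C%C *: X ^+ n)
  = ldet l X * (\prod_(i < N) \prod_(j < N | (i < j)%N) (1 + gap i j *: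
    'X)).[e]%:C%C.
Proof.
have [P uP line] := line_conj_diag.
have lineE e' := etrans (congr1 (ldet l) (line e')) (ldet_conj_diag l _ uP).
have := lineE 0; rewrite scale0r addr0 => ->.
apply: etrans (lineE e) _; rewrite [RHS]mulrAC; congr (_ * _).
rewrite horner_prod rmorph_prod -big_split /=; apply: eq_bigr => i _.
rewrite horner_prod rmorph_prod -big_split /=; apply: eq_bigr => j _.
rewrite !mxE !mul0r !addr0 -!rmorphB -rmorphM /= !hornerE; congr (_%:C)%C.
have := subrXX (x j) (x i) n; rewrite -/(gap i j) => h.
rewrite (_ : _ - _ = (x j - x i) + e * (x j ^+ n - x i ^+ n)); last by ring.
by rewrite h; ring.
Qed.

End spectral_lines.

Section log_derivatives.
Context (R : realType) (N : nat).
Local Notation C := R[i].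
Local Notation J := ('I_N * 'I_N)%type.

Lemma gapC (X : 'M[C]_N) n i j : gap X n i j = gap X n j i.
Proof.
rewrite /gap (reindex_inj rev_ord_inj) /=; apply: eq_bigr => a _.
rewrite mulrC; congr (_ ^+ _ * _ ^+ _).
  by case: (n) a => [[]//|m] a /=; rewrite subSS.
by have := ltn_ord a; case: (n) a => [[]//|m] a /=; rewrite !ltnS subSS => am;
  rewrite subKn.
Qed.

(** By symmetry the left side runs over all ordered pairs of distinct indices. The sum over all
    pairs factors into traces, and the diagonal, where the gap is n x_i^(n-1), has to be
    subtracted. *)
Lemma sum_gap (X : 'M[C]_N) n : self_adjoint X ->
  2 * (\sum_(i < N) \sum_(j < N | (i < j)%N) gap X n i j)
  = \sum_(a < n) ptr a X * ptr (n.-1 - a) X - n%:R * ptr n.-1 X.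
Proof.
move=> sX.
transitivity (\sum_(p : J) (gap X n p.1 p.2 - if p.1 == p.2 then gap X n p.1 p.2
  else 0)).
  rewrite pair_big_dep mulr_sumr big_mkcond /=.
  apply: (@sum_pairing R N (fun p =>
    if (p.1 < p.2)%N then 2 * gap X n p.1 p.2 else 0)
    (fun p => gap X n p.1 p.2 - if p.1 == p.2 then gap X n p.1 p.2 else 0)) =>
      i j /=.
  rewrite (gapC X n j i) -!val_eqE /=.
  by have [ij|ij|/val_inj ->] := ltngtP i j;
    rewrite ?eqxx ?(gtn_eqF ij) ?(ltn_eqF ij); ring.
rewrite big_split /= sumrN; congr (_ - _).
  rewrite -(pair_bigA _ (gap X n)) /= /gap.
  under eq_bigr do rewrite exchange_big.
  rewrite exchange_big; apply: eq_bigr => a _; rewrite !ptrE //.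
  rewrite big_distrl /=; apply: eq_bigr => i _.
  by rewrite big_distrr /=; apply: eq_bigr => j _; rewrite mulrC.
rewrite -big_mkcond /= -(pair_big_dep predT (fun i j => i == j) (gap X n)) /=.
rewrite ptrE // mulr_sumr; apply: eq_bigr => i _.
rewrite (big_pred1 i) => [|j]; last by rewrite /= eq_sym.
rewrite (_ : _ * _ = \sum_(a < n) eigval X i ^+ n.-1); last first.
  by rewrite sumr_const card_ord mulr_natl.
apply: eq_bigr => a _; rewrite -exprD; congr (_ ^+ _).
by have := ltn_ord a; case: (n) a => [[]//|m] a /=; rewrite ltnS; exact: subnK.
Qed.

(** The gaps are real, so the squared modulus is multiplied by Q(e)^2, a polynomial, whatever the
    sign of Q(e). Its derivative at 0 is 2 Q'(0), since Q(0) = 1. *)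
Lemma ldet_normc_line (X : 'M[C]_N) n (l : 'rV[C]_N) : self_adjoint X ->
  exists2 q : {poly R},
    (forall e : R, normc (ldet l (X + e%:C%C *: X ^+ n)) ^+ 2 = q.[e]) &
    (q^`()).[0] = (\sum_(a < n) ptr a X * ptr (n.-1 - a) X - n%:R * ptr n.-1 X)
                  * normc (ldet l X) ^+ 2.
Proof.
move=> sX; rewrite -sum_gap //.
pose Q : {poly R} := \prod_(p : J | (p.1 < p.2)%N) (1 + gap X n p.1 p.2 *: 'X).
have [Q'0 Q0] := deriv0_prod (index_enum J) (fun p : J =>
  (p.1 < p.2)%N) (fun p => gap X n p.1 p.2).
exists ((normc (ldet l X) ^+ 2)%:P * Q ^+ 2) => [e|].
  rewrite ldet_line // ComplexField.Normc.normcM normc_real exprMn real_normK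
    ?num_real //.
  by rewrite pair_big_dep hornerM hornerC horner_exp.
rewrite derivM derivC mul0r add0r hornerM hornerC deriv_exp hornerMn hornerM
  horner_exp.
rewrite Q0 Q'0 (pair_big_dep predT (fun i j : 'I_N =>
  (i < j)%N) (gap X n)) /= expr1n mulr1.
by rewrite -mulr_natl; ring.
Qed.

Definition trs (s : seq nat) (X : 'M[C]_N) : R := \prod_(m <- s) ptr m X.

(* The derivative of [trs s] along X^n is the sum of [c.1 * trs c.2]: each
   exponent m in turn is replaced by m + n - 1, with coefficient m. *)
Fixpoint shifts (n : nat) (s : seq nat) : seq (nat * seq nat) :=
  if s is m :: s' then
    (m, (m + n).-1 :: s') :: [seq (c.1, m :: c.2) | c <- shifts n s']
  else [::].

Lemma trs_line (X : 'M[C]_N) n s : self_adjoint X -> exists2 q : {poly R},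
    (forall e : R, trs s (X + e%:C%C *: X ^+ n) = q.[e]) &
    (q^`()).[0] = \sum_(c <- shifts n s) c.1%:R * trs c.2 X.
Proof.
move=> sX; elim: s => [|m s [q qE q0]].
  by exists 1 => [e|]; rewrite /trs big_nil ?hornerC // derivC hornerC.
have [r rE r0] := ptr_line n sX m.
exists (r * q) => [e|]; first by rewrite /trs big_cons rE -/(trs _ _) qE hornerM.
have X0 : X = X + (0 : R)%:C%C *: X ^+ n by rewrite scale0r addr0.
rewrite derivM hornerD !hornerM r0 q0 -qE -rE -X0 /= big_cons big_map /=.
rewrite /trs big_cons mulrA; congr (_ + _).
rewrite mulr_sumr; apply: eq_bigr => c _; rewrite big_cons; ring.
Qed.

End log_derivatives.

(** * The loop equation *)

Section poly_expectation.
Context (R : realType) d (T : measurableType d)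
  (mu : {sigma_finite_measure set T -> \bar R}) (I : finType)
  (x : T -> I -> R) (b : I -> R).
Hypothesis G : gauss_space mu x b.

Definition gauss_int (F : (I -> R) -> R) : R :=
  fine (\int[mu]_t (F (x t) * gauss_weight b (x t))%:E)%E.

Definition is_poly (F : (I -> R) -> R) := exists dF, poly_diff F dF.

Lemma gauss_intE F : is_poly F ->
  (\int[mu]_t (F (x t) * gauss_weight b (x t))%:E)%E = (gauss_int F)%:E.
Proof.
by move=> [dF pF]; rewrite /gauss_int fineK // integrable_fin_num //
  (gs_integrable G pF).
Qed.

Lemma is_polyD F H : is_poly F -> is_poly H -> is_poly (fun y => F y + H y).
Proof. by move=> [dF pF] [dH pH]; eexists; exact: poly_diffD pF pH. Qed.

Lemma is_polyM F H : is_poly F -> is_poly H -> is_poly (fun y => F y * H y).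
Proof. by move=> [dF pF] [dH pH]; eexists; exact: poly_diffM pF pH. Qed.

Lemma is_poly_cst c : is_poly (fun=> c).
Proof. by eexists; exact: poly_diff_cst. Qed.

Lemma is_polyX F n : is_poly F -> is_poly (fun y => F y ^+ n).
Proof. by move=> [dF pF]; exact: poly_diffX pF. Qed.

Lemma is_poly_prod J (r : seq J) (F : J -> (I -> R) -> R) :
  (forall j, is_poly (F j)) -> is_poly (fun y => \prod_(j <- r) F j y).
Proof.
move=> pF; have [dF {}pF] := choice pF.
exact: poly_diff_prod pF.
Qed.

Lemma is_poly_sum J (r : seq J) (F : J -> (I -> R) -> R) :
  (forall j, is_poly (F j)) -> is_poly (fun y => \sum_(j <- r) F j y).
Proof.
move=> pF; have [dF {}pF] := choice pF.
by eexists; exact: poly_diff_sum pF.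
Qed.

Lemma gauss_intD F H : is_poly F -> is_poly H ->
  gauss_int (fun y => F y + H y) = gauss_int F + gauss_int H.
Proof.
move=> pF pH; apply: EFin_inj; rewrite EFinD -!gauss_intE //; last exact: is_polyD.
case: pF pH => [dF pF] [dH pH].
rewrite -integralD // ?(gs_integrable G pF) ?(gs_integrable G pH) //.
by apply: eq_integral => t _; rewrite -EFinD mulrDl.
Qed.

Lemma gauss_intZ c F : is_poly F ->
  gauss_int (fun y => c * F y) = c * gauss_int F.
Proof.
move=> pF; apply: EFin_inj; rewrite EFinM -!gauss_intE //.
  case: pF => [dF pF]; rewrite -integralZl // ?(gs_integrable G pF) //.
  by apply: eq_integral => t _; rewrite -EFinM mulrA.
by apply: is_polyM => //; exact: is_poly_cst.
Qed.

Lemma gauss_int_sum J (r : seq J) (F : J -> (I -> R) -> R) :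
  (forall j, is_poly (F j)) ->
  gauss_int (fun y => \sum_(j <- r) F j y) = \sum_(j <- r) gauss_int (F j).
Proof.
move=> pF; elim: r => [|j r IH].
  rewrite big_nil (_ : (fun y => _) = (fun=> 0 * 0)); last first.
    by apply/funext => y; rewrite big_nil mulr0.
  by rewrite gauss_intZ ?mul0r //; exact: is_poly_cst.
rewrite big_cons -IH -gauss_intD //; last exact: is_poly_sum.
by congr gauss_int; apply/funext => y; rewrite big_cons.
Qed.

End poly_expectation.
Arguments is_poly {R I} F.

Section loop_equation.
Context (R : realType) (N k : nat) (B : R).
Local Notation C := R[i].
Local Notation J := ('I_N * 'I_N)%type.
Local Notation L := ('I_N * (unit + unit))%type.
Local Notation K := (J + L)%type.

Definition mx_crd (z : K -> R) : 'M[C]_N := herm_mx (fun p => z (inl p)).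
(** The minus sign is the conjugation: the coordinates are those of lambda, while the wave function
    takes its conjugate. *)
Definition vec_crd (z : K -> R) : 'rV[C]_N :=
  \row_i (z (inr (i, inl tt)) -i* z (inr (i, inr tt)))%C.
(** |D|^(2k), squared before the power k is taken because |D|^2, unlike |D|, is polynomial in the
    real coordinates. *)
Definition Phi (z : K -> R) : R := normc (ldet (vec_crd z) (mx_crd z)) ^+ 2 ^+ k.

Lemma mxpoly_diff_crd : mxpoly_diff mx_crd (fun _ v => mx_crd v).
Proof.
move=> i j; have [p1 p2] := mxpoly_diff_herm R i j.
split.
  apply: (@poly_diff_comp _ J K (fun y => Re (herm_mx y i j)) (fun x v =>
    Re (herm_mx v i j))
    (fun z p => z (inl p)) (fun _ v p => v (inl p)) p1) => p.
  exact: poly_diff_crd.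
apply: (@poly_diff_comp _ J K (fun y => Im (herm_mx y i j)) (fun x v =>
  Im (herm_mx v i j))
  (fun z p => z (inl p)) (fun _ v p => v (inl p)) p2) => p.
exact: poly_diff_crd.
Qed.

Lemma mxpoly_diff_vec : exists dl, mxpoly_diff vec_crd dl.
Proof.
exists (fun _ v => vec_crd v) => i j; split.
  apply: (eq_poly_diff (poly_diff_crd R (inr (j, inl tt)))) => [z|z v];
    by rewrite mxE.
apply: (eq_poly_diff (poly_diffN (poly_diff_crd R (inr (j, inr tt))))) =>
  [z|z v]; by rewrite mxE.
Qed.

Lemma is_poly_ptr m : is_poly (fun z : K -> R => ptr m (mx_crd z)).
Proof.
have pX := mxpoly_diffX m mxpoly_diff_crd.
have [p _] := cpoly_diff_sum (index_enum 'I_N) predT (fun i => pX i i).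
by eexists; exact: p.
Qed.

Lemma is_poly_Phi : is_poly Phi.
Proof.
have [dl pl] := mxpoly_diff_vec.
have pm m j : cpoly_diff (fun z => (vec_crd z *m mx_crd z ^+ m) 0 j) _ :=
  mxpoly_diffM pl (mxpoly_diffX m mxpoly_diff_crd) 0 j.
have pprod (s : 'S_N) : exists d, cpoly_diff (fun z =>
    (-1) ^+ s * \prod_(m < N) (vec_crd z *m mx_crd z ^+ m) 0 (s m)) d.
  have [d pd] := cpoly_diff_prod (index_enum 'I_N) (fun m : 'I_N => pm m (s m)).
  by eexists; exact: cpoly_diffM (cpoly_diff_cst _ ((-1) ^+ s)) pd.
have [d {}pprod] := choice pprod.
have [p1 p2] := cpoly_diff_sum (index_enum 'S_N) predT pprod.
apply: is_polyX.
have : is_poly (fun z =>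
  Re (ldet (vec_crd z) (mx_crd z)) ^+ 2 + Im (ldet (vec_crd z) (mx_crd z)) ^+ 2).
  by apply: is_polyD; apply: is_polyX; eexists; [exact: p1|exact: p2].
by congr is_poly; apply/funext => z; rewrite normc_sqr.
Qed.

Definition trsPhi s (z : K -> R) : R := trs s (mx_crd z) * Phi z.

Lemma is_poly_trs s : is_poly (fun z : K -> R => trs s (mx_crd z)).
Proof. by apply: is_poly_prod => m; exact: is_poly_ptr. Qed.

Lemma is_poly_trsPhi s : is_poly (trsPhi s).
Proof. by apply: is_polyM; [exact: is_poly_trs|exact: is_poly_Phi]. Qed.

(* The infinitesimal change of variables X -> X + e X^n. *)
Definition pow_dir n (z : K -> R) : K -> R :=
  sum_fun (herm_crd (mx_crd z ^+ n)) (fun=> 0).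

Lemma mx_crd_line n z e :
  mx_crd (fun i => z i + e * pow_dir n z i) = mx_crd z + e%:C%C *: mx_crd z ^+ n.
Proof.
rewrite /mx_crd herm_mx_line; congr (_ + _ *: _); rewrite herm_crdK //.
exact/self_adjointX/herm_mx_sa.
Qed.

Lemma vec_crd_line n z e :
  vec_crd (fun i => z i + e * pow_dir n z i) = vec_crd z.
Proof. by apply/rowP => i; rewrite !mxE /= !mulr0 !addr0. Qed.

Lemma trsPhi_pow_dir s dF n z : poly_diff (trsPhi s) dF ->
  dF z (pow_dir n z)
  = \sum_(c <- shifts n s) c.1%:R * trsPhi c.2 z
    + k%:R * (\sum_(a < n) ptr a (mx_crd z) * ptr (n.-1 - a) (mx_crd z)
              - n%:R * ptr n.-1 (mx_crd z)) * trsPhi s z.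
Proof.
move=> pF; have sX := herm_mx_sa (fun p => z (inl p)); rewrite -/(mx_crd z) in sX.
have [q qE q0] := trs_line n s sX.
have [r rE r0] := ldet_normc_line n (vec_crd z) sX.
have X0 : mx_crd z = mx_crd z + (0 : R)%:C%C *: mx_crd z ^+ n by rewrite scale0r
  addr0.
rewrite (poly_diff_line_deriv (q := q * r ^+ k) pF) => [|e]; last first.
  by rewrite /trsPhi /Phi mx_crd_line vec_crd_line qE rE hornerM horner_exp.
rewrite derivM deriv_exp hornerD !hornerM hornerMn hornerM !horner_exp q0 r0.
rewrite -qE -rE -X0 /trsPhi; congr (_ + _).
  by rewrite mulr_suml; apply: eq_bigr => c _; rewrite /Phi mulrA.
(* The power k - 1 left by the derivative has to be recombined with one factor |D|^2; at k = 0 both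
   sides vanish. *)
rewrite /Phi; case: (k) => [|m]; first by rewrite mulr0n !mul0r mulr0.
rewrite -mulr_natl /=; set a := normc _ ^+ 2; rewrite (exprS a m); ring.
Qed.

End loop_equation.

Section loop_equation_expectation.
Context (R : realType) (N k : nat) (B : R).
Local Notation C := R[i].
Local Notation J := ('I_N * 'I_N)%type.
Local Notation L := ('I_N * (unit + unit))%type.
Local Notation K := (J + L)%type.

Definition model_wt : K -> R := sum_fun (herm_wt B) (fun=> 1).

Lemma poly_diff_herm_crd_pow n p :
  poly_diff (fun z : K -> R => herm_crd (mx_crd z ^+ n) p)
            (fun z v => herm_crd (dpow n (mx_crd z) (mx_crd v)) p).
Proof.
have pX := mxpoly_diffX n (@mxpoly_diff_crd R N).
rewrite /herm_crd; case: (p.1 < p.2)%N; first exact: (pX p.1 p.2).1.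
by case: (p.2 < p.1)%N; [exact: (pX p.2 p.1).2|exact: (pX p.1 p.1).1].
Qed.

Context d (T : measurableType d) (mu : {sigma_finite_measure set T -> \bar R})
  (x : T -> K -> R) (G : gauss_space mu x model_wt).
Local Notation E := (gauss_int mu x model_wt).

(** Sum over the matrix coordinates p of the integration by parts for V_p F, where V = X^n. The
    three terms are the divergence of V times F, the derivative of F along V, and the drift. *)
Lemma gauss_int_pow_dir n F dF : poly_diff F dF ->
  E (fun z => (\sum_(a < n) ptr a (mx_crd z) * ptr (n.-1 - a) (mx_crd z)) * F z
     + dF z (pow_dir n z) - 2 * B * ptr n.+1 (mx_crd z) * F z) = 0.
Proof.
move=> pF.
pose V p (z : K -> R) := herm_crd (mx_crd z ^+ n) p.
pose dV p (z v : K -> R) := herm_crd (dpow n (mx_crd z) (mx_crd v)) p.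
pose H p (z : K -> R) := dV p z (unit_dir R (inl p)) * F z + V p z * dF z
  (unit_dir R (inl p))
   - 2 * model_wt (inl p) * z (inl p) * (V p z * F z).
have pV p : poly_diff (V p) (dV p) := poly_diff_herm_crd_pow n p.
transitivity (E (fun z => \sum_p H p z)).
  congr gauss_int; apply/funext => z; rewrite /H big_split big_split /=.
  congr (_ + _ + _).
  - rewrite -mulr_suml -divergence_pow; last exact: herm_mx_sa.
    congr (_ * _); apply: eq_bigr => p _; congr herm_crd.
  - rewrite (poly_diff_linear _ _ pF) big_sumType /= [X in _ + X]big1 ?addr0 //
    => q _.
    by rewrite mul0r.
  - rewrite sumrN; congr (- _).
    have VE : \sum_p herm_wt B p * z (inl p) * V p z = B * ptr n.+1 (mx_crd z).
      rewrite /V (herm_wtE B (fun p => z (inl p)));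
        last exact/self_adjointX/herm_mx_sa.
      by rewrite /ptr exprS.
    transitivity (2 * (\sum_p herm_wt B p * z (inl p) * V p z) * F z).
      by rewrite VE; ring.
    by rewrite mulr_sumr mulr_suml; apply: eq_bigr => p _; rewrite /model_wt /=;
      ring.
rewrite gauss_int_sum //; last first.
  move=> p; have [d1 pd1] := poly_diff_dir (unit_dir R (inl p)) (poly_diffM (pV
    p) pF).
  apply: is_polyD; first by eexists; exact: pd1.
  by eexists; exact: (poly_diffN (poly_diffM (poly_diffM (poly_diff_cst K (2 *
    model_wt (inl p))) (poly_diff_crd R (inl p))) (poly_diffM (pV p) pF))).
rewrite big1 // => p _; rewrite /gauss_int.
by rewrite (gs_ibp G (inl p) (poly_diffM (pV p) pF)).
Qed.

Local Notation e s := (E (@trsPhi R N k s)).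

(** Here F already contains |D|^(2k): its derivative adds k copies of the quadratic term to the one
    from the divergence. *)
Lemma loop_equation n s :
  2 * B * e (n.+1 :: s)
  = k.+1%:R * \sum_(a < n) e (val a :: (n.-1 - a)%N :: s)
    - (k * n)%:R * e (n.-1 :: s)
    + \sum_(c <- shifts n s) c.1%:R * e c.2.
Proof.
have [dF pF] := @is_poly_trsPhi R N k s.
have := gauss_int_pow_dir n pF.
have pS r : is_poly (trsPhi k r) := @is_poly_trsPhi R N k r.
have pZ (c : R) r : is_poly (fun z : K -> R => c * trsPhi k r z).
  by apply: is_polyM (pS r); exact: is_poly_cst.
pose F1 (z : K -> R) := k.+1%:R * \sum_(a < n) trsPhi k (val a :: (n.-1 - a)%N ::
  s) z.
pose F2 (z : K -> R) := - (k * n)%:R * trsPhi k (n.-1 :: s) z.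
pose F3 (z : K -> R) := \sum_(c <- shifts n s) c.1%:R * trsPhi k c.2 z.
pose F4 (z : K -> R) := - (2 * B) * trsPhi k (n.+1 :: s) z.
have p1 : is_poly F1.
  by apply: is_polyM; [exact: is_poly_cst|apply: is_poly_sum => a; exact: pS].
have p3 : is_poly F3 by apply: is_poly_sum => c; exact: pZ.
have -> : (fun z => (\sum_(a < n) ptr a (mx_crd z) * ptr (n.-1 - a) (mx_crd z)) *
  trsPhi k s z
     + dF z (pow_dir n z) - 2 * B * ptr n.+1 (mx_crd z) * trsPhi k s z)
   = (fun z => F1 z + F2 z + F3 z + F4 z).
  apply/funext => z; rewrite (trsPhi_pow_dir n z pF) /F1 /F2 /F3 /F4.
  have tc m r : trsPhi k (m :: r) z = ptr m (mx_crd z) * trsPhi k r z.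
    by rewrite /trsPhi /trs big_cons mulrA.
  have -> : \sum_(a < n) trsPhi k (val a :: (n.-1 - a)%N :: s) z
     = (\sum_(a < n) ptr a (mx_crd z) * ptr (n.-1 - a) (mx_crd z)) * trsPhi k s z.
    by rewrite mulr_suml; apply: eq_bigr => a _; rewrite !tc mulrA.
  by rewrite !tc natrM -natr1; ring.
rewrite (gauss_intD G) //; last 2 first.
- by apply: is_polyD => //; apply: is_polyD => //; exact: pZ.
- exact: pZ.
rewrite (gauss_intD G) //; last by apply: is_polyD => //; exact: pZ.
rewrite (gauss_intD G) //; last exact: pZ.
have -> : E F1 = k.+1%:R * \sum_(a < n) e (val a :: (n.-1 - a)%N :: s).
  rewrite (gauss_intZ G); first by rewrite (gauss_int_sum G).
  by apply: is_poly_sum => a; exact: pS.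
have -> : E F2 = - (k * n)%:R * e (n.-1 :: s) by rewrite (gauss_intZ G).
have -> : E F3 = \sum_(c <- shifts n s) c.1%:R * e c.2.
  by rewrite (gauss_int_sum G) //; apply: eq_bigr => c _; rewrite (gauss_intZ G).
have -> : E F4 = - (2 * B) * e (n.+1 :: s) by rewrite (gauss_intZ G).
lra.
Qed.

End loop_equation_expectation.

(** * Limit of the mixed moments *)

Lemma shifts_size n s c : c \in shifts n s -> size c.2 = size s.
Proof.
elim: s c => [|m s IH] c //=; rewrite inE => /orP[/eqP -> //|/mapP[c' /IH h ->]].
by rewrite /= h.
Qed.

(** Degree count for the rescaling and for the induction: a term with nonzero coefficient has total
    exponent n - 1 above that of [s]. The first alternative is the entry 0, whose shift would be
    truncated. *)
Lemma shifts_sumn n s c : c \in shifts n s ->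
  c.1 = 0%N \/ (sumn c.2).+1 = (sumn s + n)%N.
Proof.
elim: s c => [|m s IH] c //=; rewrite inE => /orP[/eqP ->|/mapP[c' /IH [h|h] ->]] /=.
- by case: m => [|m]; [left|right => /=; lia].
- by left.
- by right; rewrite -addnS h addnA.
Qed.

Section moment_limit.
Context (R : realType) (k : nat) (B : R) (B0 : 0 < B).
Variables (e : nat -> seq nat -> R) (c : nat -> R).
Hypothesis e_gt0 : forall N, (0 < N)%N -> 0 < e N [::].
Hypothesis e_cons0 : forall N s, (0 < N)%N -> e N (0%N :: s) = N%:R * e N s.
Hypothesis e_loop : forall N n s, (0 < N)%N ->
  2 * B * e N (n.+1 :: s)
  = k.+1%:R * \sum_(a < n) e N (val a :: (n.-1 - a)%N :: s)
    - (k * n)%:R * e N (n.-1 :: s)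
    + \sum_(d <- shifts n s) d.1%:R * e N d.2.
Hypothesis c0 : c 0 = 1.
Hypothesis cS : forall n, c n.+1 = \sum_(a < n) c a * c (n.-1 - a)%N.

(** The expectation of a product of normalised traces: each eigenvalue is rescaled, each trace is
    divided by N, and the total mass is divided out. *)
Definition scaled_moment (N : nat) (s : seq nat) : R :=
  rescaling k B N ^+ sumn s / N%:R ^+ size s * (e N s / e N [::]).
Local Notation u := scaled_moment.

Lemma rescaling_sqr N : (0 < N)%N -> rescaling k B N ^+ 2 = 2 * B / (k.+1%:R * N%:R).
Proof.
by move=> N0; rewrite /rescaling sqr_sqrtr // divr_ge0 ?mulr_ge0 // ltW.
Qed.

Lemma rescaling_gt0 N : (0 < N)%N -> 0 < rescaling k B N.
Proof.
by move=> N0; rewrite /rescaling sqrtr_gt0 divr_gt0 ?mulr_gt0 // ltr0n.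
Qed.

Lemma scaled_moment_cons0 N s : (0 < N)%N -> u N (0%N :: s) = u N s.
Proof.
move=> N0; rewrite /u e_cons0 //= add0n exprS; field.
by rewrite (gt_eqF (e_gt0 N0)) expf_neq0 ?pnatr_eq0 -?lt0n.
Qed.

(** The squared rescaling gives 1 / N and each trace carries another 1 / N. Relative to the left
    side the quadratic terms have one trace more, the k n correction as many, the shifts one fewer;
    hence orders 1, 1 / N and 1 / N^2. *)
Lemma scaled_moment_loop N n s : (0 < N)%N ->
  u N (n.+1 :: s)
  = \sum_(a < n) u N (val a :: (n.-1 - a)%N :: s)
    - (k * n)%:R / k.+1%:R * N%:R^-1 * u N (n.-1 :: s)
    + k.+1%:R^-1 * N%:R^-1 ^+ 2 * \sum_(d <- shifts n s) d.1%:R * u N d.2.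
Proof.
move=> N0; set r := rescaling k B N.
have NN : N%:R != 0 :> R by rewrite pnatr_eq0 -lt0n.
have : k.+1%:R != 0 :> R by rewrite pnatr_eq0.
have := rescaling_sqr N0; have := e_loop n s N0; rewrite -/r.
move: (k.+1%:R : R) => K loop r2' kk.
have rN : r != 0 by rewrite gt_eqF // rescaling_gt0.
have BN : B != 0 by rewrite gt_eqF.
have r2 : r ^+ 2 * K * N%:R = 2 * B by rewrite r2' -mulrA divfK // mulf_neq0.
pose z := e N [::]; have zN : z != 0 by rewrite gt_eqF // e_gt0.
pose w (m : nat) := r ^+ (n + sumn s).+1 / N%:R ^+ (size s).+1 / z.
have E1 : u N (n.+1 :: s) = w 0 / (2 * B) * (2 * B * e N (n.+1 :: s)).
  by rewrite /u /w /= -/r -/z; field; rewrite ?zN ?BN ?expf_neq0.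
rewrite E1 loop mulrDr mulrBr; congr (_ - _ + _).
- rewrite mulrA mulr_sumr; apply: eq_bigr => a _; rewrite /u /w /= -/r -/z.
  have -> : (a + ((n.-1 - a) + sumn s) = (n.-1 + sumn s))%N.
    rewrite addnA subnKC //; have := ltn_ord a.
    by case: (n) a => [[]//|m] a /=.
  have -> : (n + sumn s).+1 = (n.-1 + sumn s).+2.
    by have := ltn_ord a; case: (n) a => [[]//|m] a /=; rewrite addSn.
  rewrite -r2 !exprS; field.
  by rewrite ?zN ?NN ?kk ?rN ?expf_neq0.
- have [->|n0] := posnP n; first by rewrite muln0 !mul0r mulr0.
  rewrite /u /w /= -/r -/z.
  have -> : (n + sumn s).+1 = (n.-1 + sumn s).+2 by lia.
  rewrite -r2 !exprS; field.
  by rewrite ?zN ?NN ?kk ?rN ?expf_neq0.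
- rewrite !mulr_sumr [in LHS]big_seq [in RHS]big_seq; apply: eq_bigr => d ds.
  have sd := shifts_size ds; have [->|md] := shifts_sumn ds.
    by rewrite !mul0r !mulr0.
  rewrite /u /w /= -/r -/z sd addnC -md -r2 !exprS; field.
  by rewrite ?zN ?NN ?kk ?rN ?expf_neq0.
Qed.

Lemma cvg_sum_seq (I : eqType) (r : seq I) (f : I -> nat -> R) (l : I -> R) :
  (forall i, i \in r -> f i N @[N --> \oo] --> l i) ->
  \sum_(i <- r) f i N @[N --> \oo] --> \sum_(i <- r) l i.
Proof.
elim: r => [_|i r IH fl].
  rewrite big_nil; under eq_fun do rewrite big_nil; exact: cvg_cst.
rewrite big_cons; under eq_fun do rewrite big_cons.
apply: cvgD; first by apply: fl; rewrite mem_head.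
by apply: IH => j jr; apply: fl; rewrite inE jr orbT.
Qed.

Lemma cvg_invn : N%:R^-1 @[N --> \oo] --> (0 : R).
Proof. by rewrite -cvg_shiftS; exact: cvg_harmonic. Qed.

Lemma cvg_invn2 : N%:R^-1 ^+ 2 @[N --> \oo] --> (0 : R).
Proof.
have h : (fun N : nat => N%:R^-1 ^+ 2 : R) = (fun N => N%:R^-1 * N%:R^-1).
  by apply/funext => N; rewrite expr2.
by rewrite h -[X in _ --> X](mulr0 (0 : R)); apply: cvgM; exact: cvg_invn.
Qed.

(** Induction on total exponent plus number of factors. Splitting p_(n+1) into p_a p_b lowers the
    exponent by 2 and adds one factor, and removing an entry 0 loses a factor, so the measure always
    drops. Working with all products at once gives the factorisation of the limit. *)
Lemma scaled_moment_cvg s : u N s @[N --> \oo] --> \prod_(m <- s) c m.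
Proof.
have [M] := ubnP (sumn s + size s); elim: M s => // M IH [|[|n] s] /=.
- move=> _; rewrite big_nil; apply: cvg_near_cst.
  near=> N; rewrite /u /= !expr0 divr1 mul1r divff // gt_eqF // e_gt0 //.
  by near: N; exact: nbhs_infty_gt.
- rewrite add0n addnS ltnS => sM; rewrite big_cons c0 mul1r.
  apply: cvg_trans (IH s _); last by lia.
  apply: near_eq_cvg; near=> N; rewrite scaled_moment_cons0 //.
  by near: N; exact: nbhs_infty_gt.
- move=> sM.
  have L1 : \sum_(a < n) u N (val a :: (n.-1 - a)%N :: s) @[N --> \oo] -->
      \sum_(a < n) (c a * c (n.-1 - a)%N * \prod_(m <- s) c m).
    apply: (@cvg_sum_seq _ _ (fun (a : 'I_n) N => u N (val a :: (n.-1 - a)%N :: s))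
      (fun a => c a * c (n.-1 - a)%N * \prod_(m <- s) c m)) => a _.
    have := IH [:: val a, (n.-1 - a)%N & s]; rewrite !big_cons mulrA; apply => /=.
    by have := ltn_ord a; lia.
  have L2 : (k * n)%:R / k.+1%:R * N%:R^-1 * u N (n.-1 :: s) @[N --> \oo] --> (0
    : R).
    have [->|n0] := posnP n.
      rewrite muln0; under eq_fun do rewrite !mul0r; exact: cvg_cst.
    rewrite -[X in _ --> X](mul0r (\prod_(m <- n.-1 :: s) c m)); apply: cvgM.
      rewrite -[X in _ --> X](mulr0 ((k * n)%:R / k.+1%:R)).
      by apply: cvgMr; exact: cvg_invn.
    by apply: IH => /=; lia.
  (* Any finite limit suffices, as this sum is multiplied by a quantity tending to 0. *)
  have L3 : exists L, \sum_(d <- shifts n s) d.1%:R * u N d.2 @[N --> \oo] --> (L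
    : R).
    exists (\sum_(d <- shifts n s) d.1%:R * \prod_(m <- d.2) c m).
    apply: (@cvg_sum_seq _ _ (fun d N => d.1%:R * u N d.2)
      (fun d => d.1%:R * \prod_(m <- d.2) c m)) => d ds.
    have [->|md] := shifts_sumn ds.
      rewrite mul0r; under eq_fun do rewrite mul0r; exact: cvg_cst.
    apply: cvgMr; apply: IH; rewrite (shifts_size ds); lia.
  have [L {}L3] := L3.
  have L4 : k.+1%:R^-1 * N%:R^-1 ^+ 2 * \sum_(d <- shifts n s) d.1%:R * u N d.2
    @[N --> \oo] --> (0 : R).
    rewrite -[X in _ --> X](mul0r L); apply: cvgM => //.
    rewrite -[X in _ --> X](mulr0 (k.+1%:R^-1)); apply: cvgMr.
    exact: cvg_invn2.
  rewrite big_cons cS mulr_suml.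
  rewrite -[X in _ --> X]subr0 -[X in _ --> X]addr0.
  apply: cvg_trans (cvgD (cvgB L1 L2) L4); apply: near_eq_cvg.
  near=> N; rewrite [RHS]scaled_moment_loop //.
  by near: N; exact: nbhs_infty_gt.
Unshelve. all: by end_near. Qed.

End moment_limit.

(** * Moments of the semicircle law *)

Section semicircle_moments.
Context (R : realType).
Local Notation mu := (@lebesgue_measure R).
Implicit Types (f : R -> R) (x : R).

Definition scw x : R := Num.sqrt (4 - x ^+ 2).

Lemma continuous_scw : continuous scw.
Proof.
move=> x; apply: (cvg_comp (fun y : R => 4 - y ^+ 2) Num.sqrt);
  last exact: sqrt_continuous.
by apply: cvgB; [exact: cvg_cst|exact: exprn_continuous].
Qed.

Lemma is_derive_scw x : -2 < x < 2 -> is_derive x 1 scw (- (x / scw x)).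
Proof.
move=> /andP[x1 x2].
have q0 : 0 < 4 - x ^+ 2.
  by rewrite (_ : _ - _ = (2 - x) * (2 + x)); [apply: mulr_gt0; lra|ring].
have d1 : is_derive x 1 (fun y : R => 4 - y ^+ 2) (- (2 * x)).
  by apply: is_derive_eq; rewrite /GRing.scale /=; ring.
have d2 := is_derive1_sqrt q0.
have d3 := @is_derive1_comp R Num.sqrt (fun y => 4 - y ^+ 2) x _ _ d2 d1.
rewrite (_ : scw = Num.sqrt \o (fun y => 4 - y ^+ 2)) //.
apply: (is_derive_eq d3).
by rewrite /GRing.scale /= /scw; field; rewrite gt_eqF // sqrtr_gt0.
Qed.

Lemma integral_scw f : continuous f ->
  (\int[mu]_x (f x * semicircle 2 x)%:E
   = \int[mu]_(x in `[(-2)%R, 2%R]) ((2 * pi)^-1 * (f x * scw x))%:E)%E.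
Proof.
move=> cf; rewrite [RHS]integral_mkcond; apply: eq_integral => x _.
rewrite patchE /semicircle indicE /scw.
rewrite (_ : 2 ^+ 2 = 4 :> R); last by rewrite -natrX.
have p0 := @pi_gt0 R.
case: ifPn => xi; last by rewrite !mulr0.
by rewrite mulr1; move: (@pi R) p0 => q p0; congr _%:E; field; rewrite gt_eqF.
Qed.

Let integrable_scw f : continuous f ->
  mu.-integrable `[(-2)%R, 2%R] (fun x => (f x * scw x)%:E).
Proof.
move=> cf; apply: (@continuous_compact_integrable _ (fun x => f x * scw x)).
  exact: segment_compact.
apply: continuous_subspaceT => x; apply: cvgM; [exact: cf|exact: continuous_scw].
Qed.

Lemma integrable_semicircle f : continuous f ->
  mu.-integrable setT (fun x => (f x * semicircle 2 x)%:E).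
Proof.
move=> cf.
have h : mu.-integrable `[(-2)%R, 2%R] (fun x =>
  (((2 * pi)^-1)%:E * (f x * scw x)%:E)%E).
  by apply: integrableZl => //; exact: integrable_scw.
move: h => /integrable_mkcond -/(_ (measurable_itv _)).
apply: eq_integrable => // x _.
rewrite patchE /semicircle indicE /scw.
rewrite (_ : 2 ^+ 2 = 4 :> R); last by rewrite -natrX.
have p0 := @pi_gt0 R.
case: ifPn => xi; last by rewrite !mulr0.
by rewrite mulr1 -EFinM; move: (@pi R) p0 => q p0; congr _%:E; field; rewrite gt_eqF.
Qed.

(** The derivative is asked for on the open interval only: [scw] has vertical tangents at both ends
    but is continuous there. *)
Lemma FTC_scw (F f : R -> R) : continuous F -> continuous f ->
  (forall x, -2 < x < 2 -> is_derive x 1 F (f x)) ->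
  (\int[mu]_(x in `[(-2)%R, 2%R]) (f x)%:E = (F 2 - F (-2))%:E)%E.
Proof.
move=> cF cf dF; rewrite (@continuous_FTC2 _ f F) //.
- by lra.
- exact: continuous_subspaceT.
- split => [x|//|].
  + by rewrite in_itv /= => xi; have [] := dF x xi.
  + by apply: cvg_at_right_filter; exact: cF.
  + by apply: cvg_at_left_filter; exact: cF.
- by move=> x; rewrite in_itv /= => xi; rewrite derive1E; have [_] := dF x xi.
Qed.

Definition sc_moment n : R := fine (\int[mu]_x (x ^+ n * semicircle 2 x)%:E)%E.

Definition scw_int f : R := fine (\int[mu]_(x in `[(-2)%R, 2%R]) (f x * scw x)%:E)%E.

Lemma sc_momentE n : sc_moment n = (2 * pi)^-1 * scw_int (fun x => x ^+ n).
Proof.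
rewrite /sc_moment integral_scw; last exact: exprn_continuous.
have := integrable_scw (@exprn_continuous R n) => h.
under eq_integral do rewrite EFinM.
rewrite integralZl // /scw_int fineM //; exact: integrable_fin_num.
Qed.

(** Integrate the derivative of x^n (4 - x^2)^(3/2), which vanishes at both ends: it equals (4 n
    x^(n-1) - (n + 3) x^(n+1)) sqrt(4 - x^2). *)
Lemma scw_recurrence n :
  (n + 3)%:R * scw_int (fun x => x ^+ n.+1) = (4 * n)%:R * scw_int (fun x =>
    x ^+ n.-1).
Proof.
have cx := @exprn_continuous R.
pose F x := x ^+ n * ((4 - x ^+ 2) * scw x).
pose f x := ((4 * n)%:R * x ^+ n.-1 - (n + 3)%:R * x ^+ n.+1) * scw x.
have cF : continuous F.
  move=> x; apply: cvgM; first exact: cx; apply: cvgM; last exact: continuous_scw.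
  by apply: cvgB; [exact: cvg_cst|exact: cx].
have cf : continuous f.
  move=> x; apply: cvgM; last exact: continuous_scw.
  by apply: cvgB; apply: cvgM; (exact: cvg_cst || exact: cx).
have dF x : -2 < x < 2 -> is_derive x 1 F (f x).
  move=> xi; have dw := is_derive_scw xi.
  have q0 : 0 < 4 - x ^+ 2.
    move/andP: xi => [x1 x2].
    by rewrite (_ : _ - _ = (2 - x) * (2 + x)); [apply: mulr_gt0; lra|ring].
  have w0 : scw x != 0 by rewrite gt_eqF // sqrtr_gt0.
  have w2 : scw x ^+ 2 = 4 - x ^+ 2 by rewrite sqr_sqrtr // ltW.
  have dq : is_derive x 1 (fun y : R => 4 - y ^+ 2) (- (2 * x)).
    by apply: is_derive_eq; rewrite /GRing.scale /=; ring.
  have dX : is_derive x 1 (fun y : R => y ^+ n) (n%:R * x ^+ n.-1).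
    apply: DeriveDef; first exact: exprn_derivable.
    by rewrite exp_derive /GRing.scale /= mulr1.
  apply: (is_derive_eq (is_deriveM dX (is_deriveM dq dw))).
  (* With 4 eliminated, the claim is a rational identity in x and w = [scw x]. *)
  have x4 : 4 = scw x ^+ 2 + x ^+ 2 by rewrite w2; ring.
  rewrite /GRing.scale /= /f natrD natrM.
  rewrite (_ : ((fun y : R => 4 - y ^+ 2) * scw) x = (4 - x ^+ 2) * scw x) // !x4.
  move: w0; move: (scw x) => w w0.
  by case: (n) => [|m] /=; rewrite ?exprS; field.
have F0 : F 2 - F (-2) = 0.
  by rewrite /F sqrrN (_ : 2 ^+ 2 = 4 :> R) ?subrr ?mul0r ?mulr0 ?subrr // -natrX.
have i1 := integrable_scw (cx n.-1); have i2 := integrable_scw (cx n.+1).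
have f1 : (\int[mu]_(x in `[(-2)%R, 2%R]) (x ^+ n.-1 * scw x)%:E)%E \is a fin_num.
  exact: integrable_fin_num.
have f2 : (\int[mu]_(x in `[(-2)%R, 2%R]) (x ^+ n.+1 * scw x)%:E)%E \is a fin_num.
  exact: integrable_fin_num.
have : (\int[mu]_(x in `[(-2)%R, 2%R]) (f x)%:E = (4 * n)%:R%:E * (\int[mu]_(x in
  `[(-2)%R, 2%R]) (x ^+ n.-1 * scw x)%:E)
    - (n + 3)%:R%:E * (\int[mu]_(x in `[(-2)%R, 2%R]) (x ^+ n.+1 * scw x)%:E))%E.
  rewrite -!integralZl // -integralB //; last 2 first.
  - exact: integrableZl.
  - exact: integrableZl.
  by apply: eq_integral => x _; rewrite -!EFinM -EFinB /f; congr _%:E; ring.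
rewrite (FTC_scw cF cf dF) F0 /scw_int.
move=> /(congr1 fine); rewrite fineB ?fin_numM // !fineM //= => h.
lra.
Qed.

(** The substitution x = 2 sin t turns the integrand into 4 cos^2 t, with primitive 2 t + 2 sin t
    cos t. *)
Lemma scw_mass : scw_int (fun=> 1) = 2 * pi.
Proof.
have p0 := @pi_gt0 R.
pose F (t : R) := 2 * sin t; pose a : R := - (pi / 2); pose b : R := pi / 2.
have dF (t : R) : is_derive t 1 F (2 * cos t).
  by apply: is_derive_eq; rewrite /GRing.scale /=; ring.
have F'E : (F^`())%classic = fun t => 2 * cos t.
  by apply/funext => t; rewrite derive1E; have [_] := dF t.
have cc : continuous (fun t : R => 2 * cos t).
  by move=> t; apply: cvgM; [exact: cvg_cst|exact: continuous_cos].
have cF : continuous F.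
  by move=> t; apply: cvgM; [exact: cvg_cst|exact: continuous_sin].
have Fa : F a = -2 by rewrite /F /a sinN sin_pihalf; ring.
have Fb : F b = 2 by rewrite /F /b sin_pihalf; ring.
have ab : a < b by rewrite /a /b; lra.
rewrite /scw_int.
have -> : (\int[mu]_(x in `[(-2)%R, 2%R]) (1 * scw x)%:E = \int[mu]_(x in `[F a,
  F b]) (scw x)%:E)%E.
  by rewrite Fa Fb; apply: eq_integral => x _; rewrite mul1r.
rewrite integration_by_substitution_increasing //; first last.
- by apply: continuous_subspaceT; exact: continuous_scw.
- split => [t _| |]; first by have [] := dF t.
  + by apply: cvg_at_right_filter; exact: cF.
  + by apply: cvg_at_left_filter; exact: cF.
- by rewrite F'E; apply/cvg_ex; eexists; apply: cvg_at_left_filter; exact: cc.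
- by rewrite F'E; apply/cvg_ex; eexists; apply: cvg_at_right_filter; exact: cc.
- by rewrite F'E => t _; exact: cc.
- by move=> s t si ti st; rewrite /F ltr_pM2l // ltr_sin.
- exact: ltW.
pose H (t : R) := 2 * t + 2 * (sin t * cos t).
have dH (t : R) : is_derive t 1 H (4 * cos t ^+ 2).
  apply: is_derive_eq; rewrite /GRing.scale /=.
  by have := cos2Dsin2 t; nra.
have cH : continuous H.
  by move=> t; apply/differentiable_continuous/derivable1_diffP; have [] := dH t.
have cg : continuous (fun t : R => 4 * cos t ^+ 2).
  move=> t; apply: cvgM; first exact: cvg_cst.
  by rewrite expr2; apply: cvgM; exact: continuous_cos.
transitivity (fine (\int[mu]_(t in `[a, b]) (4 * cos t ^+ 2)%:E)%E).
  congr fine; apply: eq_integral => t; rewrite inE /= in_itv /= => /andP[ta tb].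
  have ct : 0 <= cos t by apply: cos_ge0_pihalf; rewrite ta tb.
  rewrite (_ : (_ * _) t = scw (F t) * (2 * cos t)); last by rewrite F'E.
  rewrite /scw /F (_ : 4 - _ = (2 * cos t) ^+ 2).
    by rewrite sqrtr_sqr ger0_norm ?mulr_ge0 //; congr _%:E; ring.
  by rewrite !exprMn; have := cos2Dsin2 t; lra.
rewrite (@continuous_FTC2 _ _ H) //=.
- by rewrite /H /a /b cosN cos_pihalf; lra.
- exact: continuous_subspaceT.
- split => [t _| |]; first by have [] := dH t.
  + by apply: cvg_at_right_filter; exact: cH.
  + by apply: cvg_at_left_filter; exact: cH.
- by move=> t _; rewrite derive1E; have [_] := dH t.
Qed.

Lemma sc_moment0 : sc_moment 0 = 1.
Proof.
rewrite sc_momentE (_ : (fun x => _) = (fun=> 1)) // scw_mass mulVf //.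
by rewrite gt_eqF // mulr_gt0 // pi_gt0.
Qed.

Lemma sc_moment1 : sc_moment 1 = 0.
Proof.
rewrite sc_momentE; have := scw_recurrence 0; rewrite muln0 mul0r => /eqP.
by rewrite mulf_eq0 pnatr_eq0 /= => /eqP ->; rewrite mulr0.
Qed.

Lemma sc_moment_rec n : (n + 4)%:R * sc_moment n.+2 = (4 * n.+1)%:R * sc_moment n.
Proof. by rewrite !sc_momentE mulrCA [RHS]mulrCA -(scw_recurrence n.+1) addSn
  addnS. Qed.

(* Weighting the convolution S_n = \sum_a s_a s_(n-a) by a + 2 multiplies it by
   (n + 4) / 2 by symmetry, while the three-term recurrence turns the weighted
   sum into 2 s_n + 2 n S_(n-2). *)
Lemma sc_moment_conv n :
  \sum_(a < n.+1) sc_moment a * sc_moment (n - a) = sc_moment n.+2.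
Proof.
have [m] := ubnP n; elim: m n => // m IH n nm.
pose S := \sum_(a < n.+1) sc_moment a * sc_moment (n - a).
have W1 : 2 * \sum_(a < n.+1) (a + 2)%:R * (sc_moment a * sc_moment (n - a)) = (n
  + 4)%:R * S.
  rewrite mulr2n mulrDl mul1r {2}(reindex_inj rev_ord_inj) /= -big_split /=
    mulr_sumr.
  apply: eq_bigr => a _; rewrite subSS subKn; last by rewrite -ltnS.
  rewrite [sc_moment (n - a) * _]mulrC -mulrDl -natrD; congr (_%:R * _).
  have := ltn_ord a; lia.
have W2 : \sum_(a < n.+1) (a + 2)%:R * (sc_moment a * sc_moment (n - a)) = (2 *
  n.+1)%:R * sc_moment n.
  rewrite big_ord_recl /= sc_moment0 subn0 mul1r.
  case: n nm @S W1 => [|n] nm S W1.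
    by rewrite big_ord0 addr0.
  rewrite big_ord_recl /= sc_moment1 mul0r mulr0 add0r.
  case: n nm @S W1 => [|n] nm S W1.
    by rewrite big_ord0 addr0 sc_moment1 !mulr0.
  have -> : \sum_(i < n.+1) (bump 0 (bump 0 i) + 2)%:R * (sc_moment (bump 0 (bump
    0 i)) * sc_moment (n.+2 - bump 0 (bump 0 i)))
    = 4 * \sum_(i < n.+1) (i.+1)%:R * (sc_moment i * sc_moment (n - i)).
    rewrite mulr_sumr; apply: eq_bigr => i _; rewrite /bump /= !add1n !subSS.
    rewrite !mulrA -natrM -sc_moment_rec; congr (_%:R * _ * _); lia.
  have W3 : 2 * \sum_(i < n.+1) (i.+1)%:R * (sc_moment i * sc_moment (n - i)) =
    (n + 2)%:R * sc_moment n.+2.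
    rewrite mulr2n mulrDl mul1r {2}(reindex_inj rev_ord_inj) /= -big_split /=
      -IH; last by lia.
    rewrite mulr_sumr.
    apply: eq_bigr => a _; rewrite subSS subKn; last by rewrite -ltnS.
    rewrite [sc_moment (n - a) * _]mulrC -mulrDl -natrD; congr (_%:R * _).
    have := ltn_ord a; lia.
  rewrite (_ : 4 = 2 * 2 :> R) -?mulrA ?W3; last by rewrite -natrM.
  rewrite !mulrA -natrM -mulrDl -natrD; congr (_%:R * _); lia.
have n4 : (n + 4)%:R != 0 :> R by rewrite pnatr_eq0 addnS.
apply: (mulfI n4); rewrite -/S -W1 W2 sc_moment_rec mulrA -natrM;
  congr (_%:R * _); lia.
Qed.

Lemma sc_momentS n : sc_moment n.+1 = \sum_(a < n) sc_moment a * sc_moment (n.-1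
  - a).
Proof. by case: n => [|n]; rewrite ?big_ord0 ?sc_moment1 // sc_moment_conv. Qed.

End semicircle_moments.

(** * Weierstrass approximation *)

Section weierstrass.
Context (R : realType).
Implicit Types (f : R -> R) (x y t : R).

Lemma uniform_continuity f (a b e : R) : continuous f -> 0 < e ->
  exists2 d, 0 < d & forall x y, x \in `[a, b] -> `|x - y| < d -> `|f x - f y| < e.
Proof.
move=> cf e0.
have cK : compact `[a, b] by exact: segment_compact.
have /compact_near_coveringP nc := cK.
have := nc R (0 : R)^'+ (fun d x => forall y, `|x - y| < d -> `|f x - f y| < e) _.
case.
- move=> x _.
  have e2 : 0 < e / 2 by rewrite divr_gt0.
  have := cf x => /cvgrPdist_lt /(_ _ e2) /nbhs_ballP [r /= r0 rf].
  have r2 : 0 < r / 2 by rewrite divr_gt0.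
  exists (ball x (r / 2), [set d : R | d < r / 2]) => /=.
    split; first exact: nbhsx_ballx.
    by exists (r / 2) => //= d; rewrite /= sub0r normrN => /ltr_normlW.
  move=> [x' d] /= [x'x dr] y x'y.
  have h1 : `|f x - f x'| < e / 2.
    by apply: rf; apply: lt_le_trans x'x _; lra.
  have h2 : `|f x - f y| < e / 2.
    apply: rf; rewrite /ball /=.
    have -> : x - y = (x - x') + (x' - y) by ring.
    rewrite (le_lt_trans (ler_normD _ _)) //.
    by move: x'x; rewrite /ball /= => x'x; lra.
  have -> : f x' - f y = - (f x - f x') + (f x - f y) by ring.
  by rewrite (le_lt_trans (ler_normD _ _)) // normrN; lra.
- move=> d /= d0 dP; exists (d / 2); first by rewrite divr_gt0.
  move=> x y xab xy; apply: (dP (d / 2) _ _ x _ y) => //=.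
  + by rewrite sub0r normrN gtr0_norm ?divr_gt0 //; lra.
  + by rewrite divr_gt0.
Qed.

(** The Bernstein polynomials: the probability of k successes in n trials with success rate t. *)
Definition bern (n k : nat) t : R := 'C(n, k)%:R * t ^+ k * (1 - t) ^+ (n - k).

Lemma bern_ge0 n k t : 0 <= t <= 1 -> 0 <= bern n k t.
Proof.
by move=> /andP[t0 t1]; rewrite /bern !mulr_ge0 // exprn_ge0 // subr_ge0.
Qed.

(* Both sums come from differentiating (t x + (1 - t))^n at x = 1. *)
Lemma bern_moments n t :
  [/\ \sum_(k < n.+1) bern n k t = 1,
      \sum_(k < n.+1) k%:R * bern n k t = n%:R * t &
      \sum_(k < n.+1) (k * k.-1)%:R * bern n k t = (n * n.-1)%:R * t ^+ 2].
Proof.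
pose P : {poly R} := (t *: 'X + (1 - t)%:P) ^+ n.
have PE : P = \sum_(k < n.+1) bern n k t *: 'X^k.
  rewrite /P addrC exprDn; apply: eq_bigr => k _.
  rewrite /bern exprZn -rmorphXn /= mul_polyC scalerA -scaler_nat scalerA.
  by congr (_ *: _); rewrite -mulrA; congr (_ * _); rewrite mulrC.
have E1 : (t *: 'X + (1 - t)%:P).[1] = 1 by rewrite hornerD hornerZ hornerX
  hornerC; ring.
have dE : (t *: 'X + (1 - t)%:P)^`() = t%:P by rewrite derivD derivC addr0 derivZ
  derivX alg_polyC.
split.
- have := congr1 (fun p => p.[1]) PE; rewrite horner_exp E1 expr1n horner_sum => ->.
  by apply: eq_bigr => k _; rewrite hornerZ hornerXn expr1n mulr1.
- have := congr1 (fun p => (p^`()).[1]) PE.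
  rewrite deriv_exp dE hornerMn hornerM horner_exp E1 expr1n hornerC mulr1
    -mulr_natl => ->.
  rewrite linear_sum horner_sum; apply: eq_bigr => k _.
  by rewrite /= derivZ derivXn hornerZ hornerMn hornerXn expr1n mulrC.
- have := congr1 (fun p => (p^`()^`()).[1]) PE.
  rewrite deriv_exp dE derivMn derivM derivC mul0r add0r deriv_exp dE.
  rewrite !(hornerMn, hornerM, horner_exp) E1 expr1n hornerC mulr1 => h.
  transitivity ((t * (t *+ n.-1)) *+ n); last first.
    by rewrite natrM; ring.
  rewrite h linear_sum linear_sum horner_sum; apply: eq_bigr => k _.
  rewrite /= derivZ derivXn derivZ derivMn derivXn hornerZ !hornerMn hornerXn expr1n.
  by rewrite natrM; ring.
Qed.

Lemma bern_variance n t :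
  \sum_(k < n.+1) (k%:R - n%:R * t) ^+ 2 * bern n k t = n%:R * t * (1 - t).
Proof.
have [m0 m1 m2] := bern_moments n t.
transitivity (\sum_(k < n.+1) ((k * k.-1)%:R * bern n k t + (1 - 2 * n%:R * t) *
  (k%:R * bern n k t)
   + (n%:R * t) ^+ 2 * bern n k t)).
  apply: eq_bigr => k _; case: (val k) => [|j]; rewrite ?mul0n /=; first by ring.
  by rewrite natrM -natr1; ring.
rewrite !big_split /= -!mulr_sumr m0 m1 m2.
case: n {m0 m1 m2} => [|n]; first by rewrite mul0n /=; ring.
by rewrite natrM -natr1 /=; ring.
Qed.

(** Bernstein's proof. Where k / n is within d of t, uniform continuity gives e / 2; elsewhere the
    difference is at most 2 M, which the factor (k - n t)^2 / (n d)^2 >= 1 turns into a variance, as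
    in Chebyshev's inequality. *)
Lemma weierstrass_unit f (e : R) : continuous f -> 0 < e ->
  exists p : {poly R}, forall t, 0 <= t <= 1 -> `|f t - p.[t]| <= e.
Proof.
move=> cf e0; have e2 : 0 < e / 2 by rewrite divr_gt0.
have [d d0 dP] := uniform_continuity 0 1 cf e2.
have [M M0 MP] : exists2 M : R, 0 <= M & forall t, 0 <= t <= 1 -> `|f t| <= M.
  have cn : {within `[0, 1], continuous (fun t => `|f t|)}.
    by apply: continuous_subspaceT => x; apply: (cvg_comp f Num.norm);
      [exact: cf|exact: norm_continuous].
  have [c _ cP] := @EVT_max _ _ 0 1 ler01 cn.
  by exists `|f c| => // t t01; apply: cP; rewrite in_itv.
(* The variance is at most n, so the far terms sum to at most 2 M / (n d^2), which this n brings
   below e / 2. *)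
have [n n0 nP] : exists2 n : nat, (0 < n)%N & 2 * M <= n%:R * (e / 2) * d ^+ 2.
  have c0 : 0 < e / 2 * d ^+ 2 by rewrite mulr_gt0 // exprn_gt0.
  have q0 : 0 <= 2 * M / (e / 2 * d ^+ 2) by rewrite divr_ge0 ?mulr_ge0 // ltW.
  exists (Num.bound (2 * M / (e / 2 * d ^+ 2))).+1 => //.
  rewrite -mulrA -ler_pdivrMr //; apply: (le_trans (ltW (archi_boundP q0))).
  by rewrite ler_nat.
have nn : 0 < n%:R :> R by rewrite ltr0n.
exists (\sum_(k < n.+1) f (k%:R / n%:R) *: ('C(n, k)%:R *: ('X^k * (1 - 'X) ^+ (n
  - k)))) => t t01.
have -> : (\sum_(k < n.+1) f (k%:R / n%:R) *: ('C(n, k)%:R *: ('X^k * (1 - 'X) ^+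
  (n - k)))).[t]
   = \sum_(k < n.+1) f (k%:R / n%:R) * bern n k t.
  rewrite horner_sum; apply: eq_bigr => k _.
  by rewrite /bern !hornerE /= ?mulrA.
have [m0 _ _] := bern_moments n t.
rewrite -[f t]mulr1 -{1}m0 mulr_sumr -sumrB.
apply: (le_trans (ler_norm_sum _ _ _)).
have key (k : 'I_n.+1) : `|f t * bern n k t - f (k%:R / n%:R) * bern n k t|
    <= e / 2 * bern n k t + 2 * M / (n%:R * d) ^+ 2 * ((k%:R - n%:R * t) ^+ 2 *
      bern n k t).
  have b0 := bern_ge0 n k t01.
  rewrite -mulrBl normrM (ger0_norm b0) [X in _ <= _ + X]mulrA -mulrDl ler_wpM2r //.
  have [tk|tk] := ltP `|t - k%:R / n%:R| d.
    have t01' : t \in `[0, 1] by rewrite in_itv.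
    rewrite (le_trans (ltW (dP _ _ t01' tk))) // lerDl.
    by rewrite mulr_ge0 ?sqr_ge0 // mulr_ge0 ?mulr_ge0 // invr_ge0 sqr_ge0.
  have kn01 : 0 <= (k%:R / n%:R : R) <= 1.
    by rewrite divr_ge0 //= ler_pdivrMr // mul1r ler_nat -ltnS.
  rewrite (@le_trans _ _ (2 * M)) //.
    by rewrite (le_trans (ler_normB _ _)) // mulr2n mulrDl mul1r lerD ?MP.
  rewrite (@le_trans _ _ (2 * M / (n%:R * d) ^+ 2 * (k%:R - n%:R * t) ^+ 2))
    ?lerDr ?(ltW e2) //.
  rewrite mulrAC ler_pdivlMr ?exprn_gt0 ?mulr_gt0 // ler_wpM2l ?mulr_ge0 //.
  have -> : k%:R - n%:R * t = - (n%:R * (t - k%:R / n%:R)) by field; rewrite gt_eqF.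
  rewrite sqrrN !exprMn ler_wpM2l ?sqr_ge0 // -[leRHS]real_normK ?num_real //.
  by rewrite ler_pXn2r ?nnegrE ?(ltW d0).
apply: (le_trans (ler_sum _ (fun k _ => key k))).
rewrite big_split /= -!mulr_sumr m0 bern_variance mulr1.
rewrite [leRHS]splitr lerD2l.
have t4 : t * (1 - t) <= 1 by move: t01 => /andP[t0 t1]; nra.
rewrite (@le_trans _ _ (2 * M / (n%:R * d) ^+ 2 * n%:R)) //.
  apply: ler_wpM2l; first by rewrite mulr_ge0 ?mulr_ge0 // invr_ge0 sqr_ge0.
  by rewrite -mulrA ler_piMr.
rewrite mulrAC ler_pdivrMr ?exprn_gt0 ?mulr_gt0 //.
have -> : e / 2 * (n%:R * d) ^+ 2 = n%:R * (e / 2) * d ^+ 2 * n%:R by ring.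
by rewrite ler_wpM2r.
Qed.

Lemma weierstrass f (a e : R) : continuous f -> 0 < a -> 0 < e ->
  exists p : {poly R}, forall x, `|x| <= a -> `|f x - p.[x]| <= e.
Proof.
move=> cf a0 e0.
pose g t := f ((2 * t - 1) * a).
have cg : continuous g.
  move=> t; apply: (cvg_comp (fun t => (2 * t - 1) * a) f); last exact: cf.
  apply: cvgM; last exact: cvg_cst.
  by apply: cvgB; [apply: cvgM; [exact: cvg_cst|exact: cvg_id]|exact: cvg_cst].
have [p pP] := weierstrass_unit cg e0.
exists (p \Po ((2 * a)^-1 *: 'X + (1 / 2)%:P)) => x xa.
have := pP ((2 * a)^-1 * x + 1 / 2);
  rewrite horner_comp hornerD hornerZ hornerX hornerC /g.
have -> : (2 * ((2 * a)^-1 * x + 1 / 2) - 1) * a = x by field; rewrite gt_eqF.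
apply; move: xa; rewrite ler_norml => /andP[x1 x2].
have -> : (2 * a)^-1 * x + 1 / 2 = (x + a) / (2 * a) by field; rewrite gt_eqF.
by rewrite divr_ge0 ?ler_pdivrMr ?mulr_gt0 //; lra.
Qed.

End weierstrass.

(** * Weak convergence from moments *)

Section moments_to_weak.
Context (R : realType).
Implicit Types (x : R) (f g : R -> R) (L : (R -> R) -> R) (p : {poly R}).

(** Polynomial growth is allowed because the bounded [f], its polynomial approximants and the tail
    majorant must lie in one class. *)
Definition test_fun f := continuous f /\
  exists (C : R) (d : nat), forall x, `|f x| <= C * (1 + `|x|) ^+ d.

(** The averaged eigenvalue density is treated as a functional; no measure on the line has to be
    built from the random eigenvalues. *)
Record pos_functional L : Prop := PosFunctional {
  pos_add : forall f g, test_fun f -> test_fun g ->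
    L (fun x => f x + g x) = L f + L g ;
  pos_scale : forall c f, test_fun f -> L (fun x => c * f x) = c * L f ;
  pos_mono : forall f g, test_fun f -> test_fun g ->
    (forall x, f x <= g x) -> L f <= L g }.

Lemma growth_mono (C D : R) d e x : 0 <= D -> C <= D -> (d <= e)%N ->
  C * (1 + `|x|) ^+ d <= D * (1 + `|x|) ^+ e.
Proof.
move=> D0 CD de; apply: (@le_trans _ _ (D * (1 + `|x|) ^+ d)).
  by rewrite ler_wpM2r // exprn_ge0 // addr_ge0.
by rewrite ler_wpM2l // ler_weXn2l // lerDl.
Qed.

Lemma test_growth f : test_fun f ->
  exists (C : R) (d : nat), 0 <= C /\ forall x, `|f x| <= C * (1 + `|x|) ^+ d.
Proof.
move=> [_ [C [d fC]]]; exists `|C|, d; split => // x.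
by rewrite (le_trans (fC x)) // growth_mono // ler_norm.
Qed.

Lemma test_cst c : test_fun (fun=> c).
Proof.
split; first by move=> x; exact: cvg_cst.
by exists `|c|, 0%N => x; rewrite expr0 mulr1.
Qed.

Lemma test_id : test_fun id.
Proof.
split; first by move=> x; exact: cvg_id.
by exists 1, 1%N => x; rewrite mul1r expr1 lerDr.
Qed.

Lemma testD f g : test_fun f -> test_fun g -> test_fun (fun x => f x + g x).
Proof.
move=> tf tg; split; first by move=> x; apply: cvgD; [exact: tf.1|exact: tg.1].
have [C [d [C0 fC]]] := test_growth tf; have [D [e [D0 gD]]] := test_growth tg.
exists (C + D), (d + e)%N => x; rewrite (le_trans (ler_normD _ _)) // mulrDl lerD //.
  by rewrite (le_trans (fC x)) // growth_mono // leq_addr.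
by rewrite (le_trans (gD x)) // growth_mono // leq_addl.
Qed.

Lemma testM f g : test_fun f -> test_fun g -> test_fun (fun x => f x * g x).
Proof.
move=> tf tg; split; first by move=> x; apply: cvgM; [exact: tf.1|exact: tg.1].
have [C [d [C0 fC]]] := test_growth tf; have [D [e [D0 gD]]] := test_growth tg.
exists (C * D), (d + e)%N => x; rewrite normrM exprD mulrACA.
exact: ler_pM.
Qed.

Lemma test_scale c f : test_fun f -> test_fun (fun x => c * f x).
Proof. by move=> tf; apply: testM => //; exact: test_cst. Qed.

Lemma test_exp n : test_fun (fun x => x ^+ n).
Proof.
elim: n => [|n IH]; first exact: test_cst.
have -> : (fun x : R => x ^+ n.+1) = (fun x => x * x ^+ n).
  by apply/funext => x; rewrite exprS.
exact: testM test_id IH.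
Qed.

Lemma test_poly p : test_fun (fun x => p.[x]).
Proof.
elim/poly_ind: p => [|p c IH].
  by rewrite (_ : (fun _ => _) = (fun=> 0)); [exact: test_cst|apply/funext => x;
    rewrite horner0].
rewrite (_ : (fun _ => _) = (fun x => p.[x] * x + c)); last first.
  by apply/funext => x; rewrite hornerD hornerM hornerX hornerC.
by apply: testD; [exact: testM IH test_id|exact: test_cst].
Qed.

Lemma pos_sub L f g : pos_functional L -> test_fun f -> test_fun g ->
  L (fun x => f x - g x) = L f - L g.
Proof.
move=> pL tf tg; rewrite -mulN1r -(pos_scale pL (-1) tg) -(pos_add pL tf);
  last exact: test_scale.
by congr L; apply/funext => x; rewrite mulN1r.
Qed.

Lemma pos_poly L p : pos_functional L ->
  L (fun x => p.[x]) = \sum_(i < size p) p`_i * L (fun x => x ^+ i).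
Proof.
move=> pL.
have -> : (fun x => p.[x]) = (fun x => \sum_(i < size p) p`_i * x ^+ i).
  by apply/funext => x; rewrite horner_coef.
elim: (size p) => [|n IH].
  rewrite big_ord0 (_ : (fun _ => _) = (fun x => 0 * 1)); last first.
    by apply/funext => x; rewrite big_ord0 mul0r.
  by rewrite (pos_scale pL 0 (test_cst 1)) mul0r.
rewrite big_ord_recr /= -IH -(pos_scale pL _ (test_exp n)) -(pos_add pL);
  last 2 first.
- have -> : (fun x => \sum_(i < n) p`_i * x ^+ i) = (fun x =>
  (\poly_(i < n) p`_i).[x]).
    by apply/funext => x; rewrite horner_poly.
  exact: test_poly.
- by apply: test_scale; exact: test_exp.
by congr L; apply/funext => x; rewrite big_ord_recr.
Qed.

Lemma pos_dist L f g h : pos_functional L -> test_fun f -> test_fun g ->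
  test_fun h ->
  (forall x, `|f x - g x| <= h x) -> `|L f - L g| <= L h.
Proof.
move=> pL tf tg th fgh; rewrite -(pos_sub pL) // ler_norml.
have tfg : test_fun (fun x => f x - g x).
  rewrite (_ : (fun _ => _) = (fun x => f x + -1 * g x)).
    by apply: testD => //; exact: test_scale.
  by apply/funext => x; rewrite mulN1r.
apply/andP; split; last first.
  by apply: (pos_mono pL) => // x; rewrite (le_trans (ler_norm _)).
rewrite -mulN1r -(pos_scale pL) //; apply: (pos_mono pL) => //;
  first exact: test_scale.
by move=> x; rewrite mulN1r; have := fgh x; rewrite ler_norml => /andP[].
Qed.

(** The bound 4^m on the even moments says that the limit lives on [-2, 2]. [f] is approximated on
    the larger interval [-3, 3]; outside it the error is at most K (|x| / 3)^(2m), whose mean is of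
    order (4 / 9)^m. *)
Lemma moments_weak_cvg (L : nat -> (R -> R) -> R) (L0 : (R -> R) -> R) (f : R -> R) :
  (forall N, (0 < N)%N -> pos_functional (L N)) -> pos_functional L0 ->
  (forall m, L N (fun x => x ^+ m) @[N --> \oo] --> L0 (fun x => x ^+ m)) ->
  L0 (fun=> 1) = 1 -> (forall m, L0 (fun x => x ^+ m.*2) <= 4 ^+ m) ->
  continuous f -> (exists M, forall x, `|f x| <= M) ->
  L N f @[N --> \oo] --> L0 f.
Proof.
move=> pL pL0 Lm L01 L0m cf [M fM].
have M0 : 0 <= M := le_trans (normr_ge0 _) (fM 0).
have tf : test_fun f by split => //; exists M, 0%N => x; rewrite expr0 mulr1.
have Lp p : L N (fun x => p.[x]) @[N --> \oo] --> L0 (fun x => p.[x]).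
  rewrite (pos_poly p pL0).
  have : (fun N => \sum_(i < size p) p`_i * L N (fun x =>
    x ^+ i)) @ \oo --> \sum_(i < size p) p`_i * L0 (fun x => x ^+ i).
    elim: (size p) => [|n IH].
      rewrite big_ord0 (_ : (fun _ => _) = (fun=> 0)); first exact: cvg_cst.
      by apply/funext => N; rewrite big_ord0.
    rewrite big_ord_recr /= (_ : (fun _ => _) = (fun N =>
      \sum_(i < n) p`_i * L N (fun x => x ^+ i) + p`_n * L N (fun x => x ^+ n))).
      by apply: cvgD => //; apply: cvgMr; exact: Lm.
    by apply/funext => N; rewrite big_ord_recr.
  apply: cvg_trans; apply: near_eq_cvg; near=> N; rewrite (pos_poly p) //.
  by apply: pL; near: N; exact: nbhs_infty_gt.
(* 7 = 3 + 1 + 3: replacing [f] by [p] costs 3 e in the limit and 3 e at stage N, and comparing the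
   two values at [p] costs e. *)
apply/cvgrPdist_le => e0 e0_gt0; pose e := e0 / 7.
have e_gt0 : 0 < e by rewrite divr_gt0.
have [p pP] := weierstrass cf (ltr0n _ 3) e_gt0.
have [C [d [C0 pC]]] := test_growth (test_poly p).
(* Beyond 3 one has 1 + |x| <= 4 |x| / 3, hence the factor 4^d. *)
pose K := M + C * 4 ^+ d.
have K0 : 0 <= K by rewrite addr_ge0 // mulr_ge0 // exprn_ge0.
(* [p] and [d] are fixed before m; the condition d <= 2 m lets (|x| / 3)^(2m) dominate (|x| /
   3)^d. *)
have [m [dm Km]] : exists m, (d <= m.*2)%N /\ K * 9^-1 ^+ m * (2 * 4 ^+ m) <= e.
  have g0 : 2 * K * (4 / 9) ^+ m @[m --> \oo] --> (0 : R).
    rewrite -[X in _ --> X](mulr0 (2 * K)); apply: cvgMr; apply: cvg_expr.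
    by rewrite ger0_norm ?divr_ge0 //; lra.
  have g1 : \forall m \near \oo, 2 * K * (4 / 9) ^+ m <= e.
    by move: g0 => /cvgr_le; apply.
  near \oo => m; exists m; split.
    by apply: (@leq_trans m); [near: m;
      exact: nbhs_infty_ge|rewrite -addnn leq_addr].
  rewrite (_ : _ * _ = 2 * K * (4 / 9) ^+ m); first by near: m.
  by rewrite exprMn; ring.
pose h (x : R) := e * 1 + K * 9^-1 ^+ m * x ^+ m.*2.
have th : test_fun h.
  by apply: testD; apply: test_scale; [exact: test_cst|exact: test_exp].
have fph x : `|f x - p.[x]| <= h x.
  have tail0 : 0 <= K * 9^-1 ^+ m * x ^+ m.*2.
    apply: mulr_ge0; last by rewrite -mul2n exprM exprn_ge0 // sqr_ge0.
    by apply: mulr_ge0 => //; rewrite exprn_ge0 // invr_ge0.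
  have [x3|x3] := leP `|x| 3;
    first by rewrite /h mulr1 (le_trans (pP x x3)) // lerDl.
  have y1 : 1 <= `|x| / 3 by rewrite ler_pdivlMr // mul1r ltW.
  have -> : h x = e + K * (`|x| / 3) ^+ m.*2.
    rewrite /h mulr1 -mulrA; congr (_ + _ * _).
    rewrite -mul2n !exprM -exprMn; congr (_ ^+ _).
    rewrite expr_div_n real_normK ?num_real // mulrC; congr (_ / _).
    by rewrite -natrX.
  rewrite (@le_trans _ _ (K * (`|x| / 3) ^+ m.*2)) ?lerDr ?(ltW e_gt0) //.
  rewrite (le_trans (ler_normB _ _)) // mulrDl lerD //.
    by rewrite (le_trans (fM x)) // ler_peMr // exprn_ege1.
  rewrite (le_trans (pC x)) // -mulrA ler_wpM2l //.
  rewrite (@le_trans _ _ ((4 * (`|x| / 3)) ^+ d)) //.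
    by apply: lerXn2r; rewrite ?nnegrE; have := normr_ge0 x; lra.
  by rewrite exprMn ler_wpM2l ?exprn_ge0 // ler_weXn2l.
(* The slack factors 2 allow the same estimate for the limit and, eventually, for every [L N]. *)
have bound L' : pos_functional L' -> L' (fun=> 1) <= 2 ->
    L' (fun x => x ^+ m.*2) <= 2 * 4 ^+ m -> `|L' f - L' (fun x => p.[x])| <= 3 * e.
  move=> pL' b1 b2; apply: (le_trans (pos_dist pL' tf (test_poly p) th fph)).
  rewrite /h (pos_add pL') ?(pos_scale pL');
    [|exact: test_exp|exact: test_cst|by apply: test_scale;
      exact: test_cst|by apply: test_scale; exact: test_exp].
  have -> : 3 * e = e * 2 + e by ring.
  rewrite lerD ?ler_wpM2l ?(ltW e_gt0) //; apply: le_trans Km.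
  by rewrite ler_wpM2l // mulr_ge0 // exprn_ge0 // invr_ge0.
have four1 : 1 <= 4 ^+ m :> R by rewrite exprn_ege1 // ler1n.
have B0 : `|L0 f - L0 (fun x => p.[x])| <= 3 * e.
  apply: bound => //; first by rewrite L01 ler1n.
  by rewrite (le_trans (L0m m)) // ler_peMl ?exprn_ge0 // ler1n.
have N1 : \forall N \near \oo, L N (fun=> 1) <= 2.
  have := Lm 0%N; rewrite (_ : (fun x => x ^+ 0) = (fun=> 1)) ?L01 //.
  move=> /cvgr_le; apply; exact: ltr1n.
have N2 : \forall N \near \oo, L N (fun x => x ^+ m.*2) <= 2 * 4 ^+ m.
  move: (Lm m.*2) => /cvgr_le; apply.
  by rewrite (le_lt_trans (L0m m)) // ltr_pMl ?ltr1n // (lt_le_trans ltr01).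
have N3 : \forall N \near \oo, `|L0 (fun x => p.[x]) - L N (fun x => p.[x])| <= e.
  by move: (Lp p) => /cvgrPdist_le; exact.
near=> N.
have BN : `|L N f - L N (fun x => p.[x])| <= 3 * e.
  apply: bound; [|by near: N|by near: N].
  by apply: pL; near: N; exact: nbhs_infty_gt.
have BP : `|L0 (fun x => p.[x]) - L N (fun x => p.[x])| <= e by near: N.
have -> : L0 f - L N f = (L0 f - L0 (fun x => p.[x])) +
   ((L0 (fun x => p.[x]) - L N (fun x => p.[x])) - (L N f - L N (fun x =>
     p.[x]))) by ring.
have -> : e0 = 3 * e + (e + 3 * e) by rewrite /e; field.
rewrite (le_trans (ler_normD _ _)) // lerD // (le_trans (ler_normB _ _)) // lerD //.
Unshelve. all: by end_near. Qed.

End moments_to_weak.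

(** * The matrix model *)

Section model.
Context (R : realType) (k : nat) (B : R) (B0 : 0 < B).
Local Notation leb := (@lebesgue_measure R).

Definition herm_coord N (t : N.-tuple (N.-tuple R)) (p : 'I_N * 'I_N) : R :=
  tnth (tnth t p.1) p.2.

Definition vec_coord N (l : N.-tuple (R * R)) (q : 'I_N * (unit + unit)) : R :=
  sum_fun (fun _ : unit => (tnth l q.1).1) (fun _ : unit => (tnth l q.1).2) q.2.

Definition model_coord N (u : N.-tuple (N.-tuple R) * N.-tuple (R * R)) :=
  sum_fun (herm_coord u.1) (vec_coord u.2).

Lemma herm_gauss_space N :
  gauss_space (@herm_measure R N) (@herm_coord N) (herm_wt B).
Proof.
have wt0 (i j : 'I_N) : 0 < herm_wt B (i, j) :> R.
  by rewrite /herm_wt /=; case: ifP => _ //; rewrite mulr_gt0.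
have G (i : 'I_N) := tuple_gauss_space (fun j => real_gauss_space (wt0 i j)).
have G' := @tuple_gauss_space _ _ _ _ _ _ N _ G.
pose phi (p : 'I_N * 'I_N) : 'I_N * ('I_N * unit) := (p.1, (p.2, tt)).
have bphi : bijective phi.
  by exists (fun q => (q.1, q.2.1)) => [[i j]|[i [j []]]].
have := reindex_gauss_space bphi G'.
by rewrite (_ : (fun j => herm_wt B _) = herm_wt B) //; apply/funext => -[].
Qed.

Lemma vec_gauss_space N :
  gauss_space (@vec_measure R N) (@vec_coord N) (fun=> 1).
Proof.
have g1 := real_gauss_space (ltr01 : 0 < 1 :> R).
have g2 := prod_gauss_space g1 g1.
have := @tuple_gauss_space _ _ _ _ _ _ N _ (fun=> g2).
rewrite (_ : (fun p => sum_fun _ _ p.2) = (fun=> 1)) //.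
by apply/funext => -[i [[]|[]]].
Qed.

Lemma model_gauss_space N :
  gauss_space (prod_measure (@herm_measure R N) (@vec_measure R N))
    (@model_coord N) (model_wt B).
Proof. exact: prod_gauss_space (herm_gauss_space N) (vec_gauss_space N). Qed.

Lemma mx_crd_model N (u : N.-tuple (N.-tuple R) * N.-tuple (R * R)) :
  mx_crd (model_coord u) = herm_of u.1.
Proof. by []. Qed.

Lemma vec_crd_model N (u : N.-tuple (N.-tuple R) * N.-tuple (R * R)) :
  vec_crd (model_coord u) = map_mx Num.conj (vec_of u.2).
Proof.
by apply/rowP => i; rewrite !mxE; apply: eq_re_im; rewrite ?cRe_conj ?cIm_conj.
Qed.

Lemma Psi_grE (c : R) N (u : N.-tuple (N.-tuple R) * N.-tuple (R * R)) :
  expR (- \sum_i normc (vec_of u.2 0 i) ^+ 2)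
    * normc (Psi_gr c k B (herm_of u.1) (map_mx Num.conj (vec_of u.2))) ^+ 2
  = c ^+ 2 * (Phi k (model_coord u) * gauss_weight (model_wt B) (model_coord u)).
Proof.
rewrite /Psi_gr -/(ldet _ _) !ComplexField.Normc.normcM !normc_real normcX.
rewrite /Phi mx_crd_model vec_crd_model gauss_weight_sum.
rewrite !exprMn !real_normK ?num_real // -!exprM [(k * 2)%N]mulnC.
have -> : expR (- (B / 2) * Re (\tr (herm_of u.1 ^+ 2))) ^+ 2
    = gauss_weight (herm_wt B) (herm_coord u.1).
  rewrite /gauss_weight herm_wt_sqr -expRM_natl; congr expR.
  rewrite -/(mx_crd (model_coord u)) mx_crd_model; by field.
have -> : expR (- \sum_i normc (vec_of u.2 0 i) ^+ 2)
    = gauss_weight (fun=> 1) (vec_coord u.2).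
  rewrite /gauss_weight -(pair_bigA _ (fun i s => 1 * vec_coord u.2 (i, s) ^+ 2)) /=.
  congr (expR (- _)); apply: eq_bigr => i _; rewrite big_sumType /= normc_sqr mxE /=.
  have us (F : unit -> R) : \sum_s F s = F tt.
    by rewrite (bigD1 tt) //= big1 ?addr0 // => -[].
  by rewrite !us !mul1r.
by rewrite mul2n -addnn exprD; ring.
Qed.

Definition model_moment (N : nat) (s : seq nat) : R :=
  gauss_int (prod_measure (@herm_measure R N) (@vec_measure R N))
    (@model_coord N) (model_wt B) (@trsPhi R N k s).

Lemma Phi_pos N : exists a, 0 < @Phi R N k a.
Proof.
(* X = diag(0, ..., N - 1) and lambda = (1, ..., 1): D is then a Vandermonde determinant with
   distinct nodes. *)
pose a (i : 'I_N * 'I_N + 'I_N * (unit + unit)) : R :=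
  match i with
  | inl p => if p.1 == p.2 then (val p.1)%:R else 0
  | inr (_, inl _) => 1
  | inr (_, inr _) => 0
  end.
exists a; rewrite /Phi.
have -> : mx_crd a = invmx 1%:M *m diag_mx (\row_i (val i)%:R) *m 1%:M :> 'M[R[i]]_N.
  rewrite invmx1 mul1mx mulmx1; apply/matrixP => i j; rewrite !mxE /= -!val_eqE /=.
  have [ij|ij|/val_inj ->] := ltngtP i j.
  - by rewrite mulr0n; apply: eq_re_im.
  - by rewrite mulr0n; apply: eq_re_im; rewrite //= oppr0.
  - by rewrite eqxx mulr1n rmorph_nat.
rewrite ldet_conj_diag ?unitmx1 // !exprn_gt0 //.
set z := _ * _.
suff z0 : z != 0.
  rewrite lt0r; apply/andP; split; last by case: (z) => x y; rewrite sqrtr_ge0.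
  by apply/eqP => /ComplexField.Normc.eq0_normc /eqP; rewrite (negbTE z0).
rewrite /z invmx1 mulmx1 det1 mulr1 mulf_neq0 //.
  apply/prodf_neq0 => i _; apply/prodf_neq0 => j ij.
  by rewrite !mxE subr_eq0 eqr_nat gtn_eqF.
apply/prodf_neq0 => i _; rewrite mxE /= (_ : _ -i* _ = 1)%C ?oner_eq0 //.
by apply: eq_re_im; rewrite //= oppr0.
Qed.

(** The total mass is nonzero, so dividing by it, as the normalising constant does, is
    meaningful. *)
Lemma model_moment_gt0 N : 0 < model_moment N [::].
Proof.
have G := model_gauss_space N.
have pP := @is_poly_trsPhi R N k [::].
rewrite -lte_fin -(gauss_intE G) //; have [dP {}pP] := pP.
apply: (gs_integral_gt0 G pP) => [y|].
  by rewrite /trsPhi /trs big_nil mul1r /Phi exprn_ge0 // sqr_ge0.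
have [a Pa] := Phi_pos N.
by exists a; rewrite /trsPhi /trs big_nil mul1r.
Qed.

Lemma ptr0 N (X : 'M[R[i]]_N) : ptr 0 X = N%:R.
Proof.
rewrite /ptr expr0 mxtrace1 -(rmorph_nat (real_complex R)) //.
Qed.

Lemma model_moment_cons0 N s : model_moment N (0%N :: s) = N%:R * model_moment N s.
Proof.
rewrite /model_moment -(gauss_intZ (model_gauss_space N));
  last exact: is_poly_trsPhi.
by congr gauss_int; apply/funext => z; rewrite /trsPhi /trs big_cons ptr0 mulrA.
Qed.

Lemma model_moment_cvg s :
  scaled_moment k B model_moment N s @[N --> \oo] --> \prod_(m <- s) @sc_moment R m.
Proof.
apply: scaled_moment_cvg => //.
- by move=> N _; exact: model_moment_gt0.
- by move=> N {}s _; exact: model_moment_cons0.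
- by move=> N n {}s _; exact: loop_equation (model_gauss_space N) n s.
- exact: sc_moment0.
- exact: sc_momentS.
Qed.

End model.

(** * Eigenvalue statistics under the ground-state measure *)

Section density.
Context (R : realType) (k : nat) (B : R) (B0 : 0 < B) (N : nat) (N0 : (0 < N)%N).
Local Notation T1 := (N.-tuple (N.-tuple R)).
Local Notation T2 := (N.-tuple (R * R)).
Local Notation mu1 := (@herm_measure R N).
Local Notation mu2 := (@vec_measure R N).
Local Notation mu := (prod_measure mu1 mu2).
Local Notation r := (rescaling k B N).
Local Notation crd := (@model_coord R N).
Local Notation G := (model_gauss_space B0 N).
Local Notation Z := (model_moment k B N [::]).
Implicit Types (f g : R -> R) (u : T1 * T2).

Definition dens f u : R := density_scaled N r f (herm_of u.1).

Definition model_density u : R := Phi k (crd u) * gauss_weight (model_wt B) (crd u).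

Lemma model_density_ge0 u : 0 <= model_density u.
Proof. by rewrite mulr_ge0 ?expR_ge0 // /Phi exprn_ge0 // sqr_ge0. Qed.

Lemma densE f u : dens f u = N%:R^-1 * \sum_i f (r * eigval (herm_of u.1) i).
Proof. by []. Qed.

Lemma herm_of_sa (t : T1) : self_adjoint (herm_of t).
Proof. exact: (herm_mx_sa (herm_coord t)). Qed.

Lemma dens_exp m u : dens (fun x =>
  x ^+ m) u = r ^+ m / N%:R * ptr m (mx_crd (crd u)).
Proof.
rewrite mx_crd_model densE ptrE; last exact: herm_of_sa.
under eq_bigr do rewrite exprMn.
by rewrite -mulr_sumr mulrA [N%:R^-1 * _]mulrC.
Qed.

Lemma densD f g u : dens (fun x => f x + g x) u = dens f u + dens g u.
Proof. by rewrite !densE big_split mulrDr. Qed.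

Lemma densZ c f u : dens (fun x => c * f x) u = c * dens f u.
Proof. by rewrite !densE -mulr_sumr mulrCA. Qed.

Lemma dens_mono f g u : (forall x, f x <= g x) -> dens f u <= dens g u.
Proof. by move=> fg; rewrite !densE ler_wpM2l ?invr_ge0 // ler_sum. Qed.

Lemma dens_norm f u : `|dens f u| <= dens (fun x => `|f x|) u.
Proof.
rewrite !densE normrM ger0_norm ?invr_ge0 // ler_wpM2l ?invr_ge0 //.
exact: ler_norm_sum.
Qed.

Lemma is_poly_dens (p : {poly R}) :
  exists2 F, is_poly F & forall u, dens (fun x => p.[x]) u = F (crd u).
Proof.
exists (fun z => \sum_(i < size p) p`_i * (r ^+ i / N%:R * ptr i (mx_crd z))).
  apply: is_poly_sum => i; apply: is_polyM; first exact: is_poly_cst.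
  by apply: is_polyM; [exact: is_poly_cst|exact: is_poly_ptr].
move=> u; under eq_bigr do rewrite -dens_exp densE mulrCA.
rewrite densE -mulr_sumr; congr (_ * _).
under [in RHS]eq_bigr do rewrite mulr_sumr.
by rewrite exchange_big; apply: eq_bigr => j _; rewrite horner_coef.
Qed.

Lemma measurable_dens_poly (p : {poly R}) :
  measurable_fun setT (dens (fun x => p.[x])).
Proof.
have [F [dF pF] FE] := is_poly_dens p.
rewrite (_ : dens _ = fun u => F (crd u)); last exact/funext.
exact: poly_diff_measurable pF (gs_meas G).
Qed.

Lemma measurable_dens f : continuous f -> measurable_fun setT (dens f).
Proof.
move=> cf.
have /choice[p pP] : forall n : nat, exists p : {poly R},
    forall x, `|x| <= n.+1%:R -> `|f x - p.[x]| <= n.+1%:R^-1.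
  by move=> n; apply: weierstrass.
apply: (@measurable_fun_cvg _ _ _ _ (fun n => dens (fun x => (p n).[x]))) => [n|u _].
  exact: measurable_dens_poly.
apply/cvgrPdist_le => e e0.
pose M := \sum_i `|r * eigval (herm_of u.1) i|.
have ne : \forall n \near \oo, n.+1%:R^-1 < e := near_infty_natSinv_lt (PosNum e0).
near=> n.
have nM i : `|r * eigval (herm_of u.1) i| <= n.+1%:R.
  apply: (@le_trans _ _ M).
    by rewrite /M (bigD1 i) //= lerDl sumr_ge0.
  apply: (@le_trans _ _ n%:R); last by rewrite ler_nat.
  by near: n; exact: nbhs_infty_ger.
rewrite !densE -mulrBr -sumrB normrM ger0_norm ?invr_ge0 // mulrC ler_pdivrMr
  ?ltr0n //.
rewrite (le_trans (ler_norm_sum _ _ _)) //.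
rewrite (@le_trans _ _ (\sum_(i < N) e)) //;
  last by rewrite sumr_const card_ord mulr_natr.
apply: ler_sum => i _; rewrite (le_trans (pP n _ (nM i))) //.
by apply: ltW; near: n.
Unshelve. all: by end_near. Qed.

Lemma dens_growth f : test_fun f ->
  exists2 F, is_poly F & forall u, `|dens f u| <= F (crd u).
Proof.
move=> /test_growth[C [d [C0 fC]]].
(* From (1 + |x|)^2 <= 2 + 2 x^2: a majorant without absolute values, hence a combination of
   traces. *)
pose p : {poly R} := C *: (2%:P + 2 *: 'X^2) ^+ d.
have [F pF FE] := is_poly_dens p.
exists F => // u; rewrite -FE (le_trans (dens_norm _ _)) // dens_mono // => x.
rewrite (le_trans (fC x)) // /p hornerZ ler_wpM2l // horner_exp hornerD hornerC
  hornerZ hornerXn.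
apply: (@le_trans _ _ (((1 + `|x|) ^+ 2) ^+ d)).
  by rewrite -exprM ler_weXn2l ?lerDl // leq_pmull.
apply: lerXn2r; rewrite ?nnegrE ?sqr_ge0 //; have := sqr_ge0 x; first lra.
by move=> _; rewrite -[x ^+ 2]real_normK ?num_real //;
  have := sqr_ge0 (1 - `|x|); lra.
Qed.

Lemma integrable_dens f : test_fun f ->
  mu.-integrable setT (fun u => (dens f u * model_density u)%:E).
Proof.
move=> tf; have [F [dF pF] FE] := dens_growth tf.
have [dP pP] := @is_poly_Phi R N k.
apply: (le_integrable _ _ _ (gs_integrable G (poly_diffM pF pP))) => //.
  apply/measurable_EFinP; apply: measurable_funM; first exact: measurable_dens tf.1.
  apply: measurable_funM; first exact: poly_diff_measurable pP (gs_meas G).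
  exact: measurable_gauss_weight (gs_meas G).
move=> u _; rewrite /= lee_fin [`|dens f u * _|]normrM (ger0_norm
  (model_density_ge0 u)).
have -> : F (crd u) * Phi k (crd u) * gauss_weight (model_wt B) (crd u)
  = F (crd u) * model_density u by rewrite -mulrA.
rewrite [`|F (crd u) * _|]normrM (ger0_norm (model_density_ge0 u)) ler_wpM2r
  ?model_density_ge0 // (le_trans (FE u)) // ler_norm //.
Qed.

Definition mean_density f : R :=
  fine (\int[mu]_u (dens f u * model_density u)%:E)%E / Z.

Let intE f : test_fun f ->
  (\int[mu]_u (dens f u * model_density u)%:E)%E = (mean_density f * Z)%:E.
Proof.
move=> tf; rewrite /mean_density divfK ?fineK //; last first.
  by rewrite gt_eqF // model_moment_gt0.
by rewrite integrable_fin_num // integrable_dens.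
Qed.

Lemma pos_functional_mean_density : pos_functional mean_density.
Proof.
have Z0 : Z != 0 by rewrite gt_eqF // model_moment_gt0.
split.
- move=> f g tf tg; apply: (mulIf Z0); apply: EFin_inj.
  rewrite -intE; last exact: testD.
  rewrite mulrDl EFinD -!intE // -integralD //; [|exact: integrable_dens..].
  by apply: eq_integral => u _; rewrite -EFinD densD mulrDl.
- move=> c f tf; apply: (mulIf Z0); apply: EFin_inj.
  rewrite -intE; last exact: test_scale.
  rewrite -mulrA EFinM -!intE // -integralZl //; last exact: integrable_dens.
  by apply: eq_integral => u _; rewrite -EFinM densZ -mulrA.
- move=> f g tf tg fg;
  rewrite -(ler_pM2r (model_moment_gt0 k B0 N)) -lee_fin -!intE //.
  apply: le_integral => //; [exact: integrable_dens..|move=> u _].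
  by rewrite lee_fin ler_wpM2r ?model_density_ge0 // dens_mono.
Qed.

Lemma mean_density_exp m :
  mean_density (fun x => x ^+ m) = scaled_moment k B (model_moment k B) N [:: m].
Proof.
have Z0 : Z != 0 by rewrite gt_eqF // model_moment_gt0.
apply: (mulIf Z0); rewrite /scaled_moment /= addn0 expr1 -[RHS]mulrA [in
  RHS]divfK //.
apply: EFin_inj; rewrite -intE; last exact: test_exp.
rewrite EFinM /model_moment -(gauss_intE G); last exact: is_poly_trsPhi.
rewrite -integralZl //; last first.
  by have [dP pP] := @is_poly_trsPhi R N k [:: m]; exact: (gs_integrable G pP).
apply: eq_integral => u _;
  rewrite -EFinM dens_exp /trsPhi /trs big_seq1 /model_density.
by congr _%:E; ring.
Qed.

Lemma Q_constE c (t : T1) : Q_const c k B (herm_of t)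
  = (\int[mu2]_l ((c ^+ 2)%:E * (model_density (t, l))%:E))%E.
Proof.
apply: eq_integral => l _; rewrite -EFinM.
by have := Psi_grE k B c (t, l) => /= ->.
Qed.

(** Integrability for every matrix, not merely almost every one, lets a constant be pulled out of
    the inner integral pointwise. *)
Lemma integrable_model_density (t : T1) :
  mu2.-integrable setT (fun l => (model_density (t, l))%:E).
Proof.
have [dP pP] := @is_poly_Phi R N k.
have pt := poly_diff_sumr (herm_coord t) pP.
have := integrableZl measurableT (gauss_weight (herm_wt B) (herm_coord t))
  (gs_integrable (vec_gauss_space R N) pt).
apply: eq_integrable => // l _; rewrite -EFinM /model_density gauss_weight_sum.
by congr _%:E; rewrite mulrCA.
Qed.

(** By Fubini the integral that defines the constant is the total mass on the joint space of X and
    lambda. *)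
Lemma gr_const_sqr : gr_const k B N ^+ 2 = Z^-1.
Proof.
have Z0 := model_moment_gt0 k B0 N.
have pP := @is_poly_trsPhi R N k [::].
have PhiE z : Phi k z = trsPhi k [::] z :> R by rewrite /trsPhi /trs big_nil mul1r.
have ZE : (\int[mu]_u (model_density u)%:E)%E = Z%:E.
  rewrite -(gauss_intE G pP); apply: eq_integral => u _.
  by rewrite /model_density PhiE.
have id : mu.-integrable setT (fun u => (model_density u)%:E).
  have [dP {}pP] := pP; apply: eq_integrable (gs_integrable G pP) => // u _.
  by rewrite /model_density PhiE.
rewrite /gr_const exprVn.
have -> : (\int[mu1]_t Q_const 1 k B (herm_of t))%E = Z%:E.
  rewrite -[RHS]ZE; have id' : (mu1 \x mu2)%E.-integrable setT (fun u =>
    (model_density u)%:E) := id.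
  apply: etrans (integral12_prod_meas1 id').
  apply: eq_integral => t _; rewrite Q_constE /fubini_F.
  by apply: eq_integral => l _; rewrite expr1n mul1e.
by rewrite sqr_sqrtr // ltW.
Qed.

Lemma E_gE f : test_fun f ->
  E_g k B (density_scaled N r f) = (mean_density f)%:E.
Proof.
move=> tf; have Z0 := model_moment_gt0 k B0 N.
have -> : mean_density f = Z^-1 * (mean_density f * Z) by field; rewrite gt_eqF.
rewrite EFinM -intE // -integralZl //; last exact: integrable_dens.
have i1 : mu.-integrable setT (fun u =>
  ((Z^-1)%:E * (dens f u * model_density u)%:E)%E).
  by apply: integrableZl => //; exact: integrable_dens.
have i2 : (mu1 \x mu2)%E.-integrable setT (fun u =>
  ((Z^-1)%:E * (dens f u * model_density u)%:E)%E) := i1.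
apply: etrans (integral12_prod_meas1 i2).
apply: eq_integral => t _; rewrite /Q_g Q_constE gr_const_sqr /fubini_F /=.
rewrite -integralZl //; last by apply: integrableZl => //;
  exact: integrable_model_density.
by apply: eq_integral => l _; rewrite -!EFinM; congr _%:E; rewrite mulrCA.
Qed.

End density.

Section semicircle_functional.
Context (R : realType).
Local Notation mu := (@lebesgue_measure R).

Definition sc_mean (f : R -> R) : R := fine (\int[mu]_x (f x * semicircle 2 x)%:E)%E.

Lemma sc_meanE (f : R -> R) : continuous f ->
  (\int[mu]_x (f x * semicircle 2 x)%:E)%E = (sc_mean f)%:E.
Proof.
by move=> cf; rewrite /sc_mean fineK // integrable_fin_num // integrable_semicircle.
Qed.

Lemma semicircle_ge0 (r x : R) : 0 <= semicircle r x.
Proof.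
rewrite /semicircle indicE mulr_ge0 // mulr_ge0 ?sqrtr_ge0 //.
by rewrite divr_ge0 // mulr_ge0 ?sqr_ge0 // pi_ge0.
Qed.

Lemma pos_functional_sc_mean : pos_functional sc_mean.
Proof.
split.
- move=> f g tf tg; apply: EFin_inj; rewrite -sc_meanE; last exact: (testD tf tg).1.
  rewrite EFinD -!sc_meanE ?tf.1 ?tg.1 //; [|exact: tg.1|exact: tf.1].
  rewrite -integralD //;
    [|exact: integrable_semicircle tf.1|exact: integrable_semicircle tg.1].
  by apply: eq_integral => x _; rewrite -EFinD mulrDl.
- move=> c f tf; apply: EFin_inj; rewrite -sc_meanE; last exact: (test_scale c tf).1.
  rewrite EFinM -sc_meanE; last exact: tf.1.
  rewrite -integralZl //; last exact: integrable_semicircle tf.1.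
  by apply: eq_integral => x _; rewrite -EFinM -mulrA.
- move=> f g tf tg fg; rewrite -lee_fin -!sc_meanE; [|exact: tg.1|exact: tf.1].
  apply: le_integral => //;
    [exact: integrable_semicircle tf.1|exact: integrable_semicircle tg.1|move=> x _].
  by rewrite lee_fin ler_wpM2r // semicircle_ge0.
Qed.

Lemma sc_mean1 : sc_mean (fun=> 1) = 1.
Proof. by rewrite -[RHS](sc_moment0 R). Qed.

Lemma sc_mean_even m : sc_mean (fun x => x ^+ m.*2) <= 4 ^+ m.
Proof.
have c1 := (@test_cst R (4 ^+ m)).1; have c2 := (@test_exp R m.*2).1.
have -> : 4 ^+ m = sc_mean (fun=> 4 ^+ m).
  have := pos_scale pos_functional_sc_mean (4 ^+ m) (@test_cst R 1).
  rewrite (_ : (fun _ => _ * 1) = (fun=> 4 ^+ m)); last by apply/funext => x;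
    rewrite mulr1.
  move=> ->; rewrite -[LHS]mulr1; congr (_ * _).
  by rewrite sc_mean1.
rewrite -lee_fin -!sc_meanE //.
apply: le_integral => //; [exact: integrable_semicircle..|move=> x _].
rewrite lee_fin; have [|xi] := boolP (x \in `[(-2)%R, 2%R]).
  rewrite in_itv /= => /andP[x1 x2]; rewrite ler_wpM2r ?semicircle_ge0 //.
  rewrite -mul2n exprM; apply: lerXn2r; rewrite ?nnegrE ?sqr_ge0 //; nra.
by rewrite /semicircle indicE memNset ?mulr0 //; exact/negP.
Qed.

End semicircle_functional.

(** Radius and rescaling satisfy r S = 2, so this is the change of variable between the semicircle
    of radius S and the one of radius 2; the prefactor is its Jacobian. *)
Lemma semicircle_rescaled (R : realType) (k : nat) (B : R) (N : nat) (x : R) :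
  0 < B -> (0 < N)%N ->
  semicircle (semicircle_radius k B N) x
  = rescaling k B N * semicircle 2 (rescaling k B N * x).
Proof.
move=> B0 N0.
set S := semicircle_radius k B N; set r := rescaling k B N.
have NN : 0 < N%:R :> R by rewrite ltr0n.
have kk : 0 < k.+1%:R :> R by rewrite ltr0n.
have S2 : S ^+ 2 = 2 * k.+1%:R * N%:R / B.
  by rewrite sqr_sqrtr // divr_ge0 ?(ltW B0) // mulr_ge0.
have r2 : r ^+ 2 = 2 * B / (k.+1%:R * N%:R) by exact: rescaling_sqr.
have r0 : 0 < r by exact: rescaling_gt0.
have S0 : 0 < S by rewrite sqrtr_gt0 divr_gt0 // mulr_gt0.
have rS : r * S = 2.
  apply/eqP; rewrite -(@eqrXn2 _ 2) ?mulr_ge0 ?(ltW r0) ?(ltW S0) //.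
  move: (k.+1%:R : R) kk S2 r2 => K kk S2 r2.
  by rewrite exprMn S2 r2; apply/eqP; field; rewrite !gt_eqF.
have rE : r = 2 / S by rewrite -rS mulfK // gt_eqF.
rewrite /semicircle.
have -> : \1_(`[- 2, 2] : set R) (r * x) = \1_(`[- S, S] : set R) x :> R.
  rewrite !indicE !mem_setE; congr (nat_of_bool _)%:R.
  by rewrite !in_itv /= -rS -mulrN !ler_pM2l.
have -> : Num.sqrt (2 ^+ 2 - (r * x) ^+ 2) = r * Num.sqrt (S ^+ 2 - x ^+ 2).
  by rewrite -{1}rS !exprMn -mulrBr sqrtrM ?sqr_ge0 // sqrtr_sqr gtr0_norm.
have p0 := @pi_gt0 R; move: (@pi R) p0 => q p0.
by rewrite rE; field; rewrite !gt_eqF.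
Qed.

Theorem propositionC1 (R : realType) (k : nat) (B : R) (hk : (1 <= k)%N)
    (hB : 0 < B) :
  (forall f : R -> R, continuous f -> (exists M : R, forall x, `|f x| <= M) ->
    (fun N : nat => E_g k B (density_scaled N (rescaling k B N) f)) @ \oo -->
      (\int[lebesgue_measure]_x (f x * semicircle 2 x)%:E)%E)
  /\
  (forall N : nat, (0 < N)%N -> forall x : R,
    semicircle (semicircle_radius k B N) x
    = rescaling k B N * semicircle 2 (rescaling k B N * x)).
Proof.
split=> [f cf [M fM]|N N0 x]; last exact: semicircle_rescaled.
have tf : test_fun f by split => //; exists M, 0%N => x; rewrite expr0 mulr1.
rewrite sc_meanE //.
have : mean_density k B N f @[N --> \oo] --> sc_mean f.
  apply: (@moments_weak_cvg R (mean_density k B) (@sc_mean R)) => //.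
  - by move=> N N0; exact: pos_functional_mean_density.
  - exact: pos_functional_sc_mean.
  (* Only single traces matter here; products of traces were needed to close the recursion. *)
  - move=> m; have := @model_moment_cvg R k B hB [:: m]; rewrite big_seq1.
    apply: cvg_trans; apply: near_eq_cvg; near=> N.
    rewrite mean_density_exp //; near: N; exact: nbhs_infty_gt.
  - exact: sc_mean1.
  - exact: sc_mean_even.
  - by exists M.
move=> h; have hE : ((mean_density k B N f)%:E @[N --> \oo] --> (sc_mean f)%:E)%E.
  by apply: cvg_EFin; [exact: nearW|exact: h].
apply: cvg_trans hE.
apply: near_eq_cvg; near=> N; rewrite /= E_gE //.
by near: N; exact: nbhs_infty_gt.
Unshelve. all: by end_near. Qed.
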